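(* Let $F$ be the function field of a smooth projective geometrically irreducible curve $X$ over $\mathbb{F}_q$, let $x$ be a place of $F$, and let $h_2=\#(\mathrm{Cl}\,F)[2]$. Label each vertex $[g]$ of $\mathcal{G}_x$ by the class of $\det g$ in $\mathrm{Cl}\,F/2\,\mathrm{Cl}\,F$. If the prime divisor $x$ is a square in the divisor class group (i.e. its class lies in $2\,\mathrm{Cl}\,F$), then all vertices in the same component of $\mathcal{G}_x$ have the same label, and there are $2h_2$ components, each of which has a different label. Otherwise, the vertices of each component have one of two labels that differ by the class of $x$ in $\mathrm{Cl}\,F/2\,\mathrm{Cl}\,F$, and two adjacent vertices have different labels, so each connected component is bipartite.
   Context: $\mathbb{A}$ is the adele ring of $F$, $\mathcal{O}_{\mathbb{A}}=\prod_y\mathcal{O}_y$, $G=\mathrm{PGL}_2$, $K=G(\mathcal{O}_{\mathbb{A}})$, $\kappa_x$ the residue field at $x$ and $\pi_x$ a uniformizer at $x$. $\mathrm{Cl}\,F=F^\times\backslash\mathbb{A}^\times/\mathcal{O}_{\mathbb{A}}^\times$ is the divisor class group and $(\mathrm{Cl}\,F)[2]$ its $2$-torsion. The label map is $$\det: G(F)\backslash G(\mathbb{A})/K\to F^\times\backslash\mathbb{A}^\times/\mathcal{O}_{\mathbb{A}}^\times\mathcal{Q}_{\mathbb{A}}\simeq\mathrm{Cl}\,F/2\,\mathrm{Cl}\,F,$$ where $\mathcal{Q}_{\mathbb{A}}$ is the group of squares in $\mathbb{A}^\times$. $\mathcal{G}_x$ is the graph of the unramified Hecke operator $\Phi_x$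 (the characteristic function of $K\begin{pmatrix}\pi_x&0\\0&1\end{pmatrix}K$, with $\pi_x$ viewed as an idele concentrated at $x$): its vertex set is $G(F)\backslash G(\mathbb{A})/K$, and there is an edge from $[g]$ to $[g']$ if and only if $[g']=[g\xi_w]$ for some $w\in\mathbb{P}^1(\kappa_x)$, where $\xi_w=\begin{pmatrix}\pi_x&b\\0&1\end{pmatrix}$ for $w=[1:b]$ and $\xi_w=\begin{pmatrix}1&0\\0&\pi_x\end{pmatrix}$ for $w=[0:1]$, placed in the component at $x$ (with $\kappa_x\subset F_x$). The existence of an edge is symmetric in its two end points. Components are connected components of the underlying unoriented graph. *)

(* Defs.v *)
From HB Require Import structures.
From Stdlib Require Import Relation_Operators.
From mathcomp Require Import all_boot all_order all_algebra all_field.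
From mathcomp Require Import finmap.
From mathcomp Require Import boolp classical_sets cardinality.

Set Implicit Arguments.
Unset Strict Implicit.
Unset Printing Implicit Defensive.

Import Order.TTheory GRing.Theory Num.Theory.
Local Open Scope classical_set_scope.
Local Open Scope ring_scope.

(** * Function fields *)

Definition constant (k : finFieldType) (F : fieldExtType {fraction {poly k}})
  (c : k) : F := (tofrac c%:P)%:A.

(* A finite extension F of k(t) is the function field of a smooth projective
   geometrically irreducible curve over k exactly when k is algebraically
   closed in F. *)
Definition constants_closed (k : finFieldType)
    (F : fieldExtType {fraction {poly k}}) : Prop :=
  forall a : F, algebraicOver (@constant k F) a -> exists c : k, a = constant F c.

(** * Discrete valuations, places, completions *)

(* Normalized discrete valuations.  The value at 0, which should be +oo, is set
   to 0, so that equal valuations are equal functions; [val_ge] below restores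
   the convention v(0) = +oo. *)
Record valuation (K : fieldType) := Valuation {
  val_fun :> K -> int;
  _ : val_fun 0 = 0;
  _ : forall a b, a != 0 -> b != 0 -> val_fun (a * b) = val_fun a + val_fun b;
  _ : forall a b, a != 0 -> b != 0 -> a + b != 0 ->
        Num.min (val_fun a) (val_fun b) <= val_fun (a + b);
  _ : exists2 a, a != 0 & val_fun a = 1
}.

Definition val_ge (K : fieldType) (v : valuation K) (n : int) (a : K) : bool :=
  (a == 0) || (n <= v a).

Definition valring (K : fieldType) (v : valuation K) : {pred K} :=
  [pred a | val_ge v 0 a].

Definition maxideal (K : fieldType) (v : valuation K) : {pred K} :=
  [pred a | val_ge v 1 a].

(* The closed points of a smooth projective curve are the normalized discrete
   valuations of its function field; triviality on the constants is automatic
   over a finite field, the group of nonzero constants being torsion. *)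
Definition place (F : fieldType) := valuation F.

HB.instance Definition _ (F : fieldType) := gen_eqMixin (place F).
HB.instance Definition _ (F : fieldType) := gen_choiceMixin (place F).

Definition cauchy (K : fieldType) (v : valuation K) (u : nat -> K) : Prop :=
  forall n : int, exists N : nat, forall i j : nat,
    (N <= i)%N -> (N <= j)%N -> val_ge v n (u i - u j).

Definition converges (K : fieldType) (v : valuation K) (u : nat -> K) (l : K)
    : Prop :=
  forall n : int, exists N : nat, forall i : nat,
    (N <= i)%N -> val_ge v n (u i - l).

Record completion (F : fieldType) (v : valuation F) := Completion {
  compl_field :> fieldType;
  compl_val : valuation compl_field;
  compl_emb : {rmorphism F -> compl_field};
  compl_embE : forall a : F, compl_val (compl_emb a) = v a;
  compl_dense : forall (a : compl_field) (n : int),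
    exists f : F, val_ge compl_val n (a - compl_emb f);
  compl_complete : forall u : nat -> compl_field,
    cauchy compl_val u -> exists l, converges compl_val u l
}.

Section ValringTheory.
Variables (K : fieldType) (v : valuation K).

Lemma val1 : v 1 = 0.
Proof.
case: v => f /= _ fM _ _.
by have := fM 1 1 (oner_neq0 _) (oner_neq0 _); rewrite mulr1 => /eqP;
  rewrite -subr_eq subrr => /eqP.
Qed.

Lemma valN a : v (- a) = v a.
Proof.
have [->|a0] := eqVneq a 0; first by rewrite oppr0.
have N1 : v (-1) = 0.
  have n0 : (-1 : K) != 0 by rewrite oppr_eq0 oner_neq0.
  have := val1; case: v => f /= _ fM _ _ f1.
  have := fM _ _ n0 n0; rewrite mulrNN mulr1 f1 => /esym/eqP.
  by rewrite -mulr2n mulrn_eq0 /= => /eqP.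
have n0 : (-1 : K) != 0 by rewrite oppr_eq0 oner_neq0.
by move: N1; case: v => f /= _ fM _ _ f1; rewrite -mulN1r fM // f1 add0r.
Qed.

Lemma valring0 : 0 \in valring v.
Proof. by rewrite inE /= /val_ge eqxx. Qed.

Lemma valring1 : 1 \in valring v.
Proof. by rewrite inE /= /val_ge val1 lexx orbT. Qed.

Lemma valringN a : a \in valring v -> - a \in valring v.
Proof. by rewrite !inE /= /val_ge oppr_eq0 valN. Qed.

Lemma valringD a b : a \in valring v -> b \in valring v -> a + b \in valring v.
Proof.
rewrite !inE /= /val_ge.
have [->|a0] := eqVneq a 0; first by rewrite add0r.
have [->|b0] := eqVneq b 0; first by rewrite addr0 (negPf a0).
have [//|ab0] := eqVneq (a + b) 0.
case: v => f /= _ _ fD _ va vb.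
by apply: le_trans (fD _ _ a0 b0 ab0); rewrite le_min va.
Qed.

Lemma valringM a b : a \in valring v -> b \in valring v -> a * b \in valring v.
Proof.
rewrite !inE /= /val_ge.
have [->|a0] := eqVneq a 0; first by rewrite mul0r eqxx.
have [->|b0] := eqVneq b 0; first by rewrite mulr0 eqxx.
rewrite mulf_eq0 (negPf a0) (negPf b0) /=.
by case: v => f /= _ fM _ _ va vb; rewrite fM // addr_ge0.
Qed.

End ValringTheory.

(* "kappa_y as a subset of F_y": a subfield of F_y, contained in O_y, on which
   reduction O_y -> O_y / m_y is bijective.  For a finite residue field in equal
   characteristic there is exactly one such subfield (the roots of unity of F_y
   of order prime to the characteristic, and 0). *)
Definition residue_subfield (K : fieldType) (v : valuation K) (S : {pred K})
    : Prop :=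
  [/\ divring_closed S,
      {subset S <= valring v} &
      forall a, a \in valring v ->
        exists! b, b \in S /\ a - b \in maxideal v].

Definition kappa (K : fieldType) (v : valuation K) : set K :=
  [set b | exists2 S : {pred K}, residue_subfield v S & b \in S].

(** * The adele ring *)

Section Adeles.
Variables (F : fieldType) (Fc : forall y : place F, completion y).

Local Notation O y := (valring (compl_val (Fc y))).

Record adele := Adele {
  adele_fun :> forall y : place F, Fc y;
  adele_fin : finite_set [set y | adele_fun y \notin O y]
}.

Lemma adele_ext (a b : adele) : (forall y, a y = b y) -> a = b.
Proof.
case: a b => [a afin] [b bfin] /= ab.
have ab' : a = b by apply: functional_extensionality_dep.
by case: _ / ab' bfin {ab} => bfin; rewrite (Prop_irrelevance afin bfin).
Qed.

HB.instance Definition _ := gen_eqMixin adele.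
HB.instance Definition _ := gen_choiceMixin adele.

Lemma adele0_fin : finite_set [set y | (0 : Fc y) \notin O y].
Proof. by apply: sub_finite_set (finite_set0 _) => y /=; rewrite valring0. Qed.

Lemma adele1_fin : finite_set [set y | (1 : Fc y) \notin O y].
Proof. by apply: sub_finite_set (finite_set0 _) => y /=; rewrite valring1. Qed.

Lemma adeleN_fin (a : adele) : finite_set [set y | - a y \notin O y].
Proof.
by apply: sub_finite_set (adele_fin a) => y /=; apply: contra => /valringN.
Qed.

Lemma adele2_fin (op : forall y, Fc y -> Fc y -> Fc y) (a b : adele) :
  (forall y s t, s \in O y -> t \in O y -> op y s t \in O y) ->
  finite_set [set y | op y (a y) (b y) \notin O y].
Proof.
move=> opO; have abfin : finite_set
    ([set y | a y \notin O y] `|` [set y | b y \notin O y]).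
  by rewrite finite_setU; split; apply: adele_fin.
apply: sub_finite_set abfin => y /=.
have [aO|/negP aO _] := boolP (a y \in O y); last by left; apply/negP.
have [bO|/negP bO _] := boolP (b y \in O y); last by right; apply/negP.
by rewrite opO.
Qed.

Definition adele0 : adele := Adele adele0_fin.
Definition adele1 : adele := Adele adele1_fin.
Definition adele_opp (a : adele) : adele := Adele (adeleN_fin a).
Definition adele_add (a b : adele) : adele :=
  @Adele (fun y => a y + b y)
    (adele2_fin a b (fun y => @valringD _ (compl_val (Fc y)))).
Definition adele_mul (a b : adele) : adele :=
  @Adele (fun y => a y * b y)
    (adele2_fin a b (fun y => @valringM _ (compl_val (Fc y)))).

Fact adele_addA : associative adele_add.
Proof. by move=> a b c; apply: adele_ext => y /=; rewrite addrA. Qed.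
Fact adele_addC : commutative adele_add.
Proof. by move=> a b; apply: adele_ext => y /=; rewrite addrC. Qed.
Fact adele_add0 : left_id adele0 adele_add.
Proof. by move=> a; apply: adele_ext => y /=; rewrite add0r. Qed.
Fact adele_addN : left_inverse adele0 adele_opp adele_add.
Proof. by move=> a; apply: adele_ext => y /=; rewrite addNr. Qed.

HB.instance Definition _ :=
  GRing.isZmodule.Build adele adele_addA adele_addC adele_add0 adele_addN.

Fact adele_mulA : associative adele_mul.
Proof. by move=> a b c; apply: adele_ext => y /=; rewrite mulrA. Qed.
Fact adele_mulC : commutative adele_mul.
Proof. by move=> a b; apply: adele_ext => y /=; rewrite mulrC. Qed.
Fact adele_mul1 : left_id adele1 adele_mul.
Proof. by move=> a; apply: adele_ext => y /=; rewrite mul1r. Qed.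
Fact adele_mulDl : left_distributive adele_mul +%R.
Proof. by move=> a b c; apply: adele_ext => y /=; rewrite mulrDl. Qed.

HB.instance Definition _ :=
  GRing.Zmodule_isComPzRing.Build adele adele_mulA adele_mulC adele_mul1
    adele_mulDl.

(* F diagonally embedded in the adeles; every element of F has finitely many
   poles, so this is all of F. *)
Definition diag_field : set adele :=
  [set a | exists f : F, forall y, a y = compl_emb (Fc y) f].

Definition int_adele : set adele := [set a | forall y, a y \in O y].

Lemma adele_at_fin (x : place F) (a : adele) (c : Fc x) :
  finite_set [set y | dfwith (T := fun y => Fc y) a c y \notin O y].
Proof.
have xfin : finite_set ([set x] `|` [set y | a y \notin O y]).
  by rewrite finite_setU; split; [exact: finite_set1|exact: adele_fin].
apply: sub_finite_set xfin => y /=.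
by have [->|yx] := eqVneq y x; [left|rewrite dfwith_out 1?eq_sym //; right].
Qed.

(* The adele with component c at x and the components of a elsewhere. *)
Definition adele_at (x : place F) (a : adele) (c : Fc x) : adele :=
  Adele (adele_at_fin a c).

End Adeles.

Arguments diag_field {F} Fc _.
Arguments int_adele {F} Fc _.

(** * Groups of units and invertible matrices over a subring *)

Definition units_of (R : comPzRingType) (S : set R) : set R :=
  [set a | S a /\ exists2 b, S b & a * b = 1].

Definition GL2 (R : comPzRingType) (S : set R) : set 'M[R]_2 :=
  [set g : 'M[R]_2 | (forall i j, S (g i j)) /\
     exists2 h : 'M[R]_2, (forall i j, S (h i j)) &
       g *m h = 1%:M /\ h *m g = 1%:M].

Definition mx2 (R : pzRingType) (a b c d : R) : 'M[R]_2 :=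
  block_mx a%:M b%:M c%:M d%:M : 'M_(1 + 1).

(** * Divisor classes, labels and the graph of the Hecke operator *)

Section Graph.
Variables (F : fieldType) (Fc : forall y : place F, completion y).

Local Notation A := (adele Fc).

Definition ideles : set A := units_of setT.

(* The element of F^* \ A^* / O_A^* = Cl F represented by the idele a, as a
   coset in A^*. *)
Definition idele_class (a : A) : set A :=
  [set b | exists2 f, units_of (diag_field Fc) f &
           exists2 u, units_of (int_adele Fc) u & b = f * a * u].

Definition twice_class_group : set (set A) :=
  [set idele_class (a * a) | a in ideles].

Definition class_group_2torsion : set (set A) :=
  [set C | exists2 a, ideles a &
             C = idele_class a /\ idele_class (a * a) = idele_class 1].

(* The element of F^* \ A^* / O_A^* Q_A = Cl F / 2 Cl F represented by the
   idele a, as a coset in A^*. *)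
Definition class_mod2 (a : A) : set A :=
  [set b | exists2 c, idele_class a c & exists2 s, ideles s & b = c * (s * s)].

(* PGL_2(A) = GL_2(A) / A^*, in which K = PGL_2(O_A) is the image of GL_2(O_A)
   and PGL_2(F) that of GL_2(F).  The double coset PGL_2(F) [g] PGL_2(O_A) is
   represented by its preimage in GL_2(A). *)
Definition dcoset (g : 'M[A]_2) : set 'M[A]_2 :=
  [set g' | exists2 gamma, GL2 (diag_field Fc) gamma &
            exists2 kap, GL2 (int_adele Fc) kap &
            exists2 z, ideles z & g' = z *: (gamma *m g *m kap)].

Definition vertices : set (set 'M[A]_2) := dcoset @` GL2 setT.

Definition label (g : 'M[A]_2) : set A := class_mod2 (\det g).

Variables (x : place F) (pix : Fc x).

(* pix as an idele concentrated at x; its class is the class of the prime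
   divisor x. *)
Definition idele_pi : A := adele_at 1 pix.

Definition matrix_at (M : 'M[Fc x]_2) : 'M[A]_2 :=
  \matrix_(i, j) adele_at ((1%:M : 'M[A]_2) i j) (M i j).

(* The elements of P^1(kappa_x): [Some b] is [1 : b] and [None] is [0 : 1]. *)
Definition P1_kappa : set (option (Fc x)) :=
  [set w | if w is Some b then kappa (compl_val (Fc x)) b else True].

Definition xi_local (w : option (Fc x)) : 'M[Fc x]_2 :=
  if w is Some b then mx2 pix b 0 1 else mx2 1 0 0 pix.

Definition xi (w : option (Fc x)) : 'M[A]_2 := matrix_at (xi_local w).

Definition edge (V W : set 'M[A]_2) : Prop :=
  exists2 g, GL2 setT g &
  exists2 w, P1_kappa w & V = dcoset g /\ W = dcoset (g *m xi w).

(* Connectedness in the underlying unoriented graph. *)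
Definition connected_in : set 'M[A]_2 -> set 'M[A]_2 -> Prop :=
  clos_refl_sym_trans _ edge.

Definition component (V : set 'M[A]_2) : set (set 'M[A]_2) :=
  [set W | vertices W /\ connected_in V W].

Definition components : set (set (set 'M[A]_2)) := component @` vertices.

Definition bipartite (C : set (set 'M[A]_2)) : Prop :=
  exists color : set 'M[A]_2 -> bool,
    forall V W, C V -> C W -> edge V W -> color V != color W.

End Graph.

Arguments ideles {F} Fc _.
Arguments twice_class_group {F} Fc _.
Arguments class_group_2torsion {F} Fc _.

(* Main.v *)
(** The label of a vertex changes by the class of x along an edge, so that
    everything but the number of components and the finiteness of the
    2-torsion is a computation with determinants.  Two vertices with the same
    label lie in one component by strong approximation for SL_2: an adelic
    matrix of determinant 1 is a product of elementary matrices, so strong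
    approximation for F away from x reduces it to a matrix at x, and GL_2(F_x)
    is generated by GL_2(O_x) and diag(1, pi_x).  When x is a square, the
    components are therefore in bijection with Cl F / 2 Cl F.  The quotient
    C = Cl F / <x> is finite and <x> is infinite cyclic, whence
    #(Cl F / 2 Cl F) = #(C / 2 C) = # C[2] = 2 # (Cl F)[2].

    The arithmetic of F is derived from a single counting principle: for z in
    F and a finite set U of digits, the number of expansions
    u_0 + u_1 z + ... + u_(n-1) z^(n-1) grows at most like c^n with c
    independent of U.  Hence R / zR is finite for every subring R containing
    z <> 0.  This makes valuation rings of F discrete and residue fields
    finite, bounds the number of zeros of a function, and, by comparing the
    growth of expansions, gives strong approximation away from x.  The
    finiteness of C is Hurwitz's argument, with the pole order at x as the
    Euclidean size on the ring of functions regular outside x. *)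

Require Import Defs.
From HB Require Import structures.
From mathcomp Require Import all_boot all_order all_algebra all_field.
From mathcomp Require Import finmap.
From mathcomp Require Import boolp classical_sets cardinality.
From mathcomp Require Import zify ring.
From Stdlib Require Import Relation_Operators.

Set Implicit Arguments.
Unset Strict Implicit.
Unset Printing Implicit Defensive.

Import Order.TTheory GRing.Theory Num.Theory.
Local Open Scope classical_set_scope.
Local Open Scope ring_scope.

(** * Valuations *)

(** The growth rate [c] depends on [z] alone: a digit set [U] enters only through a common
    denominator and a starting degree, which affect a constant factor. So digits that are pairwise
    incongruent modulo [z] number at most [c], uniformly in the subring. Places must be produced
    before they can be used: a nonconstant function receives a pole from a maximal subring
    (Chevalley), and counting shows that this valuation is discrete. Only then are the functions
    without poles known to form a finite list [k0], the form in which the hypothesis on constants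
    enters everything else.

    [Cl F] is infinite, so kernel and cokernel of doubling cannot be compared inside it. Write x =
    2c in [Cl F]. Since x has infinite order, the 2-torsion of [Cl F] injects into [C]. If 2a is a
    multiple nx, then a - nc is 2-torsion, and nc is 0 or c modulo x according to the parity of n.
    Thus the 2-torsion of [C] is the disjoint union of this image and its translate by c, whence the
    factor 2. Classes modulo doubles are the same for [Cl F] and [C] because x is a double. *)

Section ValuationTheory.
Variables (K : fieldType) (v : valuation K).
Implicit Types (a b : K) (m n : int).

Lemma valz0 : v 0 = 0.
Proof. by case: v. Qed.

Lemma valM a b : a != 0 -> b != 0 -> v (a * b) = v a + v b.
Proof. by case: v => f /= _ fM _ _; apply: fM. Qed.

Lemma val_unif : exists2 a, a != 0 & v a = 1.
Proof. by case: v. Qed.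

Lemma valV a : v a^-1 = - v a.
Proof.
have [->|a0] := eqVneq a 0; first by rewrite invr0 valz0 oppr0.
by apply/eqP; rewrite -addr_eq0 -valM ?invr_eq0 // mulVf // Defs.val1.
Qed.

Lemma valX a (i : nat) : v (a ^+ i) = v a *+ i.
Proof.
have [->|a0] := eqVneq a 0.
  by rewrite expr0n; case: i => [|i] /=; rewrite ?Defs.val1 // valz0 mul0rn.
by elim: i => [|i IH]; rewrite ?Defs.val1 // exprS mulrS valM ?expf_neq0 // IH.
Qed.

Lemma val_geE n a : a != 0 -> val_ge v n a = (n <= v a).
Proof. by rewrite /val_ge => /negPf ->. Qed.

Lemma val_ge0 n : val_ge v n 0.
Proof. by rewrite /val_ge eqxx. Qed.

Lemma val_ge_leq m n a : m <= n -> val_ge v n a -> val_ge v m a.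
Proof.
by move=> mn; rewrite /val_ge; case: eqVneq => //= _; apply: le_trans.
Qed.

Lemma val_geD n a b : val_ge v n a -> val_ge v n b -> val_ge v n (a + b).
Proof.
rewrite /val_ge.
have [->|a0] := eqVneq a 0; first by rewrite add0r.
have [->|b0] := eqVneq b 0; first by rewrite addr0 (negPf a0).
have [//|ab0] := eqVneq (a + b) 0.
case: v => f /= _ _ fD _ va vb.
by apply: le_trans (fD _ _ a0 b0 ab0); rewrite le_min va.
Qed.

Lemma val_geN n a : val_ge v n (- a) = val_ge v n a.
Proof. by rewrite /val_ge oppr_eq0 valN. Qed.

Lemma val_geB n a b : val_ge v n a -> val_ge v n b -> val_ge v n (a - b).
Proof. by move=> ga gb; rewrite val_geD // val_geN. Qed.

Lemma val_geM m n a b :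
  val_ge v m a -> val_ge v n b -> val_ge v (m + n) (a * b).
Proof.
rewrite /val_ge.
have [->|a0] := eqVneq a 0; first by rewrite mul0r eqxx.
have [->|b0] := eqVneq b 0; first by rewrite mulr0 eqxx.
by rewrite mulf_eq0 (negPf a0) (negPf b0) /= valM // => ? ?; apply: lerD.
Qed.

Lemma val_geMr n a b : val_ge v n a -> val_ge v 0 b -> val_ge v n (a * b).
Proof. by move=> ga gb; rewrite -[n]addr0 val_geM. Qed.

Lemma val_geV n a : n + v a <= 0 -> val_ge v n a^-1.
Proof. by rewrite /val_ge valV => ?; apply/orP; right; lia. Qed.

Lemma val_ge1 : val_ge v 0 1.
Proof. by rewrite /val_ge Defs.val1 lexx orbT. Qed.

Lemma val_ge_refl n a : v a = n -> val_ge v n a.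
Proof. by move=> <-; rewrite /val_ge lexx orbT. Qed.

Lemma val_geX n a (i : nat) : val_ge v n a -> val_ge v (n *+ i) (a ^+ i).
Proof.
by move=> ga; elim: i => [|i IH]; rewrite ?val_ge1 // exprS mulrS val_geM.
Qed.

Lemma val_ge0X a (i : nat) : val_ge v 0 a -> val_ge v 0 (a ^+ i).
Proof. by move/(val_geX i); rewrite mul0rn. Qed.

Lemma val_ge_sum n (I : Type) (r : seq I) (P : pred I) (f : I -> K) :
  (forall i, P i -> val_ge v n (f i)) -> val_ge v n (\sum_(i <- r | P i) f i).
Proof.
move=> gf; apply: (big_ind (fun a => val_ge v n a)) => //.
  exact: val_ge0.
by move=> a b; apply: val_geD.
Qed.

Lemma val_ge_div n a b : b != 0 -> val_ge v (n + v b) a -> val_ge v n (a / b).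
Proof.
move=> b0 ga; rewrite -[n](addrK (v b)) val_geM //.
by rewrite val_geE ?invr_eq0 // valV.
Qed.

(** Ultrametric perturbation. With [b = 1] it detects units; with [b] a power of a function it
    computes pole orders. *)
Lemma val_near a b : b != 0 -> val_ge v (v b + 1) (a - b) ->
  a != 0 /\ v a = v b.
Proof.
move=> b0 gab.
have a0 : a != 0.
  apply: contraTneq gab => ->; rewrite sub0r val_geN val_geE //.
  by rewrite -ltNge; lia.
split=> //; apply/eqP; rewrite eq_le; apply/andP; split.
  rewrite leNgt; apply/negP => ba.
  have : val_ge v (v b + 1) (a - (a - b)).
    by rewrite val_geB // val_geE //; lia.
  by rewrite subKr val_geE //; lia.
have : val_ge v (v b) ((a - b) + b).
  by apply: val_geD; [apply: val_ge_leq gab; lia|exact: val_ge_refl].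
by rewrite subrK val_geE.
Qed.

End ValuationTheory.

Lemma val_eq (K : fieldType) (v w : valuation K) : v =1 w -> v = w.
Proof.
case: v w => [f f1 f2 f3 f4] [g g1 g2 g3 g4] /= /funext fg.
by case: _ / fg in g1 g2 g3 g4 *; congr Valuation; apply: Prop_irrelevance.
Qed.

(** * Expansions and finiteness of quotients *)

(** Bernoulli's inequality [bern] makes [((c+1)/c)^n] unbounded, so [c < a] fails at [n = C * c];
    for [c = 0] the exponent 1 suffices. *)
Lemma exp_leq_growth (a c C : nat) :
  (forall n, a ^ n <= C * c ^ n)%N -> (a <= c)%N.
Proof.
move=> ub; rewrite leqNgt; apply/negP => ca.
have bern n : (c ^ n * (c + n) <= c.+1 ^ n * c)%N.
  elim: n => [|n IH]; first by rewrite !expn0 !mul1n addn0.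
  by rewrite !expnS; nia.
have := ub 1; rewrite !expn1 => ub1.
case: (posnP c) => [c0|c0]; first by nia.
have := bern (C * c)%N; have := ub (C * c)%N.
have : (c.+1 ^ (C * c) <= a ^ (C * c))%N by rewrite leq_exp2r // muln_gt0; nia.
have : (0 < c ^ (C * c))%N by rewrite expn_gt0 c0.
by nia.
Qed.

Section Subrings.
Variable T : pzRingType.

Definition is_subring (R : set T) :=
  [/\ R 1, forall a b, R a -> R b -> R (a - b)
    & forall a b, R a -> R b -> R (a * b)].

Variables (R : set T) (HR : is_subring R).

Lemma subring1 : R 1. Proof. by case: HR. Qed.

Lemma subringB a b : R a -> R b -> R (a - b).
Proof. by case: HR => _ RB _; apply: RB. Qed.

Lemma subringM a b : R a -> R b -> R (a * b).
Proof. by case: HR => _ _ RM; apply: RM. Qed.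

Lemma subring0 : R 0.
Proof. by rewrite -(subrr 1); apply: subringB; apply: subring1. Qed.

Lemma subringN a : R a -> R (- a).
Proof. by move=> Ra; rewrite -sub0r; apply: subringB => //; apply: subring0. Qed.

Lemma subringD a b : R a -> R b -> R (a + b).
Proof. by move=> Ra Rb; rewrite -[b]opprK; apply/subringB/subringN. Qed.

Lemma subringX a n : R a -> R (a ^+ n).
Proof.
move=> Ra; elim: n => [|n IH]; first by rewrite expr0; apply: subring1.
by rewrite exprS; apply: subringM.
Qed.

End Subrings.

Section Expansions.
Variable F : fieldType.
Implicit Types (z : F) (U : seq F) (R : set F).

Fixpoint expansions U z n : seq F :=
  if n is n'.+1 then [seq u + z * w | u <- U, w <- expansions U z n']
  else [:: 0].

Lemma size_expansions U z n : size (expansions U z n) = (size U ^ n)%N.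
Proof. by elim: n => //= n IH; rewrite size_allpairs IH expnS. Qed.

Definition incongruent R z U :=
  forall u u', u \in U -> u' \in U -> R ((u - u') / z) -> u = u'.

Lemma expansions_subring R z U n : is_subring R -> R z ->
  (forall u, u \in U -> R u) -> forall w, w \in expansions U z n -> R w.
Proof.
move=> HR Rz UR; elim: n => [|n IH] w /=.
  by rewrite inE => /eqP ->; apply: subring0.
case/allpairsP => -[u w'] /= [uU /IH Rw' ->].
by apply: subringD => //; [apply: UR|apply: subringM].
Qed.

(** The first digit is determined by the residue of the expansion modulo [zR], as the digits are
    incongruent; subtracting it and cancelling [z] leads to the remaining digits. *)
Lemma expansions_uniq R z U n : is_subring R -> R z -> z != 0 ->
  (forall u, u \in U -> R u) -> uniq U -> incongruent R z U ->
  uniq (expansions U z n).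
Proof.
move=> HR Rz z0 UR uU iU; elim: n => [//|n IH] /=.
apply: allpairs_uniq => // p p' /allpairsP[[u w] /= [uU1 wE ->]].
move=> /allpairsP[[u' w'] /= [uU' wE' ->]] /= eq_uw.
have uu' : u = u'.
  apply: iU => //; have -> : (u - u') / z = w' - w.
    apply: (mulIf z0); rewrite divfK // mulrBl ![_ * z]mulrC.
    by apply/eqP; rewrite -subr_eq0; apply/eqP; move: eq_uw => /eqP;
       rewrite -subr_eq0 => /eqP <-; ring.
  apply: subringB => //; first exact: (expansions_subring HR Rz UR wE').
  exact: (expansions_subring HR Rz UR wE).
by move: eq_uw; rewrite uu' => /addrI /(mulfI z0) ->.
Qed.

(** The order of quantifiers is the point: the rate [c] precedes the digit set [U]. Distinct values
    are counted, since arbitrary digits may give coinciding expansions. *)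
Definition growth_bounded z :=
  exists c : nat, forall U, exists C : nat, forall n,
    (size (undup (expansions U z n)) <= C * c ^ n)%N.

(** All [size U ^ n] expansions are distinct, so the growth rate bounds [size U]. The bound precedes
    [R], which allows [R] to be built from more than [c] given zeros of [z]. *)
Lemma incongruent_bound z : z != 0 -> growth_bounded z ->
  exists c : nat, forall R, is_subring R -> R z -> forall U, uniq U ->
    (forall u, u \in U -> R u) -> incongruent R z U -> (size U <= c)%N.
Proof.
move=> z0 [c gc]; exists c => R HR Rz U uU UR iU.
have [C ubC] := gc U; apply: (@exp_leq_growth _ _ C) => n.
rewrite -(size_expansions U z); apply: leq_trans (ubC n).
by rewrite undup_id //; apply: (expansions_uniq _ HR).
Qed.

(** An incongruent set of maximal size meets every class, since an element of a missing class could
    be added to it. *)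
Lemma subring_representatives R z : z != 0 -> growth_bounded z ->
  is_subring R -> R z ->
  exists U, [/\ uniq U, forall u, u \in U -> R u, incongruent R z U
    & forall a, R a -> exists2 u, u \in U & R ((a - u) / z)].
Proof.
move=> z0 gz HR Rz; have [c ubc] := incongruent_bound z0 gz.
pose Q U := [/\ uniq U, forall u, u \in U -> R u & incongruent R z U].
pose Pn n := `[< exists2 U, Q U & size U = n >].
have Pn0 : exists n, Pn n.
  by exists 0%N; apply/asboolP; exists [::] => //; split.
have Pnc n : Pn n -> (n <= c)%N.
  by case/asboolP => U [uU UR iU] <-; apply: ubc iU.
case: (ex_maxnP Pn0 Pnc) => n /asboolP[U [uU UR iU] sU] maxn.
exists U; split=> // a Ra; apply: contrapT => noU.
have sym u u' : R ((u - u') / z) -> R ((u' - u) / z).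
  by move/(subringN HR); rewrite -mulNr opprB.
have aU : a \notin U.
  apply/negP => aU; apply: noU; exists a => //.
  by rewrite subrr mul0r; apply: subring0.
suff : Pn n.+1 by move/maxn; rewrite ltnn.
apply/asboolP; exists (a :: U); last by rewrite /= sU.
split; first by rewrite /= aU.
  by move=> u; rewrite inE => /orP[/eqP ->|/UR].
move=> u u'; rewrite !inE => /orP[/eqP ->|uU1] /orP[/eqP ->|uU'] // Ruu'.
- by case: noU; exists u'.
- by case: noU; exists u => //; apply: sym.
- exact: iU.
Qed.

Lemma subring_pigeonhole R z : z != 0 -> growth_bounded z -> is_subring R ->
  R z -> exists c : nat, forall s : nat -> F, (forall i, R (s i)) ->
  exists i j, [/\ (i < j <= c)%N & R ((s i - s j) / z)].
Proof.
move=> z0 gz HR Rz.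
have [U [uU UR _ Ufull]] := subring_representatives z0 gz HR Rz.
exists (size U) => s Rs.
have /choice[r rP] : forall i, exists u, u \in U /\ R ((s i - u) / z).
  by move=> i; have [u] := Ufull _ (Rs i); exists u.
have nuniq : ~~ uniq [seq r i | i <- iota 0 (size U).+1].
  apply/negP => /uniq_leq_size sub.
  have /sub : {subset [seq r i | i <- iota 0 (size U).+1] <= U}.
    by move=> _ /mapP[i _ ->]; case: (rP i).
  by rewrite size_map size_iota ltnn.
have /(uniqPn 0)[i [j [ij js eqr]]] := nuniq.
exists i, j; rewrite size_map size_iota in js.
rewrite ij /= -ltnS js; split=> //.
move: eqr; rewrite !(nth_map 0%N) ?size_iota //; last by lia.
rewrite !nth_iota ?add0n //; last by lia.
move=> eqr; case: (rP i) => _ Ri; case: (rP j) => _ Rj.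
have := subringB HR Ri Rj; rewrite eqr -mulrBl.
by rewrite opprD opprK addrACA [- _ + _]addrC subrr addr0.
Qed.

End Expansions.

(** * Growth of expansions in a function field *)

Lemma fraction_denominator (R : idomainType) (a : {fraction R}) :
  exists2 d : R, d != 0 & exists n : R, tofrac d * a = tofrac n.
Proof.
elim/quotW: a => r; exists (frac r).2; first exact: denom_ratioP.
exists (frac r).1; apply/eqP.
rewrite piE /= FracField.equivfE /FracField.mulf /=.
have d0 := denom_ratioP r.
rewrite !numden_Ratio ?oner_neq0 ?mul1r // ?mulr1 // mulrC.
Qed.

Section Growth.
Variables (k : finFieldType) (F : fieldExtType {fraction {poly k}}).
Local Notation N := (\dim {:F}).
Local Notation e := (vbasis {:F}).
Implicit Types (a b z : F) (P D : {poly k}).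

(** [size] is the degree plus one, so this is a [k]-space of dimension [d * N], finite because [k]
    is. *)
Definition lattice (d : nat) a :=
  forall i, exists2 P : {poly k}, (size P <= d)%N & coord e i a = tofrac P.

Let coordE a : a = \sum_i coord e i a *: e`_i.
Proof. by apply: coord_vbasis; rewrite memvf. Qed.

Lemma lattice0 d : lattice d 0.
Proof. by move=> i; exists 0; rewrite ?size_poly0 // !linear0. Qed.

Lemma latticeD d a b : lattice d a -> lattice d b -> lattice d (a + b).
Proof.
move=> la lb i; have [P sP cP] := la i; have [Q sQ cQ] := lb i.
exists (P + Q); last by rewrite linearD /= cP cQ rmorphD.
by rewrite (leq_trans (size_polyD _ _)) // geq_max sP.
Qed.

Lemma lattice_sum d (I : finType) (f : I -> F) :
  (forall i, lattice d (f i)) -> lattice d (\sum_i f i).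
Proof.
move=> lf; apply: (big_ind (lattice d)) => //; first exact: lattice0.
exact: latticeD.
Qed.

Lemma lattice_leq c d a : (c <= d)%N -> lattice c a -> lattice d a.
Proof.
by move=> cd la i; have [P sP cP] := la i; exists P => //; apply: leq_trans cd.
Qed.

Lemma latticeZ c d P a : (size P <= c)%N -> lattice d a ->
  lattice (c + d).-1 (tofrac P *: a).
Proof.
move=> sP la i; have [Q sQ cQ] := la i.
exists (P * Q); last by rewrite linearZ /= cQ rmorphM.
by apply: leq_trans (size_polyMleq _ _) _; lia.
Qed.

Lemma lattice_denominator a : exists2 D : {poly k}, D != 0 &
  exists d, lattice d (tofrac D *: a).
Proof.
have /choice[D DP] : forall i, exists D : {poly k}, D != 0 /\
    exists n, tofrac D * coord e i a = tofrac n.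
  by move=> i; have [D D0 Dn] := fraction_denominator (coord e i a); exists D.
have /choice[n nP] := fun i => (DP i).2.
pose E i := \prod_(j | j != i) D j.
exists (\prod_i D i).
  by apply/prodf_neq0 => i _; case: (DP i).
exists (\max_i size (E i * n i)%R)%N => i; exists (E i * n i).
  exact: (@leq_bigmax 'I_N (fun i => size (E i * n i)%R) i).
by rewrite linearZ /= (bigD1 i) //= rmorphM mulrAC nP mulrC -rmorphM.
Qed.

Lemma lattice_denominators (U : seq F) : exists2 D : {poly k}, D != 0 &
  exists d, forall u, u \in U -> lattice d (tofrac D *: u).
Proof.
elim: U => [|u U [D D0 [d lD]]].
  by exists 1; rewrite ?oner_neq0 //; exists 0%N.
have [D' D'0 [d' lD']] := lattice_denominator u.
exists (D * D'); first by rewrite mulf_neq0.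
exists (size D + d' + (size D' + d))%N => w; rewrite inE rmorphM.
case/orP => [/eqP ->|/lD lw]; last rewrite mulrC.
  by rewrite -scalerA; apply: lattice_leq (latticeZ (leqnn _) lD'); lia.
by rewrite -scalerA; apply: lattice_leq (latticeZ (leqnn _) lw); lia.
Qed.

Lemma lattice_enum d : exists2 s : seq F,
  size s = ((#|k| ^ d) ^ N)%N & forall a, lattice d a -> a \in s.
Proof.
pose f (g : {ffun 'I_N -> d.-tuple k}) : F :=
  \sum_i tofrac (Poly (g i)) *: e`_i.
exists (codom f); first by rewrite size_codom card_ffun card_tuple card_ord.
move=> a la; have /choice[P PP] : forall i, exists P : {poly k},
    (size P <= d)%N /\ coord e i a = tofrac P.
  by move=> i; have [P sP cP] := la i; exists P.
pose g := [ffun i => [tuple (P i)`_j | j < d]] : {ffun 'I_N -> d.-tuple k}.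
apply/codomP; exists g; rewrite [LHS]coordE; apply: eq_bigr => i _.
have [sP ->] := PP i; congr (tofrac _ *: _); apply/polyP => j.
rewrite coef_Poly ffunE; case: (ltnP j d) => [jd|dj].
  by rewrite -(tnth_nth 0 _ (Ordinal jd)) tnth_mktuple.
by rewrite !nth_default ?size_tuple // (leq_trans sP).
Qed.

Lemma function_field_growth z : growth_bounded z.
Proof.
have [D D0 [c0 lz]] := lattice_denominators [seq z * e`_i | i : 'I_N].
(* [D] clears the denominators of the products of [z] with the basis; multiplication by [D] and by
   [D * z] then both raise the degree bound by at most [c]. *)
pose c := (size D + c0)%N.
have lD d a : lattice d a -> lattice (d + c) (tofrac D *: a).
  by move=> la; apply: lattice_leq (latticeZ (leqnn _) la); rewrite /c; lia.
have lDz d a : lattice d a -> lattice (d + c) (tofrac D *: (z * a)).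
  move=> la; rewrite [a]coordE mulr_sumr scaler_sumr; apply: lattice_sum => i.
  have [P sP ->] := la i; rewrite -scalerAr scalerA mulrC -scalerA.
  have /lz lzi : z * e`_i \in [seq z * e`_i | i : 'I_N].
    by apply/mapP; exists i; rewrite ?mem_enum.
  by apply: lattice_leq (latticeZ sP lzi); rewrite /c; lia.
exists (#|k| ^ (c * N))%N => U; have [E E0 [m lE]] := lattice_denominators U.
exists (#|k| ^ (m * N))%N => n.
(* With one factor [D] per digit, all expansions of length [n] fall into one lattice; the digits
   contribute only [E] and [m]. *)
have lexp w : w \in expansions U z n ->
    lattice (m + c * n) (tofrac (E * D ^+ n) *: w).
  elim: n w => [|n IH] w /=.
    by rewrite inE => /eqP ->; rewrite scaler0; apply: lattice0.
  case/allpairsP => -[u w'] /= [/lE lu /IH lw ->].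
  rewrite scalerDr; apply: latticeD.
    rewrite mulrC rmorphM -scalerA; elim: (n.+1) => [|j IHj].
      by rewrite expr0 rmorph1 scale1r; apply: lattice_leq lu; lia.
    rewrite exprS rmorphM -scalerA; apply: lattice_leq (lD _ _ IHj).
    by rewrite mulnS; lia.
  have -> : tofrac (E * D ^+ n.+1) *: (z * w') =
            tofrac D *: (z * (tofrac (E * D ^+ n) *: w')).
    by rewrite -scalerAr scalerA -rmorphM exprS mulrCA.
  by apply: lattice_leq (lDz _ _ lw); rewrite mulnS; lia.
have [s ss sP] := lattice_enum (m + c * n).
have -> : (#|k| ^ (m * N) * (#|k| ^ (c * N)) ^ n)%N = size s.
  rewrite ss -!expnM -expnD; congr (_ ^ _)%N; nia.
rewrite -(size_map (fun w => tofrac (E * D ^+ n) *: w)).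
apply: uniq_leq_size.
  rewrite map_inj_uniq ?undup_uniq //; apply: scalerI.
  by rewrite tofrac_eq0 mulf_neq0 ?expf_neq0.
by move=> _ /mapP[w + ->]; rewrite mem_undup => /lexp /sP.
Qed.

End Growth.

(** * Existence of places *)

Lemma exprB_div (F : fieldType) (a : F) m n : a != 0 -> (n <= m)%N ->
  a ^+ (m - n) = a ^+ m / a ^+ n.
Proof.
move=> a0 nm; apply: (mulIf (expf_neq0 n a0)).
by rewrite -exprD subnK // divfK // expf_neq0.
Qed.

(** * Valuation rings of a field with bounded growth are discrete *)

Section ValuationRings.
Variables (F : fieldType) (growthF : forall z : F, growth_bounded z).
Variables (R : set F) (HR : is_subring R).
Hypothesis Rval : forall a, R a \/ R a^-1.

Let nonunit a := [/\ a != 0, R a & ~ R a^-1].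
Let unit a := [/\ a != 0, R a & R a^-1].

(** Locality of a valuation ring: if [b / (1 - b)] lies in [R] it yields the inverse of [1 - b]; if
    its inverse does, [b] becomes a unit. *)
Let unit_1B b : nonunit b -> unit (1 - b).
Proof.
move=> [b0 Rb nRb].
have b1 : 1 - b != 0.
  rewrite subr_eq0; apply: contra_notN nRb => /eqP <-.
  by rewrite invr1; apply: subring1.
split=> //; first by apply: subringB => //; apply: subring1.
have [Rq|Rq] := Rval (b / (1 - b)).
  have -> : (1 - b)^-1 = 1 + b / (1 - b).
    by field.
  by apply: subringD => //; apply: subring1.
case: nRb; have -> : b^-1 = 1 + (b / (1 - b))^-1.
  by field; rewrite b0 b1.
by apply: subringD => //; apply: subring1.
Qed.

Let nonunitX b i : nonunit b -> nonunit (b ^+ i.+1).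
Proof.
move=> [b0 Rb nRb]; split; first by rewrite expf_neq0.
  exact: subringX.
move=> Rbi; apply: nRb; have -> : b^-1 = b ^+ i * (b ^+ i.+1)^-1.
  by rewrite exprS invfM mulrCA mulfV ?mulr1 // expf_neq0.
by apply: subringM => //; apply: subringX.
Qed.

(* Two powers of b agree modulo a, and 1 - b^(j-i) is a unit. *)
Let power_divisible a : a != 0 -> R a -> exists c, forall b, nonunit b ->
  exists2 i, (i < c)%N & R (b ^+ i / a).
Proof.
move=> a0 Ra; have [c cP] := subring_pigeonhole a0 (growthF a) HR Ra.
exists c.+1 => b nb; have [b0 Rb _] := nb.
have [//|i [j [/andP[ij jc] Rij]]] := cP (fun i => b ^+ i).
  by move=> i; apply: subringX.
exists i; first by rewrite ltnS (leq_trans _ jc) // ltnW.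
have [d0 _ Rd] := unit_1B (nonunitX (j - i).-1 nb).
have -> : b ^+ i / a = (b ^+ i - b ^+ j) / a * (1 - b ^+ (j - i).-1.+1)^-1.
  have -> : b ^+ i - b ^+ j = b ^+ i * (1 - b ^+ (j - i).-1.+1).
    by rewrite prednK ?subn_gt0 // mulrBr mulr1 -exprD subnKC // ltnW.
  by rewrite mulrAC mulfK.
exact: subringM.
Qed.

Variable z : F.
Hypothesis nz : nonunit z.

(** A nonunit [b] such that [b ^ n] divides [z] for the largest possible [n] works. That [n] is
    bounded comes from [power_divisible]: some [b ^ i] with [i < c] is already a multiple of [z]. *)
Let uniformizer : exists2 p, nonunit p & forall a, nonunit a -> R (a / p).
Proof.
have [z0 Rz nRz] := nz; have [c cP] := power_divisible z0 Rz.
pose P n := `[< exists2 b, nonunit b & R (z / b ^+ n) >].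
have P1 : exists n, P n.
  by exists 1%N; apply/asboolP; exists z; rewrite // divff //; apply: subring1.
have Pc n : P n -> (n <= c)%N.
  case/asboolP => b nb Rn; rewrite leqNgt; apply/negP => cn.
  have [i ic Ri] := cP b nb; have [b0 _ _] := nb.
  have [_ _] := nonunitX (n - i).-1 nb; case.
  have -> : (b ^+ (n - i).-1.+1)^-1 = (b ^+ i / z) * (z / b ^+ n).
    rewrite prednK ?subn_gt0 ?(ltn_trans ic) //.
    rewrite mulrA divfK // -[n in RHS](@subnK i); last by lia.
    by rewrite exprD invfM mulrCA mulfV ?mulr1 // expf_neq0.
  exact: subringM.
case: (ex_maxnP P1 Pc) => n /asboolP[b nb Rn] maxn.
exists b => // a na; have [a0 Ra nRa] := na; have [b0 Rb nRb] := nb.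
have [//|] := Rval (a / b); rewrite invf_div => Rr.
apply: contrapT => nRab.
have nr : nonunit (b / a).
  by split; rewrite ?mulf_neq0 ?invr_eq0 //; rewrite invf_div.
have n0 : (0 < n)%N.
  by apply: maxn; apply/asboolP; exists z; rewrite // divff //; apply: subring1.
(* If [a / b] is not in [R], then [b] is the product of the nonunits [a] and [b / a]. One of them
   divides the other, so its square divides [b] and its power [2 * n] divides [z], against the
   maximality of [n]. *)
suff [r nr' Rs] : exists2 r, nonunit r & R (b / r ^+ 2).
  have /maxn : P (2 * n)%N by
    apply/asboolP; exists r => //; have [r0 _ _] := nr';
    have -> : z / r ^+ (2 * n) = z / b ^+ n * (b / r ^+ 2) ^+ n;
    [rewrite expr_div_n -exprM mulrA divfK // expf_neq0
    |apply: subringM => //; apply: subringX].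
  by lia.
have [Rar|Rar] := Rval (a / (b / a)).
  exists (b / a) => //; have -> : b / (b / a) ^+ 2 = a / (b / a).
    by field; rewrite a0 b0.
  by [].
exists a => //; have -> : b / a ^+ 2 = (a / (b / a))^-1 by field; rewrite a0 b0.
by [].
Qed.

Let unitM a b : unit a -> unit b -> unit (a * b).
Proof.
move=> [a0 Ra Ra'] [b0 Rb Rb']; split; first by rewrite mulf_neq0.
  exact: subringM.
by rewrite invfM; apply: subringM.
Qed.

Let unitV a : unit a -> unit a^-1.
Proof. by move=> [a0 Ra Ra']; split; rewrite ?invr_eq0 // invrK. Qed.

(** The value of [a] is the exponent of the uniformizer that leaves a unit. For [a] in [R] it is the
    largest power of [p] dividing [a]: the quotient is a unit because every nonunit is a multiple of
    [p]. Inverses give the remaining elements. *)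
Lemma valuation_ring_place : exists2 v : place F, 0 < v z &
  forall a, R a -> val_ge v 0 a.
Proof.
have [p np pP] := uniformizer; have [p0 Rp nRp] := np.
have dec0 a : a != 0 -> R a -> exists n : int, unit (a / p ^ n).
  move=> a0 Ra; have [c cP] := power_divisible a0 Ra.
  pose P n := `[< R (a / p ^+ n) >].
  have P0 : exists n, P n by exists 0%N; apply/asboolP; rewrite expr0 divr1.
  have Pc n : P n -> (n <= c)%N.
    move=> /asboolP Rn; rewrite leqNgt; apply/negP => cn.
    have [i ic Ri] := cP p np; have [_ _] := nonunitX (n - i).-1 np; case.
    have -> : (p ^+ (n - i).-1.+1)^-1 = (p ^+ i / a) * (a / p ^+ n).
      rewrite prednK ?subn_gt0 ?(ltn_trans ic) //.
      rewrite mulrA divfK // -[n in RHS](@subnK i); last by lia.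
      by rewrite exprD invfM mulrCA mulfV ?mulr1 // expf_neq0.
    exact: subringM.
  case: (ex_maxnP P0 Pc) => n /asboolP Rn maxn; exists n%:Z.
  have r0 : a / p ^+ n != 0 by rewrite mulf_neq0 ?invr_eq0 ?expf_neq0.
  split=> //; apply: contrapT => nR.
  have : P n.+1.
    apply/asboolP; have := pP _ (And3 r0 Rn nR).
    by rewrite exprSr invfM mulrA.
  by move/maxn; rewrite ltnn.
have /choice[f fP] : forall a, exists n : int, a != 0 -> unit (a / p ^ n).
  move=> a; have [->|a0] := eqVneq a 0; first by exists 0.
  have [/(dec0 _ a0)[n un]|Ra] := Rval a; first by exists n.
  have [|n un] := dec0 _ _ Ra; first by rewrite invr_eq0.
  by exists (- n) => _; have := unitV un; rewrite invfM invrK !invr_expz.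
have unitp n : unit (p ^ n) -> n = 0.
  suff pos i : ~ unit (p ^+ i.+1).
    case: n => [[|i]|i] // u; first by case: (pos i).
    by case: (pos i); have := unitV u; rewrite NegzE invr_expz opprK.
  by case=> _ _; case: (nonunitX i np).
have fE a n : a != 0 -> unit (a / p ^ n) -> f a = n.
  move=> a0 un; apply/eqP; rewrite eq_sym -subr_eq0; apply/eqP/unitp.
  have -> : p ^ (n - f a) = (a / p ^ f a) / (a / p ^ n).
    by rewrite expfzDr // -invr_expz; field; rewrite a0 !expfz_neq0.
  by apply: unitM; [apply: fP|apply: unitV].
pose v a := if a == 0 then 0 else f a.
have vE a : a != 0 -> v a = f a by rewrite /v => /negPf ->.
have fpos a : a != 0 -> R a -> 0 <= f a.
  move=> a0 Ra; have [n un] := dec0 a a0 Ra; rewrite (fE a n) //.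
  rewrite leNgt; apply/negP => n0; case: nRp.
  case: n n0 un => // n _; rewrite NegzE => -[_ Rn Rn'].
  have -> : p^-1 = p ^+ n * a * (a / p ^ (- n.+1%:Z))^-1.
    rewrite invf_div -invr_expz -[p ^ _]/(p ^+ n.+1) exprS.
    by field; rewrite ?a0 ?p0 ?expf_neq0.
  by apply: subringM => //; apply: subringM => //; apply: subringX.
have fR a : a != 0 -> 0 <= f a -> R a.
  move=> a0; case E : (f a) => [n|//] _; have [_ Ru _] := fP a a0.
  rewrite -[a](@divfK _ (p ^+ n)) ?expf_neq0 //.
  by rewrite E in Ru; apply: (subringM HR Ru); apply: subringX.
have fM a b : a != 0 -> b != 0 -> f (a * b) = f a + f b.
  move=> a0 b0; apply: fE; first by rewrite mulf_neq0.
  by rewrite expfzDr // invfM mulrACA; apply: unitM; apply: fP.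
have v0 : v 0 = 0 by rewrite /v eqxx.
have vM a b : a != 0 -> b != 0 -> v (a * b) = v a + v b.
  by move=> a0 b0; rewrite !vE ?mulf_neq0 // fM.
have vD a b : a != 0 -> b != 0 -> a + b != 0 ->
    Num.min (v a) (v b) <= v (a + b).
  move=> a0 b0 ab0; rewrite !vE //.
  wlog le_ab : a b a0 b0 ab0 / f a <= f b.
    move=> W; case/orP: (le_total (f a) (f b)) => [/W|ba]; first exact.
    by rewrite minC addrC; apply: W; rewrite // addrC.
  rewrite (min_idPl le_ab).
  have fV c : c != 0 -> f c^-1 = - f c.
    move=> c0; apply/eqP; rewrite -addr_eq0 -fM ?invr_eq0 // mulVf //.
    apply/eqP/fE; rewrite ?oner_neq0 // expr0z divr1.
    by split; rewrite ?oner_neq0 ?invr1 //; apply: subring1.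
  have := fpos ((a + b) / a); rewrite fM ?invr_eq0 // fV // subr_ge0; apply.
    by rewrite mulf_neq0 ?invr_eq0.
  rewrite mulrDl divff //; apply: subringD => //; first exact: subring1.
  by apply: fR; rewrite ?mulf_neq0 ?invr_eq0 // fM ?invr_eq0 // fV // subr_ge0.
have v1 : exists2 a, a != 0 & v a = 1.
  exists p => //; rewrite vE //; apply: fE => //; rewrite expr1z divff //.
  by split; rewrite ?oner_neq0 ?invr1 //; apply: subring1.
exists (Valuation v0 vM vD v1) => /=.
  have [z0 Rz nRz] := nz; rewrite vE // lt_neqAle fpos // andbT eq_sym.
  apply: contra_notN nRz => /eqP fz; have [_ _] := fP z z0.
  by rewrite fz expr0z divr1.
move=> a Ra; rewrite /val_ge; case: eqVneq => //= a0.
by rewrite vE // fpos.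
Qed.

End ValuationRings.

(** * Valuation rings as maximal subrings (Chevalley) *)

Section MaximalSubrings.
Variables (F : fieldType) (A0 : set F) (z : F).
Hypotheses (HA0 : is_subring A0) (A0z : A0 z) (nA0z : ~ A0 z^-1).

Let P (A : set F) := A = set0 \/ [/\ is_subring A, A0 `<=` A & ~ A z^-1].

Let P_bigcup (C : set (set F)) : C `<=` P -> total_on C subset ->
  P (\bigcup_(X in C) X).
Proof.
move=> CP Ctot.
have [[A [CA [a Aa]]]|noA] :=
  pselect (exists A, C A /\ exists a, A a); last first.
  left; apply/seteqP; split=> // a [A CA Aa]; case: noA.
  by exists A; split=> //; exists a.
have PA B b : C B -> B b -> [/\ is_subring B, A0 `<=` B & ~ B z^-1].
  by move=> /CP[->|].
have [HA sA _] := PA A a CA Aa; right.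
have common b c : (\bigcup_(X in C) X) b -> (\bigcup_(X in C) X) c ->
    exists B, [/\ C B, is_subring B, B b & B c].
  move=> [B CB Bb] [D CD Dc]; have [BD|DB] := Ctot _ _ CB CD.
    by exists D; split=> //; [case: (PA D c)|apply: BD].
  by exists B; split=> //; [case: (PA B b)|apply: DB].
split.
- split; first by exists A => //; apply: subring1.
    move=> b c /common cb /cb[B [CB HB Bb Bc]].
    by exists B => //; apply: subringB.
  move=> b c /common cb /cb[B [CB HB Bb Bc]].
  by exists B => //; apply: subringM.
- by move=> b /sA Ab; exists A.
- by move=> [B CB Bz]; case: (PA B _ CB Bz).
Qed.

Let over (R : set F) (p : {poly F}) := forall i, R p`_i.

Let adjoin_subring R y : is_subring R ->
  is_subring [set a | exists2 p, over R p & a = p.[y]].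
Proof.
move=> HR; have over_sum n (f : nat -> F) : (forall i, R (f i)) ->
    R (\sum_(i < n) f i).
  by move=> Rf; elim/big_ind: _ => //; [exact: subring0|exact: subringD].
split.
- exists 1; last by rewrite hornerC.
  by move=> i; rewrite coef1; case: eqP => _; [apply: subring1|apply: subring0].
- move=> _ _ [p pR ->] [q qR ->]; exists (p - q); last by rewrite hornerD hornerN.
  by move=> i; rewrite coefB; apply: subringB.
- move=> _ _ [p pR ->] [q qR ->]; exists (p * q); last by rewrite hornerM.
  move=> i; rewrite coefM.
  elim/big_ind: _ => [|a b|j _]; [exact: subring0|exact: subringD|].
  exact: subringM.
Qed.

(** A subring over [A0] that is maximal for missing [z^-1] is a valuation ring. If it contained
    neither [a] nor [a^-1], adjoining either would produce [z^-1], and of two such expressions of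
    minimal degree the shorter reduces the longer. *)
Lemma maximal_subring : exists R, [/\ is_subring R, R z, ~ R z^-1
  & forall a, R a \/ R a^-1].
Proof.
have [R [PR maxR]] := Zorn_bigcup P_bigcup.
have [HR sR nRz] : [/\ is_subring R, A0 `<=` R & ~ R z^-1].
  case: PR => // R0; have /maxR : R `<` A0.
    rewrite R0; split=> // /(_ _ (subring1 HA0)); exact.
  by case; right; split.
have Rz : R z by apply: sR.
have z0 : z != 0.
  by apply: contra_notN nRz => /eqP ->; rewrite invr0; apply: subring0.
exists R; split=> //.
have adjoin y : ~ R y -> exists2 p, over R p & p.[y] = z^-1.
  move=> nRy; apply: contrapT => nop.
  have sub : R `<` [set a | exists2 p, over R p & a = p.[y]].
    split=> [a Ra|/(_ y) sub].
      exists a%:P; last by rewrite hornerC.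
      by move=> i; rewrite coefC; case: eqP => // _; apply: subring0.
    apply/nRy/sub; exists 'X; last by rewrite hornerX.
    by move=> i; rewrite coefX; case: eqP => _; [apply: subring1|apply: subring0].
  apply: (maxR _ sub); right; split; first exact: adjoin_subring.
    by move=> a /sR Ra; case: sub => + _; apply.
  by move=> [p pR pz]; apply: nop; exists p.
(* If [u = 1 - z * w] were not invertible in [R], adjoining [u^-1] would reach [z^-1]. Then some
   power of [u] is a multiple of [z] while being congruent to 1 modulo [z], which puts [z^-1] in
   [R]. *)
have unit1 w : R w -> R (1 - z * w)^-1.
  move=> Rw; apply: contrapT => nRu.
  have u0 : 1 - z * w != 0.
    by apply: contra_notN nRu => /eqP ->; rewrite invr0; apply: subring0.
  have [p pR pz] := adjoin _ nRu; set u := 1 - z * w in u0 nRu pz.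
  have Ru : R u by apply: subringB; [|apply: subring1|apply: subringM].
  have [r Rr ur] : exists2 r, R r & u ^+ size p = z * r.
    exists (\sum_(i < size p) p`_i * u ^+ (size p - i)).
      elim/big_ind: _ => [|a b|i _]; [exact: subring0|exact: subringD|].
      by apply: subringM => //; apply: subringX.
    apply: (mulfI (invr_neq0 z0)); rewrite mulKf // -pz horner_coef mulr_suml.
    apply: eq_bigr => i _; rewrite -mulrA exprVn; congr (_ * _).
    by rewrite (exprB_div u0) 1?mulrC // ltnW.
  have [s Rs us] : exists2 s, R s & u ^+ size p = 1 - z * s.
    elim: (size p) => [|n [s Rs us]].
      by exists 0; [apply: subring0|rewrite mulr0 subr0 expr0].
    exists (s + w - z * w * s); last by rewrite exprS us /u; ring.
    by apply: subringB => //; [apply: subringD|do 2!apply: subringM => //].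
  apply: nRz; have -> : z^-1 = r + s.
    apply: (mulfI z0); rewrite mulfV // mulrDr -ur us; ring.
  exact: subringD.
have minp y : ~ R y -> exists p, [/\ over R p, p.[y] = z^-1 &
    forall q, over R q -> q.[y] = z^-1 -> (size p <= size q)%N].
  move=> /adjoin[p pR pz].
  pose Q n := `[< exists p, [/\ over R p, p.[y] = z^-1 & size p = n] >].
  have Q0 : exists n, Q n by exists (size p); apply/asboolP; exists p.
  case: (ex_minnP Q0) => n /asboolP[q [qR qz <-]] minq.
  by exists q; split=> // r rR rz; apply: minq; apply/asboolP; exists r.
suff desc y p q : y != 0 -> over R p -> p.[y] = z^-1 -> over R q ->
    q.[y^-1] = z^-1 -> (size q <= size p)%N ->
    exists2 p', over R p' & p'.[y] = z^-1 /\ (size p' < size p)%N.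
  move=> a; apply: contrapT => /not_orP[nRa nRa'].
  have a0 : a != 0.
    by apply: contra_notN nRa => /eqP ->; apply: subring0.
  have [p [pR pz minP]] := minp _ nRa; have [q [qR qz minQ]] := minp _ nRa'.
  have [qp|/ltnW pq] := leqP (size q) (size p).
    have [p' p'R [p'z]] := desc _ _ _ a0 pR pz qR qz qp.
    by rewrite ltnNge minP.
  have [|p' p'R [p'z]] := desc _ q p (invr_neq0 a0) qR qz pR _ pq.
    by rewrite invrK.
  by rewrite ltnNge minQ.
move=> y0 pR pz qR qz qp.
have [n sp] : exists n, size p = n.+1.
  case E : (size p) => [|n]; last by exists n.
  move/eqP: E; rewrite size_poly_eq0 => /eqP p0.
  by move/esym/eqP: pz; rewrite p0 horner0 invr_eq0 (negPf z0).
(* Multiplied by [z * y ^ n], the equation [q.[y^-1] = z^-1] expresses [u * y ^ n] through lower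
   powers of [y]. Since [u] is a unit, this replaces the leading term of [p]. *)
pose u := 1 - z * q`_0.
have u0 : u != 0.
  apply/eqP => u0; apply: nRz; have -> : z^-1 = q`_0; last by [].
  by apply: (mulfI z0); rewrite mulfV //; apply/eqP; rewrite -subr_eq0 -/u u0.
exists (\poly_(i < n) (p`_i + p`_n * z * q`_(n - i) / u)).
  move=> i; rewrite coef_poly; case: ifP => _; last exact: subring0.
  apply: subringD => //; apply: subringM => //; last exact: unit1.
  by apply: subringM => //; apply: subringM.
split; last by rewrite sp ltnS size_poly.
rewrite horner_poly -pz (@horner_coef_wide _ n.+1 p) ?sp //.
rewrite big_ord_recr /=.
under eq_bigr do rewrite mulrDl.
rewrite big_split /=; congr (_ + _).
have qsum : \sum_(i < n) q`_(n - i) * y ^+ i = y ^+ n * (z^-1 - q`_0).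
  have qn : (size q <= n.+1)%N by rewrite -sp.
  rewrite -qz (horner_coef_wide _ qn) big_ord_recl /=.
  rewrite expr0 mulr1 addrC addKr mulr_sumr (reindex_inj rev_ord_inj) /=.
  apply: eq_bigr => i _; rewrite /bump /= add1n subKn ?ltn_ord //.
  rewrite mulrCA exprVn; congr (_ * _).
  by rewrite (exprB_div y0).
transitivity (p`_n * z / u * \sum_(i < n) q`_(n - i) * y ^+ i).
  by rewrite mulr_sumr; apply: eq_bigr => i _; ring.
rewrite qsum; apply: (mulIf u0); rewrite /u; field.
by rewrite -/u u0 z0.
Qed.

End MaximalSubrings.

(** A transcendental [a] lies outside [k[a^-1]], so some valuation ring contains [k[a^-1]] but not
    [a]; its place is a pole of [a]. *)
Lemma place_with_pole (k F : fieldType) (phi : {rmorphism k -> F}) (a : F) :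
  (forall z : F, growth_bounded z) -> ~ algebraicOver phi a ->
  exists v : place F, v a < 0.
Proof.
move=> growthF nalg.
have a0 : a != 0.
  apply: contra_notN nalg => /eqP ->; exists 'X; first by rewrite polyX_eq0.
  by rewrite map_polyX rootE hornerX.
pose A0 := [set b | exists p : {poly k}, b = (map_poly phi p).[a^-1]].
have HA0 : is_subring A0.
  split; first by exists 1; rewrite rmorph1 hornerC.
    by move=> _ _ [p ->] [q ->]; exists (p - q); rewrite rmorphB hornerD hornerN.
  by move=> _ _ [p ->] [q ->]; exists (p * q); rewrite rmorphM hornerM.
have A0z : A0 a^-1 by exists 'X; rewrite map_polyX hornerX.
have nA0 : ~ A0 a^-1^-1.
  rewrite invrK => -[p ap]; apply: nalg; pose n := size p.
  (* Multiplying [a = p(a^-1)] by [a ^ n] gives a monic equation of degree [n.+1]. The constant term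
     of the reversed polynomial is the coefficient of [p] at [n], which vanishes because [n] is the
     size of [p]. *)
  exists ('X^(n.+1) - \poly_(i < n.+1) p`_(n - i)).
    apply/eqP => /(congr1 (fun q : {poly k} => q`_n.+1)).
    rewrite coefB coefXn eqxx coef_poly ltnn subr0 coef0 => /eqP.
    by rewrite oner_eq0.
  rewrite rootE rmorphB /= map_polyXn hornerD hornerN hornerXn subr_eq0.
  apply/eqP; rewrite exprS {1}ap -/n.
  rewrite [in LHS](@horner_coef_wide _ n) ?size_map_poly //.
  have -> : map_poly phi (\poly_(i < n.+1) p`_(n - i)) =
            \poly_(i < n.+1) phi p`_(n - i).
    apply/polyP => i; rewrite coef_map !coef_poly.
    by case: ifP => _ /=; rewrite ?rmorph0.
  rewrite horner_poly [in RHS](reindex_inj rev_ord_inj) big_ord_recr /=.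
  rewrite subnn subn0 nth_default // rmorph0 mul0r addr0.
  rewrite mulr_suml; apply: eq_bigr => i _.
  have le_in : (i <= n)%N by apply/ltnW/ltn_ord.
  rewrite coef_map subSS subKn // -mulrA exprVn; congr (_ * _).
  by rewrite (exprB_div a0) // mulrC.
have [R [HR Rz nRz Rval]] := maximal_subring HA0 A0z nA0.
have [|v vz _] := @valuation_ring_place _ growthF R HR Rval a^-1.
  by split; rewrite ?invr_eq0.
by exists v; move: vz; rewrite valV; lia.
Qed.

(** * Approximation for finitely many places *)

Section WeakApproximation.
Variable F : fieldType.
Implicit Types (v w y : place F) (a b : F).
Implicit Types (s : seq (place F)) (S : set (place F)).

(** The choices of [S] that matter are all places (functions without poles), the complement of one
    place or of the poles of a function (functions with a given polar set), and a finite set (a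
    semilocal ring). *)
Definition integral_on S : set F := [set a | forall y, S y -> val_ge y 0 a].

Lemma integral_on_subring S : is_subring (integral_on S).
Proof.
split=> [y _|a b aS bS y Sy|a b aS bS y Sy]; first exact: val_ge1.
  by rewrite val_geB ?aS ?bS.
by rewrite -[0]addr0 val_geM ?aS ?bS.
Qed.

Lemma val_exprz v a (n : int) : v (a ^ n) = v a * n.
Proof.
case: n => n; rewrite ?NegzE -?invr_expz ?valV -[a ^ _]/(a ^+ _) valX.
  by rewrite -mulr_natr natz.
by rewrite -mulr_natr natz mulrN.
Qed.

(** Units of [v] are units of [w], so [w] is an integer multiple of [v]; as both are normalized, the
    factor is 1. *)
Lemma valring_subset_eq v w :
  (forall a, val_ge v 0 a -> val_ge w 0 a) -> v = w.
Proof.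
move=> vw; have w0 a : a != 0 -> v a = 0 -> w a = 0.
  move=> a0 va; have := vw a; have := vw a^-1.
  rewrite !val_geE ?invr_eq0 // !valV va oppr0 lexx.
  by move=> /(_ isT) + /(_ isT); lia.
have [p p0 vp] := val_unif v.
have wE a : a != 0 -> w a = w p * v a.
  move=> a0; have /w0 : a / p ^ v a != 0.
    by rewrite mulf_neq0 ?invr_eq0 ?expfz_neq0.
  rewrite !valM ?invr_eq0 ?expfz_neq0 // !valV !val_exprz vp mul1r subrr.
  by move=> /(_ erefl); lia.
have [q q0 wq] := val_unif w.
have wp : 0 <= w p by have := vw p; rewrite !val_geE // vp; apply.
have wp1 : w p = 1.
  have := wE q q0; rewrite wq => e1.
  have vq : 0 < v q by rewrite ltNge; apply/negP => vq; nia.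
  by nia.
apply: val_eq => a; have [->|a0] := eqVneq a 0; first by rewrite !valz0.
by rewrite wE // wp1 mul1r.
Qed.

Lemma separate2 v w : v != w -> exists2 a, v a < 0 & 0 < w a.
Proof.
have sub v1 v2 : v1 != v2 -> exists2 a, 0 <= v1 a & v2 a < 0.
  move=> /eqP ne; apply: contrapT => noa; apply: ne.
  apply: valring_subset_eq => a; have [->|a0] := eqVneq a 0.
    by move=> _; apply: val_ge0.
  rewrite !val_geE // => v1a; rewrite leNgt; apply/negP => v2a.
  by apply: noa; exists a.
have nz v1 a : v1 a < 0 -> a != 0.
  by apply: contraTneq => ->; rewrite valz0.
move=> vw; have [a va wa] := sub _ _ vw.
have [b wb vb] : exists2 b, 0 <= w b & v b < 0 by apply: sub; rewrite eq_sym.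
exists (b / a); rewrite valM ?invr_eq0 ?(nz _ _ wa) ?(nz _ _ vb) // valV; lia.
Qed.

Lemma val_1DX_pole v a n : v a < 0 ->
  1 + a ^+ n.+1 != 0 /\ v (1 + a ^+ n.+1) = v a *+ n.+1.
Proof.
move=> va; have a0 : a != 0 by apply: contraTneq va => ->; rewrite valz0.
rewrite -valX; apply: val_near; first by rewrite expf_neq0.
rewrite addrK val_geE ?oner_neq0 // Defs.val1 valX; nia.
Qed.

Lemma val_1DX_zero v a n : 0 < v a ->
  1 + a ^+ n.+1 != 0 /\ v (1 + a ^+ n.+1) = 0.
Proof.
move=> va; have a0 : a != 0 by apply: contraTneq va => ->; rewrite valz0.
rewrite -(Defs.val1 v); apply: val_near; first exact: oner_neq0.
by rewrite addrAC subrr add0r val_geE ?expf_neq0 // Defs.val1 valX; nia.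
Qed.

Lemma separate v s : v \notin s ->
  exists2 a, v a < 0 & forall w, w \in s -> 0 < w a.
Proof.
elim: s => [_|w s IH].
  have [p p0 vp] := val_unif v; exists p^-1 => //.
  by rewrite valV vp.
rewrite inE negb_or => /andP[vw /IH[a va sa]] {IH}.
have [c vc wc] := separate2 vw.
have a0 : a != 0 by apply: contraTneq va => ->; rewrite valz0.
have c0 : c != 0 by apply: contraTneq vc => ->; rewrite valz0.
pose n := (\sum_(y <- s) `|y c|)%N.
have nP y : y \in s -> (`|y c| <= n)%N.
  by move=> ys; rewrite /n (big_rem y) //= leq_addr.
(* If [w a < 0], the factor [a ^ n.+1 / (1 + a ^ n.+1)] is close to 1 at the poles of [a] and close
   to 0 at its zeros, so [c] decides at [v] and [w]. If [w a = 0], the power of [a] is neutral at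
   [w]. The exponent outweighs [c] on [s]. *)
have [wa|wa|wa] := ltgtP (w a) 0.
- have [u0 vu] := val_1DX_pole n va; have [_ wu] := val_1DX_pole n wa.
  exists (a ^+ n.+1 * c / (1 + a ^+ n.+1)).
    by rewrite !valM ?mulf_neq0 ?expf_neq0 ?invr_eq0 // valV vu valX; lia.
  move=> y; rewrite inE => /orP[/eqP->|ys].
    by rewrite !valM ?mulf_neq0 ?expf_neq0 ?invr_eq0 // valV wu valX; lia.
  have [_ yu] := val_1DX_zero n (sa y ys).
  rewrite !valM ?mulf_neq0 ?expf_neq0 ?invr_eq0 // valV yu valX.
  by have := nP y ys; have := sa y ys; nia.
- by exists a => // y; rewrite inE => /orP[/eqP->//|/sa].
- exists (a ^+ n.+1 * c).
    by rewrite valM ?expf_neq0 // valX; nia.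
  move=> y; rewrite inE => /orP[/eqP->|ys]; rewrite valM ?expf_neq0 // valX.
    by rewrite wa mul0rn add0r.
  by have := nP y ys; have := sa y ys; nia.
Qed.

Lemma approximate_delta v s (n : nat) : v \notin s ->
  exists2 a, val_ge v n (a - 1) & forall w, w \in s -> val_ge w n a.
Proof.
move=> /separate[a va sa].
have [u0 vu] := val_1DX_pole n va.
exists (a ^+ n.+1 / (1 + a ^+ n.+1)).
  have -> : a ^+ n.+1 / (1 + a ^+ n.+1) - 1 = - (1 + a ^+ n.+1)^-1 by field.
  by rewrite val_geN; apply: val_geV; rewrite vu; nia.
move=> w ws; have [_ wu] := val_1DX_zero n (sa w ws).
apply: val_ge_div => //; rewrite wu addr0.
have a0 : a != 0 by apply: contraTneq va => ->; rewrite valz0.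
by rewrite val_geE ?expf_neq0 // valX; have := sa w ws; nia.
Qed.

Lemma weak_approximation s (f : place F -> F) (n : nat) : uniq s ->
  exists a, forall y, y \in s -> val_ge y n (a - f y).
Proof.
move=> us.
(* [m] bounds the pole orders of all target values at all places of [s], so the delta functions are
   taken [m] orders closer than requested. *)
pose m := (\sum_(y <- s) \sum_(w <- s) `|w (f y)|)%N.
have mP y w : y \in s -> w \in s -> (`|w (f y)| <= m)%N.
  move=> ys ws; rewrite /m (big_rem y) //= (big_rem w) //=.
  by rewrite -addnA leq_addr.
have /choice[e eP] : forall y, exists a, y \in s ->
    val_ge y (n + m)%N (a - 1) /\
    forall w, w \in s -> w != y -> val_ge w (n + m)%N a.
  move=> y; have [ys|ys] := boolP (y \in s); last by exists 0.
  have [|a ya wa] := @approximate_delta y (rem y s) (n + m).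
    by rewrite mem_rem_uniq // inE eqxx.
  exists a => _; split=> // w ws wy; apply: wa.
  by rewrite mem_rem_uniq // inE wy.
have fge y w : y \in s -> w \in s -> val_ge w (- m%:Z) (f y).
  move=> ys ws; have [->|f0] := eqVneq (f y) 0; first exact: val_ge0.
  by rewrite val_geE //; have := mP y w ys ws; lia.
exists (\sum_(y <- s) e y * f y) => y ys.
have nm : n%:Z = (n + m)%N%:Z - m%:Z by lia.
rewrite (big_rem y) //= addrAC -{2}[f y]mul1r -mulrBl; apply: val_geD.
  by rewrite nm; apply: val_geM; [case: (eP y ys)|apply: fge].
rewrite big_seq; apply: val_ge_sum => w.
rewrite mem_rem_uniq // inE => /andP[wy ws].
rewrite nm; apply: val_geM; last exact: fge.
by case: (eP w ws) => _; apply; rewrite // eq_sym.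
Qed.

Hypothesis growthF : forall z : F, growth_bounded z.

(** Approximate delta functions at distinct zeros of [a] are incongruent modulo [a] in the ring of
    functions integral at those zeros, so at most [c] zeros exist. For [a = 0] the set is empty
    because the value at 0 is set to 0. *)
Lemma finite_zeros a : finite_set [set y : place F | 0 < y a].
Proof.
have [->|a0] := eqVneq a 0.
  by apply: sub_finite_set (finite_set0 _) => y /=; rewrite valz0.
apply: contrapT => inf; have [c cP] := incongruent_bound a0 (growthF a).
have [B sB cB] := infinite_set_fset c.+1 inf.
pose s := enum_fset B; have us : uniq s by apply: fset_uniq.
have /choice[e eP] : forall y, exists b, y \in s ->
    val_ge y 1 (b - 1) /\ forall w, w \in s -> w != y -> val_ge w 1 b.
  move=> y; have [ys|ys] := boolP (y \in s); last by exists 0.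
  have [|b yb wb] := @approximate_delta y (rem y s) 1.
    by rewrite mem_rem_uniq // inE eqxx.
  exists b => _; split=> // w ws wy; apply: wb.
  by rewrite mem_rem_uniq // inE wy.
pose R := integral_on [set` s].
have inj y w : y \in s -> w \in s -> R ((e y - e w) / a) -> y = w.
  move=> ys ws Ryw; apply: contrapT => /eqP yw.
  have := Ryw y ys.
  have [ey _] := eP y ys; have [_ ew] := eP w ws; have {}ew := ew y ys yw.
  have [|d0 vd] := @val_near _ y (e y - e w) 1 (oner_neq0 _).
    by rewrite Defs.val1 addrAC; apply: val_geB.
  rewrite val_geE ?mulf_neq0 ?invr_eq0 // valM ?invr_eq0 // valV vd Defs.val1.
  by have := sB y ys; rewrite /=; lia.
have HR : is_subring R by apply: integral_on_subring.
suff : (size [seq e y | y <- s] <= c)%N by rewrite size_map leqNgt cB.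
apply: (cP R) => //.
- by move=> y ys; rewrite val_geE // ltW //; apply: sB.
- rewrite map_inj_in_uniq // => y w ys ws eyw; apply: inj => //.
  by rewrite eyw subrr mul0r; apply: subring0.
- move=> _ /mapP[y ys ->] w ws; have [->|wy] := eqVneq w y.
    rewrite -[e y](subrK 1); apply: val_geD; last exact: val_ge1.
    by apply: val_ge_leq (eP y ys).1.
  by apply: val_ge_leq (proj2 (eP y ys) w ws wy).
- by move=> _ _ /mapP[y ys ->] /mapP[w ws ->] /inj -> .
Qed.

Lemma finite_val_neq0 a : finite_set [set y : place F | y a != 0].
Proof.
have : finite_set
    ([set y : place F | 0 < y a] `|` [set y : place F | 0 < y a^-1]).
  by rewrite finite_setU; split; apply: finite_zeros.
apply: sub_finite_set => y /=; rewrite valV; case: (ltgtP (y a) 0) => ya _ //.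
  by right; lia.
by left.
Qed.

End WeakApproximation.

(** * Functions with poles in a given polar set *)

Section PolarRing.
Variables (F : fieldType) (growthF : forall z : F, growth_bounded z).
Implicit Types (x y : place F) (a b u p t : F).

Definition poles t : set (place F) := [set y | y t < 0].

Lemma finite_poles t : finite_set (poles t).
Proof.
by apply: sub_finite_set (finite_val_neq0 growthF t) => y; apply: ltr0_neq0.
Qed.

Lemma valring_pigeonhole y (n : nat) : exists c : nat, forall s : nat -> F,
  (forall i, val_ge y 0 (s i)) ->
  exists i j, (i < j <= c)%N /\ val_ge y n (s i - s j).
Proof.
have [p p0 yp] := val_unif y.
have pn0 : p ^+ n != 0 by rewrite expf_neq0.
have [||c cP] := @subring_pigeonhole _ (integral_on [set y]) _ pn0 (growthF _).
- exact: integral_on_subring.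
- by move=> _ ->; apply: val_ge0X; rewrite val_geE // yp.
exists c => s sP; have [|i [j [ij Rij]]] := cP s; first by move=> i _ ->.
exists i, j; split=> //; rewrite -[s i - s j](divfK pn0) mulrC.
apply: val_geMr; last exact: Rij.
by rewrite val_geE // valX yp; lia.
Qed.

Section FixedFunction.
Variables (t : F) (x : place F).
Hypothesis xt : poles t x.
Local Notation P := (poles t).
Local Notation R := (integral_on (~` poles t)).
Local Notation OP := (integral_on (poles t)).

Let t0 : t != 0.
Proof. by apply: contraTneq xt => ->; rewrite /poles /= valz0. Qed.

Let HR : is_subring R. Proof. exact: integral_on_subring. Qed.
Let HOP : is_subring OP. Proof. exact: integral_on_subring. Qed.

Lemma polar_ring_self : R t.
Proof. by move=> y /negP; rewrite /= -leNgt => yt; rewrite val_geE. Qed.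

Let OPtV : OP t^-1.
Proof.
move=> y yt; rewrite val_geE ?invr_eq0 // valV.
by move: yt; rewrite /poles /=; lia.
Qed.

(* "p is a monic polynomial of degree d in t", up to functions that are
   integral at the poles of t. *)
Definition monic_in (d : nat) p := R p /\ OP ((p / t ^+ d - 1) * t).

Lemma monic_inM d e p q : monic_in d p -> monic_in e q ->
  monic_in (d + e) (p * q).
Proof.
move=> [Rp OPp] [Rq OPq]; split; first exact: (subringM HR).
have -> : (p * q / t ^+ (d + e) - 1) * t =
  ((p / t ^+ d - 1) * t) * (1 + ((q / t ^+ e - 1) * t) * t^-1) +
  (q / t ^+ e - 1) * t.
  by rewrite exprD; field; rewrite t0 !expf_neq0.
apply: (subringD HOP) => //; apply: (subringM HOP) => //.
by apply: (subringD HOP); [apply: (subring1 HOP)|apply: (subringM HOP)].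
Qed.

Lemma monic_in1 : monic_in 0 1.
Proof.
split; first exact: (subring1 HR).
by rewrite expr0 divr1 subrr mul0r; apply: (subring0 HOP).
Qed.

Lemma monic_inX d p i : monic_in d p -> monic_in (d * i) (p ^+ i).
Proof.
move=> mp; elim: i => [|i IH]; first by rewrite muln0; apply: monic_in1.
by rewrite exprS mulnS; apply: monic_inM.
Qed.

Lemma monic_in_val d p : monic_in d p -> p != 0 /\ x p = x t *+ d.
Proof.
move=> [_ OPp]; have td0 : t ^+ d != 0 by rewrite expf_neq0.
have [|q0 vq] := @val_near _ x (p / t ^+ d) 1 (oner_neq0 _).
  rewrite Defs.val1 -[_ - 1](mulfK t0); apply: (@val_geM _ x 0 1).
    exact: OPp.
  by apply: val_geV; move: xt; rewrite /poles /=; lia.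
have p0 : p != 0 by apply: contraNneq q0 => ->; rewrite mul0r.
split=> //; move: vq; rewrite valM ?invr_eq0 // valV valX Defs.val1; lia.
Qed.

(** Two powers of [t] agree in the finite residue field at [y]. Their difference is monic in [t] and
    vanishes at [y]; its [n]th power vanishes to order [n]. *)
Lemma monic_in_vanishing y (n : nat) : ~ P y ->
  exists d p, monic_in d p /\ val_ge y n p.
Proof.
move=> nPy; have [c cP] := valring_pigeonhole y 1.
have yt : val_ge y 0 t by apply: polar_ring_self.
have [|i [j [/andP[ij _] yij]]] := cP (fun i => t ^+ i).
  by move=> i; apply: val_ge0X.
exists (j * n)%N, ((t ^+ j - t ^+ i) ^+ n); split; last first.
  have yji : val_ge y 1 (t ^+ j - t ^+ i) by rewrite -opprB val_geN.
  by have := val_geX n yji; rewrite natz.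
apply: monic_inX; split.
  by apply: (subringB HR); apply: (subringX HR); apply: polar_ring_self.
have -> : ((t ^+ j - t ^+ i) / t ^+ j - 1) * t = - t^-1 ^+ (j - i).-1.
  have E : t ^+ j = t ^+ i * (t ^+ (j - i).-1 * t).
    by rewrite -exprSr -exprD prednK ?subn_gt0 // subnKC // ltnW.
  by rewrite E exprVn; field; rewrite t0 !expf_neq0.
by apply: (subringN HOP); apply: (subringX HOP).
Qed.

Lemma monic_in_vanishing_seq (s : seq (place F)) (n : nat) :
  (forall y, y \in s -> ~ P y) ->
  exists d p, monic_in d p /\ forall y, y \in s -> val_ge y n p.
Proof.
elim: s => [_|y s IH nP]; first by exists 0%N, 1; split=> //; apply: monic_in1.
have [|d [p [mp vp]]] := IH; first by move=> w ws; apply: nP; rewrite inE ws orbT.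
have nPy : ~ P y by apply: nP; rewrite mem_head.
have [e [q [mq vq]]] := monic_in_vanishing n nPy.
exists (d + e)%N, (p * q); split; first exact: monic_inM.
move=> w; rewrite inE => /orP[/eqP ->|ws].
  by rewrite mulrC; apply: val_geMr => //; case: mp => + _; apply.
apply: val_geMr; first exact: vp.
by case: mq => + _; apply; apply: nP; rewrite inE ws orbT.
Qed.

(** Zeros of [p] are placed at the poles of [u] outside [P]; keeping [p] monic in [t] controls its
    polar part along [P]. *)
Lemma clear_denominator u : exists d p, monic_in d p /\ R (p * u).
Proof.
have [s sP] := (finite_seqP _).1 (finite_poles u).
pose n := (\sum_(y <- s) `|y u|)%N.
have nE y : y \in s -> (`|y u| <= n)%N.
  by move=> ys; rewrite /n (big_rem y) //= leq_addr.
have [|d [p [mp vp]]] := @monic_in_vanishing_seq [seq y <- s | `[< ~ P y >]] n.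
  by move=> y; rewrite mem_filter => /andP[/asboolP].
exists d, p; split=> // y nPy.
have [ys|ys] := boolP (y \in s).
  have u0 : u != 0.
    have : poles u y by rewrite sP.
    by apply: contraPneq => ->; rewrite /poles /= valz0.
  apply: (@val_ge_leq _ _ _ (n%:Z - n%:Z)); first by rewrite subrr.
  apply: val_geM; first by apply: vp; rewrite mem_filter ys andbT; apply/asboolP.
  by rewrite val_geE //; have := nE y ys; lia.
rewrite mulrC; apply: val_geMr; last by case: mp => + _; apply.
have [->|u0] := eqVneq u 0; first exact: val_ge0.
rewrite val_geE // leNgt; apply/negP => yu.
by move/negP: ys; apply; have : poles u y by []; rewrite sP.
Qed.

Lemma clear_denominators (U : seq F) : exists d p,
  monic_in d p /\ forall u, u \in U -> R (p * u).
Proof.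
elim: U => [|u U [d [p [mp pU]]]].
  by exists 0%N, 1; split=> //; apply: monic_in1.
have [e [q [mq qu]]] := clear_denominator u.
exists (d + e)%N, (p * q); split; first exact: monic_inM.
move=> w; rewrite inE => /orP[/eqP ->|/pU Rw].
  by rewrite -mulrA; apply: (subringM HR) => //; case: mp.
by rewrite mulrAC; apply: (subringM HR) => //; case: mq.
Qed.

(* A weak form of Riemann's inequality: adding functions without poles outside
   P reduces the polar parts along P to a bounded size. *)
Lemma polar_part_reduction : exists d : nat, forall a,
  exists2 g, R g & OP ((a - g) / t ^+ d).
Proof.
have tV0 : t^-1 != 0 by rewrite invr_eq0.
have [U [_ UOP _ Ufull]] := subring_representatives tV0 (growthF _) HOP OPtV.
have [d [p [mp pU]]] := clear_denominators U; exists d => a.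
have [s sP] := (finite_seqP _).1 (finite_poles t).
have [r OPr] : exists r : nat, OP (a / t ^+ (d + r)).
  pose r := (\sum_(y <- s) `|y a|)%N; exists r => y Py.
  have [->|a0] := eqVneq a 0; first by rewrite mul0r val_ge0.
  have ys : y \in s by move: Py; rewrite sP.
  have yr : (`|y a| <= r)%N by rewrite /r (big_rem y) //= leq_addr.
  apply: val_ge_div; rewrite ?expf_neq0 // val_geE // valX.
  by move: Py; rewrite /poles /=; nia.
elim: r a OPr => [|n IH] a OPn.
  exists 0; first exact: (subring0 HR).
  by rewrite subr0; rewrite addn0 in OPn.
(* [p * u] has no pole outside [P] and behaves like [t ^ d * u] along [P], so subtracting
   [t ^ n.+1 * (p * u)] removes the top digit, of order [d + n.+1]. The final bound [d] is the
   degree of the common denominator [p]. *)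
have [u uU OPu] := Ufull _ OPn.
have [|g Rg OPg] := IH (a - t ^+ n.+1 * (p * u)).
  have -> : (a - t ^+ n.+1 * (p * u)) / t ^+ (d + n) =
     (a / t ^+ (d + n.+1) - u) / t^-1 - u * ((p / t ^+ d - 1) * t).
    by rewrite addnS !exprS !exprD; field; rewrite t0 oner_neq0 !expf_neq0.
  by apply: (subringB HOP) => //; apply: (subringM HOP); [apply: UOP|case: mp].
exists (g + t ^+ n.+1 * (p * u)).
  apply: (subringD HR) => //; apply: (subringM HR); last exact: pU.
  by apply: (subringX HR); apply: polar_ring_self.
by move: OPg; rewrite opprD addrA addrAC.
Qed.

End FixedFunction.

(* Take a with a pole at x and zeros at the other poles of 1/p; the reduced
   polar parts of the powers of a take finitely many values. *)
Lemma function_with_single_pole x :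
  exists2 t : F, poles t x & integral_on (~` [set x]) t.
Proof.
have [p p0 xp] := val_unif x; pose t := p^-1.
have xt : poles t x by rewrite /poles /= valV xp.
have t0 : t != 0 by rewrite invr_eq0.
have [s sP] := (finite_seqP _).1 (finite_poles t).
have [|a xa sa] := @separate _ x [seq y <- s | y != x].
  by rewrite mem_filter eqxx.
have {}sa : forall y, poles t y -> y != x -> 0 < y a.
  move=> y yt yx; apply: sa; rewrite mem_filter yx.
  by have : poles t y by []; rewrite sP.
have a0 : a != 0 by apply: contraTneq xa => ->; rewrite valz0.
have [d dP] := polar_part_reduction xt.
have /choice[g gP] : forall i : nat, exists g, integral_on (~` poles t) g /\
    integral_on (poles t) ((a ^+ i - g) / t ^+ d).
  by move=> i; have [g] := dP (a ^+ i); exists g.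
have td0 : t^-1 ^+ d != 0 by rewrite expf_neq0 ?invr_eq0.
have [||c cP] := @subring_pigeonhole _ (integral_on (poles t)) _ td0 (growthF _).
- exact: integral_on_subring.
- move=> y yt; apply: val_ge0X; apply: val_geV; rewrite add0r ltW //.
have [|i [j [/andP[ij _] OPij]]] := cP (fun i => (a ^+ i - g i) / t ^+ d).
  by move=> i; case: (gP i).
have {}OPij : integral_on (poles t) ((a ^+ i - g i) - (a ^+ j - g j)).
  by move: OPij; rewrite -mulrBl exprVn invrK divfK ?expf_neq0.
have hE : g j - g i = a ^+ j - a ^+ i + ((a ^+ i - g i) - (a ^+ j - g j)).
  by ring.
exists (g j - g i).
  have [||h0 vh] := @val_near _ x (g j - g i) (a ^+ j).
  - by rewrite expf_neq0.
  - have -> : g j - g i - a ^+ j = ((a ^+ i - g i) - (a ^+ j - g j)) - a ^+ i.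
      by rewrite hE; ring.
    apply: val_geB.
      apply: val_ge_leq (OPij x xt); rewrite valX; nia.
    by rewrite val_geE ?expf_neq0 // !valX; nia.
  by rewrite /poles /= vh valX; nia.
move=> y /= /eqP yx; have [yt|yt] := pselect (poles t y); last first.
  by apply: val_geB; [case: (gP j)|case: (gP i)] => + _; apply.
rewrite hE; apply: val_geD; last exact: OPij.
by apply: val_geB; apply: val_ge0X; rewrite val_geE // ltW // sa.
Qed.

End PolarRing.

(** * Strong approximation and finiteness of the class group *)

Section StrongApproximation.
Variables (F : fieldType) (growthF : forall z : F, growth_bounded z).
Variable k0 : seq F.
Hypothesis k0P : forall a, integral_on setT a -> a \in k0.
Variable x : place F.
Implicit Types (y : place F) (a b c p : F) (s : seq (place F)).

Local Notation B := (integral_on (~` [set x])).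

Let HB : is_subring B. Proof. exact: integral_on_subring. Qed.

(** A zero at [x] would make the powers of [a] infinitely many functions without poles. This stands
    in for the degree formula. *)
Lemma integral_val_le0 a : B a -> x a <= 0.
Proof.
move=> Ba; rewrite leNgt; apply/negP => xa.
have a0 : a != 0 by apply: contraTneq xa => ->; rewrite valz0.
have ak i : a ^+ i \in k0.
  apply: k0P => y _; apply: val_ge0X.
  have [->|/eqP yx] := eqVneq y x; last exact: Ba.
  by rewrite val_geE // ltW.
have /uniq_leq_size sub : uniq [seq a ^+ i | i <- iota 0 (size k0).+1].
  rewrite map_inj_uniq ?iota_uniq // => i j /(congr1 x); rewrite !valX; nia.
have /sub : {subset [seq a ^+ i | i <- iota 0 (size k0).+1] <= k0}.
  by move=> _ /mapP[i _ ->].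
by rewrite size_map size_iota ltnn.
Qed.

Section FixedFunction.
Variable t : F.
Hypotheses (xt : x t < 0) (Bt : B t).

Let t0 : t != 0.
Proof. by apply: contraTneq xt => ->; rewrite valz0. Qed.

Let polest : poles t = [set x].
Proof.
apply/seteqP; split=> [y yt|_ ->//]; apply: contrapT => /Bt.
by rewrite val_geE //; move: yt; rewrite /poles /=; lia.
Qed.

Let xpole : poles t x. Proof. by []. Qed.

Let clear (U : seq F) : exists c,
  [/\ B c, c != 0 & forall u, u \in U -> B (c * u)].
Proof.
have [d [c [mc cU]]] := clear_denominators growthF xpole U.
exists c; rewrite -polest; split=> //; first by case: mc.
by case: (monic_in_val xpole mc).
Qed.

Let vanishing s (n : nat) : x \notin s ->
  exists p, [/\ B p, p != 0, x p < 0 & forall y, y \in s -> val_ge y n p].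
Proof.
move=> xs.
have [|d [p [mp vp]]] := monic_in_vanishing_seq growthF xpole (s := s) n.
  by move=> y ys; rewrite polest => yx; rewrite -yx ys in xs.
have [p0 xp] := monic_in_val xpole mp.
exists (p * t); split.
- by apply: (subringM HB) => //; rewrite -polest; case: mp.
- by rewrite mulf_neq0.
- by rewrite valM // xp; nia.
- move=> y ys; apply: val_geMr; first exact: vp.
  by apply: Bt => yx; rewrite -yx ys in xs.
Qed.

(** The residue of [a * t^-n] modulo [t^-n] at [x] records the polar part of [a]. Two elements of
    [B] with the same residue differ by one of the finitely many functions without poles. *)
Lemma bounded_pole_finite (n : nat) : exists s : seq F,
  forall a, B a -> val_ge x (- n%:Z) a -> a \in s.
Proof.
have z0 : t^-1 ^+ n != 0 by rewrite expf_neq0 ?invr_eq0.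
pose O := integral_on [set x].
have HO : is_subring O by apply: integral_on_subring.
have Oz : O (t^-1 ^+ n).
  by move=> _ ->; apply: val_ge0X; apply: val_geV; rewrite add0r ltW.
have [U [_ _ _ Ufull]] := subring_representatives z0 (growthF _) HO Oz.
pose L a u := B a /\ O ((a * t^-1 ^+ n - u) / t^-1 ^+ n).
have /choice[h hP] : forall u, exists a, (exists b, L b u) -> L a u.
  move=> u; have [[b Lb]|nob] := pselect (exists b, L b u); first by exists b.
  by exists 0 => /nob.
exists [seq h u + c | u <- U, c <- k0] => a Ba xa.
have [|u uU Ou] := Ufull (a * t^-1 ^+ n).
  move=> _ ->; rewrite -(addNr n%:Z); apply: val_geM => //.
  by rewrite val_geE // valX valV; nia.
have [Bh Oh] : L (h u) u by apply: hP; exists a.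
apply/allpairsP; exists (u, a - h u); split=> //=; last by rewrite addrC subrK.
apply: k0P => y _; have [->|/eqP yx] := eqVneq y x; last first.
  exact: (subringB HB Ba Bh y yx).
have := subringB HO Ou Oh; rewrite -mulrBl.
have -> : a * t^-1 ^+ n - u - (h u * t^-1 ^+ n - u) = (a - h u) * t^-1 ^+ n.
  by ring.
by rewrite mulfK //; apply.
Qed.

(* Base-p expansions with digits in U, multiplied by a common denominator,
   embed into base-p expansions of elements of B with digits in U0. *)
Lemma incongruent_leq p (Z : set (place F)) (U U0 : seq F) :
  B p -> x p < 0 -> Z = [set y : place F | 0 < y p] ->
  uniq U -> (forall u, u \in U -> integral_on Z u) ->
  incongruent (integral_on Z) p U ->
  (forall u, u \in U0 -> B u) ->
  (forall a, B a -> exists2 u, u \in U0 & B ((a - u) / p)) ->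
  (size U <= size U0)%N.
Proof.
move=> Bp xp ZE uU UZ iU U0B U0full.
have p0 : p != 0 by apply: contraTneq xp => ->; rewrite valz0.
have HZ : is_subring (integral_on Z) by apply: integral_on_subring.
have Zp : integral_on Z p by rewrite ZE => y /= yp; rewrite val_geE // ltW.
have [c [Bc c0 cU]] := clear U.
(* [C] bounds the pole orders at [x] of the cleared digits [c * u] and of the digits in [U0]; every
   further digit adds the pole order [e] of [p]. *)
pose C := (\sum_(u <- U) `|x (c * u)%R| + \sum_(u <- U0) `|x u|)%N.
pose e := `|x p|%N; have xpE : x p = - e%:Z by rewrite /e; lia.
have CU u : u \in U -> val_ge x (- C%:Z) (c * u).
  move=> uU1; have [->|cu0] := eqVneq (c * u) 0; first exact: val_ge0.
  rewrite val_geE // /C (big_rem u) //=; lia.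
have CU0 u : u \in U0 -> val_ge x (- C%:Z) u.
  move=> uU0; have [->|u0] := eqVneq u 0; first exact: val_ge0.
  rewrite val_geE // /C [X in (_ + X)%N](big_rem u) //=; lia.
have [LC LCP] := bounded_pole_finite C.
have inL n w : w \in expansions U p n ->
    B (c * w) /\ val_ge x (- (C + e * n)%N%:Z) (c * w).
  elim: n w => [|n IH] w /=.
    rewrite inE => /eqP ->; rewrite mulr0; split; last exact: val_ge0.
    exact: (subring0 HB).
  case/allpairsP => -[u w'] /= [uU1 /IH[Bw xw] ->].
  rewrite mulrDr mulrCA; split.
    by apply: (subringD HB); [apply: cU|apply: (subringM HB)].
  apply: val_geD; first by apply: val_ge_leq (CU u uU1); lia.
  have -> : - (C + e * n.+1)%N%:Z = x p + - (C + e * n)%N%:Z.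
    by rewrite xpE mulnS; lia.
  by apply: val_geM => //; apply: val_ge_refl.
(* Each division with remainder by [p] lowers the pole order by [e]. After [n] digits the quotient
   lies in the finite list [LC], whose size is the constant factor in the comparison of growth. *)
have dec n b : B b -> val_ge x (- (C + e * n)%N%:Z) b ->
    exists w b', [/\ w \in expansions U0 p n, b' \in LC & b = w + p ^+ n * b'].
  elim: n b => [|n IH] b Bb xb.
    exists 0, b; split; rewrite ?inE ?expr0 ?mul1r ?add0r //.
    by apply: LCP => //; apply: val_ge_leq xb; lia.
  have [u uU0 Bu] := U0full b Bb.
  have [|w [b' [wE b'L E]]] := IH _ Bu.
    apply: val_ge_div => //; apply: val_geB.
      by apply: val_ge_leq xb; rewrite xpE mulnS; lia.
    by apply: val_ge_leq (CU0 u uU0); rewrite xpE; lia.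
  exists (u + p * w), b'; split=> //.
    by apply/allpairsP; exists (u, w).
  rewrite exprS -mulrA -addrA -mulrDr -E mulrCA mulfV // mulr1.
  by rewrite addrC subrK.
apply: (@exp_leq_growth _ _ (size LC)) => n.
rewrite mulnC -!(size_expansions _ p) -(size_map ( *%R c)).
rewrite -(size_allpairs (fun w b => w + p ^+ n * b)); apply: uniq_leq_size.
  rewrite map_inj_uniq; last exact: mulfI.
  exact: (expansions_uniq n HZ).
move=> _ /mapP[w /inL[Bw xw] ->].
have [w0 [b [w0E bL ->]]] := dec n _ Bw xw.
by apply/allpairsP; exists (w0, b).
Qed.

(** Only zeros of [p] can obstruct divisibility by [p] in [B], so [B] modulo [p] injects into the
    ring at those zeros modulo [p]. By [incongruent_leq] the target is no larger than the source, so
    the map is onto. *)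
Lemma approximation_mod p a (Z : set (place F)) :
  B p -> x p < 0 -> Z = [set y : place F | 0 < y p] ->
  integral_on Z a -> exists2 b, B b & integral_on Z ((a - b) / p).
Proof.
move=> Bp xp ZE Za.
have p0 : p != 0 by apply: contraTneq xp => ->; rewrite valz0.
have HZ : is_subring (integral_on Z) by apply: integral_on_subring.
have BZ b : B b -> integral_on Z b.
  by move=> Bb y; rewrite ZE /= => yp; apply: Bb => yx; move: yp; rewrite yx; lia.
have [U0 [uU0 U0B iU0 U0full]] := subring_representatives p0 (growthF _) HB Bp.
apply: contrapT => nob.
have nU0 u : u \in U0 -> ~ integral_on Z ((a - u) / p).
  by move=> uU0'; move=> Zu; apply: nob; exists u => //; apply: U0B.
have iZ : incongruent (integral_on Z) p U0.
  move=> u u' uU uU' Zuu'; apply: iU0 => // y yx.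
  have [yp|yp] := pselect (0 < y p); first by apply: Zuu'; rewrite ZE.
  have yp0 : y p = 0 by have := Bp y yx; rewrite val_geE //; lia.
  apply: val_ge_div => //; rewrite yp0 addr0.
  by apply: val_geB; [apply: U0B|apply: U0B].
suff : (size (a :: U0) <= size U0)%N by rewrite /= ltnn.
apply: (@incongruent_leq p Z) => //.
- rewrite /= uU0 andbT; apply/negP => /nU0; apply.
  by rewrite subrr mul0r; apply: (subring0 HZ).
- by move=> u; rewrite inE => /orP[/eqP->//|/U0B/BZ].
- move=> u u'; rewrite !inE => /orP[/eqP->|uU] /orP[/eqP->|uU'] //.
  + by move/(nU0 _ uU').
  + by move/(subringN HZ); rewrite -mulNr opprB => /(nU0 _ uU).
  + exact: iZ.
Qed.

Lemma integral_approximation s (g : place F -> F) (n : nat) : x \notin s ->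
  (forall y, y \in s -> val_ge y 0 (g y)) ->
  exists2 b, B b & forall y, y \in s -> val_ge y n (b - g y).
Proof.
move=> xs gs; have [p [Bp p0 xp vp]] := vanishing n.+1 xs.
pose Z := [set y : place F | 0 < y p].
have [r rP] := (finite_seqP _).1 (finite_zeros growthF p).
have rE y : (y \in r) = `[< Z y >].
  by apply/idP/asboolP => yr; [have : [set` r] y by []|have : Z y by []];
     rewrite -?rP // /Z rP.
(* [p] may have zeros outside [s], where the approximation modulo [p] also imposes a condition; the
   target is taken to be 0 there. *)
pose g' y := if y \in s then g y else 0.
have [a aP] := weak_approximation g' n (undup_uniq r).
have [|b Bb Zb] := @approximation_mod p a Z Bp xp erefl.
  move=> y Zy; rewrite -[a](subrK (g' y)); apply: val_geD.
    by apply: val_ge_leq (aP y _) => //; rewrite mem_undup rE; apply/asboolP.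
  by rewrite /g'; case: ifP => [/gs//|_]; apply: val_ge0.
exists b => // y ys.
have Zy : Z y by have := vp y ys; rewrite val_geE // /Z /=; lia.
have := aP y; rewrite mem_undup rE /g' ys => /(_ (introT (asboolP _) Zy)) yag.
have -> : b - g y = (a - g y) - (a - b) / p * p by rewrite divfK //; ring.
apply: val_geB => //; rewrite mulrC; apply: val_geMr; last exact: Zb.
by apply: val_ge_leq (vp y ys); lia.
Qed.

Lemma strong_approximation_aux s (f : place F -> F) (n : nat) : x \notin s ->
  exists a, (forall y, y \in s -> val_ge y n (a - f y)) /\
    forall y, y \notin s -> y != x -> val_ge y 0 a.
Proof.
move=> xs; have [c [Bc c0 cU]] := clear [seq f y | y <- s].
have [r rP] := (finite_seqP _).1 (finite_zeros growthF c).
have xc := integral_val_le0 Bc.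
(* Zeros of the common denominator [c] outside [s] must not become poles of [b / c], so [b] is made
   to vanish there too; the [m] extra orders survive the division by [c]. *)
pose s' := s ++ r.
have xs' : x \notin s'.
  rewrite mem_cat negb_or xs; apply/negP => xr.
  by have : [set` r] x by []; rewrite -rP /=; lia.
pose m := (\sum_(y <- s') `|y c|)%N.
have mP y : y \in s' -> y c <= m.
  by move=> ys; rewrite /m (big_rem y) //=; lia.
pose g y := if y \in s then c * f y else 0.
have [|b Bb bP] := @integral_approximation s' g (n + m) xs'.
  move=> y ys'; rewrite /g; case: ifP => [ys|_]; last exact: val_ge0.
  by apply: cU; [apply: map_f|move=> yx; rewrite -yx ys in xs].
exists (b / c); split=> [y ys|y ys yx].
  have ys' : y \in s' by rewrite mem_cat ys.
  have -> : b / c - f y = (b - c * f y) / c by field.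
  apply: val_ge_div => //; have := bP y ys'; rewrite /g ys.
  by apply: val_ge_leq; have := mP y ys'; lia.
apply: val_ge_div => //; rewrite add0r.
have [yr|yr] := boolP (y \in r).
  have ys' : y \in s' by rewrite mem_cat yr orbT.
  have := bP y ys'; rewrite /g (negPf ys) subr0.
  by apply: val_ge_leq; have := mP y ys'; lia.
apply: (@val_ge_leq _ _ _ 0); last by apply: Bb; apply/eqP.
rewrite leNgt; apply: contra yr => yc.
by have : [set y : place F | 0 < y c] y by []; rewrite rP.
Qed.

(* Hurwitz's argument, with -x as the Euclidean size: for beta of smallest
   size in the fractional ideal of n, M alpha is a multiple of beta. *)
Lemma divisor_reduction_aux : exists2 M, B M /\ M != 0 &
  forall n : place F -> int, finite_set [set y | n y != 0] ->
  exists2 b, b != 0 & forall y, y != x -> n y <= y b <= n y + y M.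
Proof.
have [d dP] := polar_part_reduction growthF xpole.
(* The remainders compared below have been divided by [t ^ d]; this precision leaves value at least
   1 at [x] after multiplying back. *)
have [c cP] := valring_pigeonhole growthF x (`|x t| * d).+1.
(* A common multiple of every difference [t ^ i - t ^ j] that the pigeonhole can return, so that [M]
   is independent of the divisor [n]. *)
pose M := \prod_(i < c.+1) \prod_(j < c.+1 | (i < j)%N) (t ^+ i - t ^+ j).
have tij i j : (i < j)%N -> t ^+ i - t ^+ j != 0.
  move=> ij; rewrite subr_eq0; apply/eqP => /(congr1 x); rewrite !valX; nia.
have Btij i j : B (t ^+ i - t ^+ j).
  by apply: (subringB HB); apply: (subringX HB).
have prodB (I : finType) (P : pred I) (h : I -> F) :
    (forall i, B (h i)) -> B (\prod_(i | P i) h i).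
  move=> Bh; elim/big_ind: _ => //; first exact: (subring1 HB).
  exact: (subringM HB).
have BM : B M by apply: (prodB _ predT) => i; apply: (prodB).
have M0 : M != 0.
  apply/prodf_neq0 => i _; apply/prodf_neq0 => j; exact: tij.
have MP i j : (i < j <= c)%N -> B (M / (t ^+ i - t ^+ j)).
  move=> /andP[ij jc]; have ic : (i < c.+1)%N by lia.
  rewrite /M (bigD1 (Ordinal ic)) //= (bigD1 (Ordinal (jc : (j < c.+1)%N))) //=.
  have cancel (e f g : F) : e != 0 -> e * f * g / e = f * g by move=> e0; field.
  rewrite cancel ?tij //.
  by apply: (subringM HB); apply: (prodB) => // k; apply: (prodB).
exists M; first by [].
move=> n /finite_seqP[s sP].
have ns y : y \notin s -> n y = 0.
  move=> ys; apply: contrapT => /eqP ny; move/negP: ys; apply.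
  by have : [set y | n y != 0] y by []; rewrite sP.
pose N := (\sum_(y <- s) `|n y|)%N.
have nN y : `|n y| <= N.
  have [ys|/ns->//] := boolP (y \in s).
  by rewrite /N (big_rem y) //=; lia.
pose I a := forall y, y != x -> val_ge y (n y) a.
have IB a b : I a -> B b -> I (b * a).
  move=> Ia Bb y yx; rewrite mulrC; apply: val_geMr; first exact: Ia.
  by apply: Bb; apply/eqP.
pose s' := [seq y <- s | y != x].
have xs' : x \notin s' by rewrite mem_filter eqxx.
have [q [Bq q0 xq vq]] := vanishing N xs'.
have Iq : I q.
  move=> y yx; have [ys|ys] := boolP (y \in s).
    by apply: val_ge_leq (vq y _); rewrite ?mem_filter ?yx //; have := nN y; lia.
  by rewrite ns //; apply: Bq; apply/eqP.
have Ix a : I a -> a != 0 -> x a <= - x q.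
  move=> Ia a0; have : x (a * q) <= 0.
    apply: integral_val_le0 => y /eqP yx.
    have [ys|ys] := boolP (y \in s).
      apply: (@val_ge_leq _ _ _ (n y + N)); first by have := nN y; lia.
      apply: val_geM; first exact: Ia.
      by apply: vq; rewrite mem_filter yx.
    rewrite -(addr0 0); apply: val_geM; last by apply: Bq; apply/eqP.
    by rewrite -(ns y ys); apply: Ia.
  by rewrite valM //; lia.
(* By [Ix] the number [- x q - x a] is nonnegative, so it has a minimum; minimizing it maximizes
   [x a], that is, minimizes the Euclidean size. *)
pose Q i := `[< exists2 a, I a /\ a != 0 & - x q - x a = i%:Z >].
have Q0 : exists i, Q i.
  exists `|- x q - x q|%N; apply/asboolP; exists q => //.
  by have := Ix q Iq q0; lia.
case: (ex_minnP Q0) => m /asboolP[b [Ib b0] bm] minm.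
have bmax a : I a -> val_ge x (x b + 1) a -> a = 0.
  move=> Ia ba; apply: contrapT => /eqP a0; move: ba; rewrite val_geE // => ba.
  have : Q `|- x q - x a|%N.
    by apply/asboolP; exists a => //; have := Ix a Ia a0; lia.
  by move/minm; have := Ix a Ia a0; lia.
have dvd a : I a -> a != 0 -> forall y, y != x -> y b <= y a + y M.
  move=> Ia a0 y yx.
  have /choice[g gP] : forall i, exists g, B g /\
      val_ge x 0 ((a / b * t ^+ i - g) / t ^+ d).
    move=> i; have [g] := dP (a / b * t ^+ i).
    by rewrite polest => Bg Og; exists g; split=> //; apply: Og.
  have [|i [j [ijc xij]]] := cP (fun i => (a / b * t ^+ i - g i) / t ^+ d).
    by move=> i; case: (gP i).
  have ij : (i < j)%N by case/andP: ijc.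
  (* The combination lies in the fractional ideal and has larger value at [x] than [b], so the
     extremal choice of [b] makes it zero. *)
  have ad : (t ^+ i - t ^+ j) * a - (g i - g j) * b = 0.
    apply: bmax.
      move=> w wx; apply: val_geB; apply: IB => //.
      by apply: (subringB HB); [case: (gP i)|case: (gP j)].
    have -> : (t ^+ i - t ^+ j) * a - (g i - g j) * b =
        ((a / b * t ^+ i - g i) / t ^+ d - (a / b * t ^+ j - g j) / t ^+ d) *
        (t ^+ d * b) by field; rewrite b0 expf_neq0.
    apply: val_ge_leq (val_geM xij (val_ge_refl (erefl (x (t ^+ d * b))))).
    by rewrite valM ?expf_neq0 // valX; move: xt; clear; nia.
  have Mab : M * a = M / (t ^+ i - t ^+ j) * (g i - g j) * b.
    apply: (mulIf (tij i j ij)); move/eqP: ad; rewrite subr_eq0 => /eqP ad.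
    have -> : M / (t ^+ i - t ^+ j) * (g i - g j) * b * (t ^+ i - t ^+ j) =
      M * ((g i - g j) * b) by field; rewrite tij.
    by rewrite -ad; ring.
  have := val_geMr (val_ge_refl (erefl (y b))) (subringM HB (MP i j ijc)
     (subringB HB (gP i).1 (gP j).1) y (elimN eqP yx)).
  by rewrite mulrC -Mab val_geE ?mulf_neq0 // valM // addrC.
exists b => // y yx; apply/andP; split.
  by have := Ib y yx; rewrite val_geE.
(* For the upper bound at [y], strong approximation provides an element of the ideal whose value at
   [y] is exactly [n y], to which [dvd] is applied. *)
have [p p0 yp] := val_unif y.
pose f w := if w == y then p ^ n y else 0.
have [|a [aP aP']] := @strong_approximation_aux (y :: s') f N.+1.
  by rewrite inE negb_or xs' eq_sym yx.
have [a0 ya] : a != 0 /\ y a = n y.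
  have := aP y (mem_head _ _); rewrite /f eqxx => yap.
  have ypn : y (p ^ n y) = n y by rewrite val_exprz yp mul1r.
  have [||] := @val_near _ y a (p ^ n y); rewrite ?expfz_neq0 // ypn //.
  by apply: val_ge_leq yap; have := nN y; lia.
rewrite -ya; apply: dvd => // w wx.
have [->|wy] := eqVneq w y; first by rewrite val_geE // ya.
have [ws|ws] := boolP (w \in y :: s').
  have := aP w ws; rewrite /f (negPf wy) subr0; apply: val_ge_leq.
  by move: (nN w); clear; lia.
rewrite (ns w); first exact: aP'.
by move: ws; rewrite inE (negPf wy) mem_filter wx.
Qed.

End FixedFunction.

Lemma strong_approximation s (f : place F -> F) (n : nat) : x \notin s ->
  exists a, (forall y, y \in s -> val_ge y n (a - f y)) /\
    forall y, y \notin s -> y != x -> val_ge y 0 a.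
Proof.
have [t xt Bt] := function_with_single_pole growthF x.
by move=> xs; apply: strong_approximation_aux xt Bt _ _ _ xs.
Qed.

Lemma divisor_reduction : exists2 M, B M /\ M != 0 &
  forall n : place F -> int, finite_set [set y | n y != 0] ->
  exists2 b, b != 0 & forall y, y != x -> n y <= y b <= n y + y M.
Proof.
have [t xt Bt] := function_with_single_pole growthF x.
exact: divisor_reduction_aux xt Bt.
Qed.

End StrongApproximation.

(** * Counting classes modulo squares *)

Lemma card_eq_image_finset (G : finType) (T : choiceType) (D : {set G})
    (f : G -> T) (X : set T) :
  {in D &, injective f} -> X = [set f i | i in [set` D]] ->
  (X #= `I_#|D|)%card.
Proof.
move=> finj ->; pose l := [seq f i | i <- enum D].
have ul : uniq l.
  by rewrite map_inj_in_uniq ?enum_uniq // => i j; rewrite !mem_enum; apply: finj.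
have -> : [set f i | i in [set` D]] = [set` seq_fset tt l].
  apply/seteqP; split=> [_ [i iD <-]|a].
    by rewrite /mkset seq_fsetE; apply: map_f; rewrite mem_enum.
  by rewrite /mkset seq_fsetE => /mapP[i]; rewrite mem_enum => iD ->; exists i.
apply/card_eq_fsetP; rewrite cardE -(size_map f) -/l.
by rewrite size_seq_fset undup_id.
Qed.

(** Kernel and cokernel of squaring on a finite abelian group: the order of the group is the image
    times the kernel, and also the image times the number of its cosets. *)
Lemma card_2torsion_mod2 (G : finType) (op : G -> G -> G) (e : G)
    (inv : G -> G) :
  associative op -> commutative op -> left_id e op -> left_inverse e inv op ->
  #|finset (fun i => op i i == e)| =
  #|[set finset (fun j => [exists s, j == op i (op s s)]) | i in [set: G]]%SET|.
Proof.
move=> opA opC op1 opV.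
have opI i : injective (op i).
  by move=> j k /(congr1 (op (inv i))); rewrite !opA opV !op1.
have opACA i j k l : op (op i j) (op k l) = op (op i k) (op j l).
  by rewrite -!opA; congr op; rewrite !opA [op j k]opC.
pose sq i := op i i; pose Im := sq @: [set: G]%SET.
set K := finset _; set P := imset _ _.
have KIm : #|G| = (#|Im| * #|K|)%N.
  rewrite -cardsT -sum1_card (partition_big_imset sq) /= -sum_nat_const.
  apply: eq_bigr => _ /imsetP[i _ ->]; rewrite sum1dep_card.
  rewrite -(card_imset K (opI i)); apply: eq_card => j; rewrite !inE /=.
  apply/eqP/imsetP => [sj|[k]].
    exists (op (inv i) j); last by rewrite opA [op i _]opC opV op1.
    by rewrite inE opACA -/(sq j) sj opACA !opV op1.
  by rewrite inE => /eqP kk ->; rewrite /sq opACA kk opC op1.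
pose cl i := finset (fun j => [exists s, j == op i (op s s)]).
have clE i j : (j \in cl i) -> cl j = cl i.
  rewrite inE => /existsP[s /eqP ->]; apply/setP => k; rewrite !inE.
  apply/existsP/existsP => -[u /eqP ->].
    by exists (op s u); rewrite -opA opACA.
  exists (op (inv s) u); apply/eqP; rewrite -opA; congr op.
  by rewrite opACA [op s (op _ _)]opA [op s (inv s)]opC opV op1.
have cl_refl i : i \in cl i.
  by rewrite inE; apply/existsP; exists e; rewrite op1 opC op1.
have PIm : #|G| = (#|P| * #|Im|)%N.
  rewrite -cardsT; apply: card_uniform_partition.
    move=> _ /imsetP[i _ ->]; rewrite -(card_imset Im (opI i)).
    apply: eq_card => j; rewrite inE; apply/existsP/imsetP.
      by move=> [s /eqP ->]; exists (sq s) => //; apply: imset_f.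
    by move=> [_ /imsetP[s _ ->] ->]; exists s.
  apply/and3P; split.
  - rewrite finset.eqEsubset finset.subsetT; apply/fintype.subsetP => i _.
    by apply/bigcupP; exists (cl i) => //; apply: imset_f.
  - apply/finset.trivIsetP => _ _ /imsetP[i _ ->] /imsetP[j _ ->].
    rewrite -/(cl i) -/(cl j).
    apply: contraR => /pred0Pn[k /andP[/= /clE <- /clE <-]]; exact: eqxx.
  - apply/negP => /imsetP[i _ /setP/(_ i)].
    by rewrite -/(cl i) cl_refl inE.
have Im0 : (0 < #|Im|)%N.
  by apply/card_gt0P; exists (sq e); apply: imset_f.
by apply/eqP; rewrite -(eqn_pmul2r Im0) -PIm mulnC -KIm.
Qed.

Section Cosets.
Variable R : comPzRingType.
Implicit Types (a b c : R) (S : set R).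

Definition is_unit_subgroup S :=
  [/\ S 1, forall a b, S a -> S b -> S (a * b)
    & forall a, S a -> exists2 b, S b & a * b = 1].

Definition eqmod S a b := exists2 s, S s & a = b * s.

Lemma units_of_setT_subgroup : is_unit_subgroup (units_of [set: R]).
Proof.
split; first by split=> //; exists 1; rewrite ?mulr1.
  move=> a b [_ [a' _ aa']] [_ [b' _ bb']]; split=> //; exists (a' * b') => //.
  by rewrite mulrACA aa' bb' mulr1.
move=> a [_ [a' _ aa']]; exists a' => //; split=> //.
by exists a; rewrite // mulrC.
Qed.

Variables (S : set R) (HS : is_unit_subgroup S).

Lemma eqmod_refl a : eqmod S a a.
Proof. by exists 1; rewrite ?mulr1 //; case: HS. Qed.

Lemma eqmod_sym a b : eqmod S a b -> eqmod S b a.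
Proof.
move=> [s Ss ->]; have [_ _ /(_ s Ss)[s' Ss' ss']] := HS.
by exists s'; rewrite // -mulrA ss' mulr1.
Qed.

Lemma eqmod_trans a b c : eqmod S a b -> eqmod S b c -> eqmod S a c.
Proof.
move=> [s Ss ->] [r Sr ->]; exists (r * s); last by rewrite mulrA.
by case: HS => _ SM _; apply: SM.
Qed.

Lemma eqmodM a b c d : eqmod S a b -> eqmod S c d -> eqmod S (a * c) (b * d).
Proof.
move=> [s Ss ->] [r Sr ->]; exists (s * r); last by rewrite mulrACA.
by case: HS => _ SM _; apply: SM.
Qed.

Lemma eqmod_coset a b :
  [set c | eqmod S c a] = [set c | eqmod S c b] <-> eqmod S a b.
Proof.
split=> [/seteqP[sub _]|ab]; first by apply: sub; apply: eqmod_refl.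
apply/seteqP; split=> c /= ?; apply: eqmod_trans; try eassumption.
exact: eqmod_sym.
Qed.

End Cosets.

Section CountingClasses.
Variable R : comPzRingType.
Implicit Types (a b c h s : R).
Local Notation U := (units_of [set: R]).
Variables (H : set R) (HH : is_unit_subgroup H) (HU : H `<=` U).
Variables (p : R) (Up : U p).
Hypothesis p_free : forall n, H (p ^+ n) -> n = 0%N.

Let U1 : U 1. Proof. by case: (units_of_setT_subgroup R). Qed.
Let UM a b : U a -> U b -> U (a * b).
Proof. by case: (units_of_setT_subgroup R) => _ M _; apply: M. Qed.
Let UX a n : U a -> U (a ^+ n).
Proof. by move=> Ua; elim: n => [|n IH]; rewrite ?expr0 // exprS; apply: UM. Qed.
Let H1 : H 1. Proof. by case: HH. Qed.
Let HM a b : H a -> H b -> H (a * b).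
Proof. by case: HH => _ M _; apply: M. Qed.

(* The subgroup generated by H and p; the two exponents avoid negative powers. *)
Definition cyclic_extension : set R :=
  [set c | U c /\ exists h n m, H h /\ c * p ^+ n = h * p ^+ m].

Definition square_extension : set R :=
  [set c | exists h s, [/\ H h, U s & c = h * (s * s)]].

Local Notation HC := cyclic_extension.
Local Notation HL := square_extension.

Let HC_subgroup : is_unit_subgroup HC.
Proof.
split.
- by split=> //; exists 1, 0%N, 0%N.
- move=> a b [Ua [h [n [m [Hh ah]]]]] [Ub [h' [n' [m' [Hh' bh]]]]].
  split; first exact: UM.
  exists (h * h'), (n + n')%N, (m + m')%N; split; first exact: HM.
  by rewrite !exprD mulrACA ah bh mulrACA.
- move=> a [Ua [h [n [m [Hh ah]]]]].
  have [_ _ UV] := units_of_setT_subgroup R; have [b Ub ab] := UV a Ua.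
  have [_ _ HV] := HH; have [h' Hh' hh'] := HV h Hh.
  exists b => //; split=> //; exists h', m, n; split=> //.
  have -> : b * p ^+ m = b * p ^+ m * (h * h') by rewrite hh' mulr1.
  have -> : b * p ^+ m * (h * h') = (b * h') * (h * p ^+ m) by ring.
  have -> : (b * h') * (h * p ^+ m) = (a * b) * (h' * p ^+ n).
    by rewrite -ah; ring.
  by rewrite ab mul1r.
Qed.

Lemma square_extension_subgroup : is_unit_subgroup HL.
Proof.
split.
- by exists 1, 1; rewrite !mulr1.
- move=> _ _ [h [s [Hh Us ->]]] [h' [s' [Hh' Us' ->]]].
  exists (h * h'), (s * s'); split; [exact: HM|exact: UM|].
  by rewrite mulrACA [s * s * _]mulrACA.
- move=> _ [h [s [Hh Us ->]]].
  have [_ _ UV] := units_of_setT_subgroup R; have [b Ub sb] := UV s Us.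
  have [_ _ HV] := HH; have [h' Hh' hh'] := HV h Hh.
  exists (h' * (b * b)); first by exists h', b.
  by rewrite mulrACA hh' [s * s * _]mulrACA sb !mulr1.
Qed.

Let HHC h : H h -> HC h.
Proof. by move=> Hh; split; [apply: HU|exists h, 0%N, 0%N]. Qed.

Let HCp n : HC (p ^+ n).
Proof. by split; [apply: UX|exists 1, 0%N, n; rewrite expr0 mulr1 mul1r]. Qed.

Let p_cancel h h' n m : H h -> H h' -> h * p ^+ n = h' * p ^+ m -> n = m.
Proof.
move=> Hh Hh'; have [p' _ pp'] : exists2 p', U p' & p * p' = 1.
  by have [_ _ UV] := units_of_setT_subgroup R; apply: UV.
have [_ _ HV] := HH.
have lt i j k l : H i -> H j -> (k <= l)%N -> i * p ^+ k = j * p ^+ l -> k = l.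
  move=> Hi Hj kl E; have [j' Hj' jj'] := HV j Hj.
  suff /p_free : H (p ^+ (l - k)) by lia.
  have -> : p ^+ (l - k) = i * j'.
    have pk : p ^+ k * p' ^+ k = 1 by rewrite -exprMn pp' expr1n.
    rewrite -[LHS]mulr1 -jj' -[LHS]mulr1 -{1}pk.
    have -> : p ^+ (l - k) * (j * j') * (p ^+ k * p' ^+ k) =
       (j * (p ^+ (l - k) * p ^+ k)) * (j' * p' ^+ k) by ring.
    rewrite -exprD subnK // -E.
    have -> : i * p ^+ k * (j' * p' ^+ k) = i * j' * (p ^+ k * p' ^+ k) by ring.
    by rewrite pk mulr1.
  exact: HM.
have [nm|/ltnW mn] := leqP n m; first exact: lt.
by move/esym/lt => ->.
Qed.

(** The quotient of [HC] by [H] is infinite cyclic, so it has no 2-torsion. This makes the 2-torsion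
    modulo [H] inject into the 2-torsion modulo [HC]. *)
Let HC_square c : HC c -> H (c * c) -> H c.
Proof.
move=> [Uc [h [n [m [Hh ch]]]]] Hcc.
have nm : (n + n = m + m)%N.
  apply: (@p_cancel (c * c) (h * h)) => //; first exact: HM.
  by rewrite !exprD mulrACA ch mulrACA.
have -> : c = h; last by [].
have nmE : n = m by lia.
rewrite nmE in ch.
have [p' _ pp'] : exists2 p', U p' & p * p' = 1.
  by have [_ _ UV] := units_of_setT_subgroup R; apply: UV.
have pk : p ^+ m * p' ^+ m = 1 by rewrite -exprMn pp' expr1n.
by rewrite -[c]mulr1 -pk mulrA ch -mulrA pk mulr1.
Qed.

Variables (T : finType) (key : R -> T).
Hypothesis keyP : forall a b, U a -> U b -> key a = key b -> eqmod HC a b.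

(** The quotient of [U] by [HC] as a finite type with a class map and a section, so that counting in
    finite types applies. Finiteness holds because [key] separates the classes. *)
Let class_data : exists (G : finType) (r : G -> R) (cls : R -> G),
  [/\ forall i, U (r i), forall i, cls (r i) = i
    & forall a b, U a -> U b -> (cls a = cls b <-> eqmod HC a b)].
Proof.
pose canon a := xget 1 [set b | U b /\ eqmod HC b a].
have canonP a : U a -> U (canon a) /\ eqmod HC (canon a) a.
  by move=> Ua; apply: (@xgetI _ 1 [set b | U b /\ eqmod HC b a] a); split=> //;
     apply: eqmod_refl.
have canonE a b : eqmod HC a b -> canon a = canon b.
  move=> ab; rewrite /canon; congr (xget _ _).
  apply/seteqP; split=> c /= [Uc ca]; split=> //.
    exact: (eqmod_trans HC_subgroup ca).
  by apply: (eqmod_trans HC_subgroup ca); apply: eqmod_sym.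
pose C := [set canon a | a in U].
have finC : finite_set C.
  apply: contrapT => inf; have [B sB cB] := infinite_set_fset #|T|.+1 inf.
  have : uniq [seq key a | a <- enum_fset B].
    rewrite map_inj_in_uniq ?fset_uniq // => a b.
    move=> /sB[a' Ua' <-] /sB[b' Ub' <-] kab.
    have [Ua ca] := canonP _ Ua'; have [Ub cb] := canonP _ Ub'.
    apply: canonE; apply: (eqmod_trans HC_subgroup (eqmod_sym HC_subgroup ca)).
    exact: (eqmod_trans HC_subgroup (keyP Ua Ub kab)).
  move/card_uniqP => card_eq.
  have := max_card (mem [seq key a | a <- enum_fset B]).
  by rewrite card_eq size_map leqNgt cB.
have [s sC] := (finite_seqP _).1 finC.
have inC a : U a -> canon a \in s.
  by move=> Ua; have : C (canon a); [exists a|rewrite sC].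
pose d : seq_sub s := SeqSub (inC 1 U1).
exists (seq_sub s), val, (fun a => insubd d (canon a)).
have insE a : U a -> val (insubd d (canon a)) = canon a.
  by move=> Ua; rewrite val_insubd inC.
split.
- by move=> [a /= as_]; have [b Ub <-] : C a; [rewrite sC|case: (canonP b Ub)].
- move=> [a /= as_]; apply: val_inj; have [b Ub ab] : C a by rewrite sC.
  rewrite /=; rewrite insE -ab; last by case: (canonP b Ub).
  by apply: canonE; case: (canonP b Ub).
- move=> a b Ua Ub; split=> [/(congr1 val)|ab]; last by rewrite (canonE _ _ ab).
  rewrite !insE // => cab; have [_ ca] := canonP _ Ua; have [_ cb] := canonP _ Ub.
  by apply: (eqmod_trans HC_subgroup (eqmod_sym HC_subgroup ca)); rewrite cab.
Qed.

Definition torsion_cosets : set (set R) :=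
  [set X | exists2 a, U a & X = [set b | eqmod H b a] /\ H (a * a)].

Definition square_cosets : set (set R) :=
  [set [set b | eqmod HL b a] | a in U].

Let torsion_classes (G : finType) (cls : R -> G) :=
  finset (fun i => `[< exists a, [/\ U a, H (a * a)%R & cls a = i] >]).

(** [torsion_classes] is the image in the finite quotient of the 2-torsion modulo [H]; injectivity
    rests on [HC_square]. *)
Let torsion_card (G : finType) (cls : R -> G) :
  (forall a b, U a -> U b -> (cls a = cls b <-> eqmod HC a b)) ->
  (torsion_cosets #= `I_#|torsion_classes cls|)%card.
Proof.
move=> clsP.
pose psi i := [set b | exists a, [/\ U a, H (a * a), cls a = i & eqmod H b a]].
have eqH a b : U a -> H (a * a) -> U b -> H (b * b) ->
    cls a = cls b -> eqmod H a b.
  move=> Ua Ha Ub Hb /clsP[//|//|c HCc ab].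
  exists c => //; apply: HC_square => //.
  have [_ _ HV] := HH; have [h Hh bh] := HV _ Hb.
  have -> : c * c = a * a * h; last exact: HM.
  rewrite ab; have -> : b * c * (b * c) * h = b * b * h * (c * c) by ring.
  by rewrite bh mul1r.
have psiE a : U a -> H (a * a) -> psi (cls a) = [set b | eqmod H b a].
  move=> Ua Ha; apply/seteqP; split=> b /=; last by move=> ba; exists a.
  move=> [c [Uc Hc ca bc]]; apply: (eqmod_trans HH bc); exact: eqH.
apply: (@card_eq_image_finset _ _ _ psi) => [i j|].
  rewrite !inE => -[a [Ua Ha <-]] [b [Ub Hb <-]].
  rewrite !psiE // => /(eqmod_coset HH)[c Hc ->]; apply/clsP => //.
    by apply: UM => //; apply: HU.
  by exists c => //; apply: HHC.
apply/seteqP; split=> [_ [a Ua [-> Ha]]|_ [i + <-]] /=.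
  by exists (cls a); [rewrite inE; apply/asboolP; exists a|rewrite psiE].
by rewrite /= inE => /asboolP[a [Ua Ha <-]]; exists a => //; rewrite psiE.
Qed.

Lemma finite_torsion_cosets : finite_set torsion_cosets.
Proof.
have [G [r [cls [_ _ clsP]]]] := class_data.
by exists #|torsion_classes cls|; apply: torsion_card.
Qed.

(* As p is a square times an element of H, passing to the finite quotient by
   the infinite cyclic group <p> doubles the 2-torsion and leaves the classes
   modulo squares unchanged; both have the same number of elements in a finite
   abelian group. *)
Lemma card_square_cosets c h : U c -> H h -> c * c = h * p ->
  (square_cosets #= `I_(2 * #|` fset_set torsion_cosets|)%N)%card.
Proof.
move=> Uc Hh cc; have HLs := square_extension_subgroup.
have [G [r [cls [Ur clsr clsP]]]] := class_data.
rewrite (card_fset_set (torsion_card clsP)); set K0 := torsion_classes cls.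
have eqr a : U a -> eqmod HC (r (cls a)) a by move=> Ua; apply/clsP.
pose op i j := cls (r i * r j).
have clsM a b : U a -> U b -> op (cls a) (cls b) = cls (a * b).
  move=> Ua Ub; apply/clsP; [exact: UM|exact: UM|].
  by apply: eqmodM => //; apply: eqr.
have [_ _ UV] := units_of_setT_subgroup R.
have /choice[inv invP] : forall i, exists j, op j i = cls 1.
  move=> i; have [b Ub ab] := UV _ (Ur i); exists (cls b).
  by rewrite -[i in op _ i]clsr clsM // mulrC ab.
have opA : associative op.
  by move=> i j k; rewrite -[i]clsr -[j]clsr -[k]clsr !clsM ?mulrA //; apply: UM.
have opC : commutative op by move=> i j; rewrite /op mulrC.
have op1 : left_id (cls 1) op by move=> i; rewrite -[i]clsr clsM // mul1r.
have opV : left_inverse (cls 1) inv op by move=> i; apply: invP.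
have := card_2torsion_mod2 opA opC op1 opV.
set K := finset (fun i => op i i == _); set P := imset _ _.
have HLU s : HL s -> U s.
  by move=> [g [s' [Hg Us ->]]]; apply: UM; [apply: HU|apply: UM].
have HLp : HL p.
  have [_ _ HV] := HH; have [g Hg hg] := HV h Hh.
  exists g, c; split=> //; rewrite cc mulrA [g * h]mulrC hg mul1r //.
have HLX n : HL (p ^+ n).
  case: square_extension_subgroup => HL1 HLM _.
  by elim: n => [|n IH]; rewrite ?expr0 // exprS; apply: (HLM).
(* Since [p] is a square up to [H], the group [HC] lies in [HL], so classes modulo squares factor
   through the finite quotient. *)
have HCL a b : eqmod HC a b -> eqmod HL a b.
  move=> [s [Us [g [n [m [Hg sg]]]]] ->].
  case: HLs => HL1 HLM HLV; have [q HLq pq] := HLV _ (HLX n).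
  exists s => //; have -> : s = g * p ^+ m * q by rewrite -sg -mulrA pq mulr1.
  by apply: (HLM) => //; apply: (HLM) => //; exists g, 1; rewrite !mulr1.
pose phi (X : {set G}) := [set b | exists2 i, i \in X & eqmod HL b (r i)].
pose cl i := finset (fun j => [exists s, j == op i (op s s)]).
have clP i j : (j \in cl i) <-> eqmod HL (r j) (r i).
  split.
    rewrite inE => /existsP[s /eqP ->].
    apply: (eqmod_trans square_extension_subgroup (b := r i * (r s * r s))).
      apply: HCL; rewrite {1}/op; apply: (eqmod_trans HC_subgroup (eqr _ _)).
        exact: UM.
      by apply: eqmodM => //; [apply: eqmod_refl|apply: eqr; apply: UM].
    by exists (r s * r s) => //; exists 1, (r s); rewrite mul1r.
  move=> [_ [g [s [Hg Us ->]]] rj]; rewrite inE; apply/existsP; exists (cls s).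
  apply/eqP; rewrite clsM // -[i]clsr clsM ?clsr //; last exact: UM.
  rewrite -[LHS]clsr; apply/clsP; [exact: Ur|by apply: UM => //; apply: UM|].
  rewrite rj; exists g; first exact: HHC.
  ring.
have phiE i : phi (cl i) = [set b | eqmod HL b (r i)].
  apply/seteqP; split=> b /= => [[j /clP ji bj]|bi].
    exact: (eqmod_trans square_extension_subgroup bj).
  by exists i => //; apply/clP; apply: eqmod_refl.
have cl_refl i : i \in cl i by apply/clP; apply: eqmod_refl.
(* [K] is the disjoint union of [K0] and its translate by the class [g] of [c]; the square of [g] is
   the class of [p], which is trivial modulo [HC]. *)
have <- : #|K| = (2 * #|K0|)%N.
  pose g := cls c.
  have opI : injective (op g).
    by move=> i j /(congr1 (op (inv g))); rewrite !opA opV !op1.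
  have -> : K = K0 :|: op g @: K0.
    apply/setP => i; rewrite !inE; apply/eqP/orP; last first.
      case=> [/asboolP[a [Ua Ha <-]]|/imsetP[j]].
        rewrite clsM //; apply/clsP => //; first exact: UM.
        by exists (a * a); rewrite ?mul1r //; apply: HHC.
      rewrite inE => /asboolP[a [Ua Ha <-]] ->.
      have Uca : U (c * a) by apply: UM.
      rewrite /g !clsM //; apply/clsP => //; first exact: UM.
      have -> : c * a * (c * a) = 1 * (c * c * (a * a)) by ring.
      exists (c * c * (a * a)) => //; case: HC_subgroup => _ HCM _.
      apply: (HCM); last exact: HHC.
      by rewrite cc; apply: HCM; [exact: HHC|exact: (HCp 1)].
    rewrite -[i]clsr clsM // => /clsP[||s [Us [h' [n [m [Hh' sh]]]]]] //.
      exact: UM.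
    rewrite mul1r => si.
    have [q Uq pq] := UV _ Up.
    have pqX j : p ^+ j * q ^+ j = 1 by rewrite -exprMn pq expr1n.
    (* The square of [r i] is [h' * p ^ (m - n)] and [q] inverts [p], so [a = r i * p ^ (n - l)] has
       square [h' * p ^ (n + m - 2 * l)], whose exponent is the parity of [n + m]. *)
    pose l := (n + m)./2.
    pose a := r i * (p ^+ n * q ^+ l).
    have Ua : U a by apply: UM => //; apply: UM; apply: UX.
    have clsa : cls a = i.
      rewrite -[RHS]clsr; apply/clsP => //; exists (p ^+ n * q ^+ l) => //.
      case: HC_subgroup => _ HCM HCV; apply: (HCM) => //.
      have [w HCw pw] := HCV _ (HCp l).
      have -> : q ^+ l = w; last by [].
      by rewrite -[q ^+ l]mulr1 -pw mulrA [q ^+ l * _]mulrC pqX mul1r.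
    have aa : a * a = h' * (p ^+ odd (n + m)).
      have -> : a * a = r i * r i * p ^+ n * (p ^+ n * (q ^+ l * q ^+ l)).
        by rewrite /a; ring.
      rewrite si sh -mulrA; congr (_ * _).
      rewrite mulrA -exprD [(m + n)%N]addnC.
      rewrite -{1}[(n + m)%N]odd_double_half -/l -addnn exprD exprD.
      have -> : forall u v w : R, u * (v * v) * (w * w) = u * ((v * w) * (v * w)).
        by move=> u v w; ring.
      by rewrite pqX !mulr1.
    have [od|od] := boolP (odd (n + m)); last first.
      left; apply/asboolP; exists a; rewrite clsa; split=> //.
      by rewrite aa (negPf od) mulr1.
    right; apply/imsetP; have [c' Uc' cc'] := UV _ Uc.
    exists (cls (a * c')); last first.
      by rewrite clsM ?clsr //; [rewrite mulrCA cc' mulr1 clsa|exact: UM].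
    rewrite inE; apply/asboolP; exists (a * c'); split=> //; first exact: UM.
    have -> : a * c' * (a * c') = a * a * (c' * c') by ring.
    have [_ _ HV] := HH; have [g' Hg' hg'] := HV h Hh.
    have -> : a * a * (c' * c') = h' * g'; last exact: HM.
    have pE : p ^+ odd (n + m) = g' * (c * c).
      by rewrite od cc mulrA [g' * h]mulrC hg' mul1r.
    rewrite aa pE; have -> : h' * (g' * (c * c)) * (c' * c') =
       h' * g' * ((c * c') * (c * c')) by ring.
    by rewrite cc' !mulr1.
  rewrite cardsU disjoint_setI0 ?cards0 ?subn0; last first.
    apply/pred0P => i; apply/negP => /= /andP[].
    rewrite inE => /asboolP[a [Ua Ha <-]].
    move=> /imsetP[j]; rewrite inE => /asboolP[b [Ub Hb <-]].
    rewrite clsM // => /clsP[||s [Us [h' [n [m [Hh' sh]]]]] ab] //.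
      exact: UM.
    (* A common element would identify [p ^ (n + n)] with [p ^ (m + m).+1] up to [H], which
       [p_cancel] rules out by parity. *)
    have : (n + n = (m + m).+1)%N; last by lia.
    apply: (@p_cancel (a * a) (h * (b * b) * (h' * h'))) => //.
      by apply: HM; [exact: HM|exact: HM].
    rewrite exprD exprS exprD ab.
    have -> : c * b * s * (c * b * s) * (p ^+ n * p ^+ n) =
      (c * c) * (b * b) * ((s * p ^+ n) * (s * p ^+ n)) by ring.
    by rewrite sh cc; ring.
  by rewrite (card_imset _ opI) mul2n addnn.
move=> ->.
apply: (@card_eq_image_finset _ _ P phi).
  move=> _ _ /imsetP[i _ ->] /imsetP[j _ ->]; rewrite -/(cl i) -/(cl j) !phiE.
  move=> /(eqmod_coset square_extension_subgroup) ij; apply/setP => k.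
  apply/idP/idP => /clP ki; apply/clP; apply: (eqmod_trans HLs ki) => //.
  exact: eqmod_sym.
apply/seteqP; split=> [_ [a Ua <-]|_ [_ /imsetP[i _ ->] <-]] /=.
  exists (cl (cls a)); first by apply/imsetP; exists (cls a).
  rewrite phiE; apply/(eqmod_coset HLs); apply: HCL; exact: eqr.
by exists (r i) => //; rewrite -phiE.
Qed.

End CountingClasses.

(** * Ideles and divisor classes *)

Section UnitsOf.
Variables (R : comPzRingType) (S : set R).
Hypotheses (S1 : S 1) (SM : forall a b, S a -> S b -> S (a * b)).

Lemma units_of_subgroup : is_unit_subgroup (units_of S).
Proof.
split; first by split=> //; exists 1; rewrite ?mulr1.
  move=> a b [Sa [a' Sa' aa']] [Sb [b' Sb' bb']]; split; first exact: SM.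
  by exists (a' * b'); [exact: SM|rewrite mulrACA aa' bb' mulr1].
move=> a [Sa [a' Sa' aa']]; exists a' => //; split=> //.
by exists a; rewrite // mulrC.
Qed.

End UnitsOf.

Section Ideles.
Variables (F : fieldType) (growthF : forall z : F, growth_bounded z).
Variable Fc : forall y : place F, completion y.
Implicit Types (y : place F) (f : F).
Local Notation A := (adele Fc).
Local Notation V y := (compl_val (Fc y)).
Implicit Types (a b c u : A).

Lemma val_ge_emb y n f : val_ge (V y) n (compl_emb (Fc y) f) = val_ge y n f.
Proof. by rewrite /val_ge compl_embE fmorph_eq0. Qed.

Lemma diag_fin f : finite_set
  [set y | compl_emb (Fc y) f \notin valring (compl_val (Fc y))].
Proof.
apply: sub_finite_set (finite_val_neq0 growthF f) => y /=.
apply: contraNneq => yf.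
by rewrite inE /= val_ge_emb /val_ge yf lexx orbT.
Qed.

Definition diag f : A := Adele (diag_fin f).

Lemma diagE f y : diag f y = compl_emb (Fc y) f. Proof. by []. Qed.

Lemma diagM f g : diag (f * g) = diag f * diag g.
Proof. by apply: adele_ext => y; rewrite diagE rmorphM. Qed.

Lemma diag1 : diag 1 = 1.
Proof. by apply: adele_ext => y; rewrite diagE rmorph1. Qed.

Lemma diag0 : diag 0 = 0.
Proof. by apply: adele_ext => y; rewrite diagE rmorph0. Qed.

Lemma diag_fieldP a : diag_field Fc a <-> exists f, a = diag f.
Proof.
split=> [[f af]|[f ->]]; last by exists f.
by exists f; apply: adele_ext => y; rewrite af.
Qed.

Lemma diag_unit f : f != 0 -> units_of (diag_field Fc) (diag f).
Proof.
move=> f0; split; first by exists f.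
by exists (diag f^-1); [exists f^-1|rewrite -diagM divff // diag1].
Qed.

Lemma idele_neq0 a : ideles Fc a -> forall y, a y != 0.
Proof.
move=> [_ [b _ ab]] y; apply/eqP => ay0.
have : a y * b y = 1 by rewrite -[a y * b y]/((a * b) y) ab.
by rewrite ay0 mul0r => /eqP; rewrite eq_sym oner_eq0.
Qed.

Lemma idele_val_fin a : ideles Fc a -> finite_set [set y | V y (a y) != 0].
Proof.
move=> Ia; have a0 := idele_neq0 Ia; have [_ [b _ ab]] := Ia.
have fin : finite_set ([set y | a y \notin valring (V y)] `|`
    [set y | b y \notin valring (V y)]).
  by rewrite finite_setU; split; apply: adele_fin.
apply: sub_finite_set fin => y /= Vay.
have aby : a y * b y = 1 by rewrite -[a y * b y]/((a * b) y) ab.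
have by0 : b y != 0.
  by apply/eqP => by0; move/eqP: aby; rewrite by0 mulr0 eq_sym oner_eq0.
have : V y (a y) + V y (b y) = 0 by rewrite -valM // aby Defs.val1.
rewrite !inE /= !val_geE // => Vab.
have [Va|Va] := leP 0 (V y (a y)); last by left.
by right; rewrite -ltNge; lia.
Qed.

Lemma mk_idele a : (forall y, a y != 0) ->
  finite_set [set y | V y (a y) != 0] -> ideles Fc a.
Proof.
move=> a0 fin; split=> //.
have fin' : finite_set [set y | (a y)^-1 \notin valring (V y)].
  apply: sub_finite_set fin => y /=; apply: contraNneq => Va.
  by rewrite inE /= val_geE ?invr_eq0 ?a0 // valV Va oppr0.
exists (Adele fin') => //; apply: adele_ext => y.
by rewrite -[LHS]/(a y * (a y)^-1) mulfV ?a0.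
Qed.

Lemma int_adele_unitP u : units_of (int_adele Fc) u <->
  forall y, u y != 0 /\ V y (u y) = 0.
Proof.
split=> [[Ou [w Ow uw]] y|uP].
  have u0 : u y != 0 by apply: idele_neq0; split=> //; exists w.
  have w0 : w y != 0.
    by apply: idele_neq0; split=> //; exists u; rewrite // mulrC.
  have uwy : u y * w y = 1 by rewrite -[u y * w y]/((u * w) y) uw.
  have : V y (u y) + V y (w y) = 0 by rewrite -valM // uwy Defs.val1.
  by have := Ou y; have := Ow y; rewrite !inE /= !val_geE //; split=> //; lia.
have [_ [w _ uw]] : ideles Fc u.
  apply: mk_idele => [y|]; first by case: (uP y).
  by apply: sub_finite_set (finite_set0 _) => y /=; case: (uP y) => _ ->.
have uwy y : u y * w y = 1 by rewrite -[u y * w y]/((u * w) y) uw.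
split=> [y|]; first by case: (uP y) => u0 Vu; rewrite inE /= val_geE // Vu.
exists w => // y; case: (uP y) => u0 Vu.
have -> : w y = (u y)^-1 by apply: (mulfI u0); rewrite uwy mulfV.
by rewrite inE /= val_geE ?invr_eq0 // valV Vu oppr0.
Qed.

Lemma eq_val_unit a b : ideles Fc a -> ideles Fc b ->
  (forall y, V y (a y) = V y (b y)) ->
  exists2 u, units_of (int_adele Fc) u & a = b * u.
Proof.
move=> Ia Ib Vab; have [_ [c _ bc]] := Ib.
have b0 := idele_neq0 Ib; have a0 := idele_neq0 Ia.
have bcy y : b y * c y = 1 by rewrite -[b y * c y]/((b * c) y) bc.
exists (c * a); last by rewrite mulrA bc mul1r.
apply/int_adele_unitP => y; rewrite -[(c * a) y]/(c y * a y).
have -> : c y = (b y)^-1 by apply: (mulfI (b0 y)); rewrite bcy mulfV.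
split; first by rewrite mulf_neq0 ?invr_eq0 ?a0 ?b0.
by rewrite valM ?invr_eq0 ?a0 ?b0 // valV Vab addNr.
Qed.

Definition principal_ideles : set A :=
  [set h | exists2 f, units_of (diag_field Fc) f &
           exists2 u, units_of (int_adele Fc) u & h = f * u].

Lemma diag_field_units_subgroup : is_unit_subgroup (units_of (diag_field Fc)).
Proof.
apply: units_of_subgroup; first by apply/diag_fieldP; exists 1; rewrite diag1.
move=> a b /diag_fieldP[f ->] /diag_fieldP[g ->]; apply/diag_fieldP.
by exists (f * g); rewrite diagM.
Qed.

Lemma int_adele_units_subgroup : is_unit_subgroup (units_of (int_adele Fc)).
Proof.
apply: units_of_subgroup => [y|a b Oa Ob y]; first exact: valring1.
exact: valringM.
Qed.

Lemma principal_ideles_subgroup : is_unit_subgroup principal_ideles.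
Proof.
have [F1 FM FV] := diag_field_units_subgroup.
have [O1 OM OV] := int_adele_units_subgroup.
split; first by exists 1 => //; exists 1; rewrite ?mulr1.
  move=> _ _ [f Ff [u Ou ->]] [g Fg [w Ow ->]].
  by exists (f * g); [exact: FM|exists (u * w); [exact: OM|rewrite mulrACA]].
move=> _ [f Ff [u Ou ->]]; have [f' Ff' ff'] := FV f Ff.
have [u' Ou' uu'] := OV u Ou.
exists (f' * u'); last by rewrite mulrACA ff' uu' mulr1.
by exists f' => //; exists u'.
Qed.

Lemma units_of_idele (S : set A) : units_of S `<=` ideles Fc.
Proof. by move=> a [_ [b _ ab]]; split=> //; exists b. Qed.

Let ideleM a b : ideles Fc a -> ideles Fc b -> ideles Fc (a * b).
Proof. by have [_ M _] := units_of_setT_subgroup A; apply: M. Qed.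

Lemma principal_ideles_sub : principal_ideles `<=` ideles Fc.
Proof.
move=> _ [f Ff [u Ou ->]].
by apply: ideleM; [exact: units_of_idele Ff|exact: units_of_idele Ou].
Qed.

Local Notation H := principal_ideles.

Lemma idele_classE a : idele_class a = [set b | eqmod H b a].
Proof.
apply/seteqP; split=> b /= [f].
  move=> Ff [u Ou ->]; exists (f * u); last by rewrite mulrAC mulrC.
  by exists f => //; exists u.
move=> [g Fg [u Ou ->]] ->; exists g => //; exists u => //.
by rewrite mulrA [a * g]mulrC.
Qed.

Lemma class_mod2E a : class_mod2 a = [set b | eqmod (square_extension H) b a].
Proof.
apply/seteqP; split=> b /=.
  rewrite /class_mod2 /= idele_classE => -[c [h Hh ->] [s Us ->]].
  by exists (h * (s * s)); [exists h, s|rewrite -mulrA].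
move=> [_ [h [s [Hh Us ->]]] ->]; exists (a * h).
  by rewrite idele_classE; exists h.
by exists s => //; rewrite mulrA.
Qed.

Lemma class_group_2torsionE : class_group_2torsion Fc = torsion_cosets H.
Proof.
have HH := principal_ideles_subgroup.
apply/seteqP; split=> C [a Ua [-> Ha]]; exists a => //; rewrite !idele_classE.
  split=> //; move: Ha; rewrite !idele_classE => /(eqmod_coset HH)[h Hh ->].
  by rewrite mul1r.
by split=> //; apply/(eqmod_coset HH); exists (a * a); rewrite ?mul1r.
Qed.

Variable k0 : seq F.
Hypothesis k0P : forall f, integral_on setT f -> f \in k0.
Variable x : place F.

(** The precision is relative to [c]. At the finitely many places where [a] is not integral or [c]
    is not a unit, the order [N] exceeds the values of [c]; elsewhere integrality is enough. *)
Lemma adelic_strong_approximation a c : ideles Fc c -> exists f,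
  forall y, y != x -> val_ge (V y) (V y (c y)) (a y - compl_emb (Fc y) f).
Proof.
move=> Ic; have fin : finite_set ([set y | a y \notin valring (V y)] `|`
    [set y | V y (c y) != 0]).
  by rewrite finite_setU; split; [exact: adele_fin|exact: idele_val_fin].
have [s sP] := (finite_seqP _).1 fin.
pose N := (\sum_(y <- s) `|V y (c y)|)%N.
have NP y : y \in s -> V y (c y) <= N%:Z.
  by move=> ys; rewrite /N (big_rem y) //=; lia.
have /choice[g gP] : forall y, exists g,
    val_ge (V y) N%:Z (a y - compl_emb (Fc y) g).
  by move=> y; apply: compl_dense.
have [|f [fs fo]] :=
  @strong_approximation _ growthF _ k0P x [seq y <- s | y != x] g N.
  by rewrite mem_filter eqxx.
exists f => y yx; have [ys|ys] := boolP (y \in s).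
  apply: val_ge_leq (NP y ys) _.
  have -> : a y - compl_emb (Fc y) f =
      (a y - compl_emb (Fc y) (g y)) - compl_emb (Fc y) (f - g y).
    by rewrite rmorphB; ring.
  by apply: val_geB => //; rewrite val_ge_emb; apply: fs; rewrite mem_filter yx.
have [Oa Vc] : a y \in valring (V y) /\ V y (c y) = 0.
  have nys : ~ ([set y | a y \notin valring (V y)] `|`
      [set y | V y (c y) != 0]) y.
    by rewrite sP => /(negP ys).
  split; first by apply: contrapT => /negP ay; apply: nys; left.
  by apply: contrapT => /eqP ay; apply: nys; right.
rewrite Vc; apply: val_geB; first exact: Oa.
by rewrite val_ge_emb; apply: fo => //; rewrite mem_filter negb_and ys orbT.
Qed.

Variables (pix : Fc x) (hpix : V x pix = 1).

Local Notation p := (idele_pi pix).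

Lemma idele_pi_at : p x = pix. Proof. exact: dfwith_in. Qed.

Lemma idele_pi_out y : y != x -> p y = 1.
Proof. by move=> yx; rewrite /p /= dfwith_out // eq_sym. Qed.

Lemma idele_pi_idele : ideles Fc p.
Proof.
apply: mk_idele => [y|].
  have [->|yx] := eqVneq y x; last by rewrite idele_pi_out ?oner_neq0.
  by rewrite idele_pi_at; apply: contra_eq_neq hpix => ->; rewrite valz0.
apply: sub_finite_set (finite_set1 x) => y; rewrite /mkset.
apply: contraNeq => yx.
by rewrite idele_pi_out // Defs.val1.
Qed.

Lemma adeleX a n y : (a ^+ n) y = a y ^+ n.
Proof. by elim: n => [//|n IH]; rewrite !exprS -IH. Qed.

Let ideleX a n : ideles Fc a -> ideles Fc (a ^+ n).
Proof.
have [U1 _ _] := units_of_setT_subgroup A.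
by move=> Ia; elim: n => [|n IH]; rewrite ?expr0 // exprS; apply: ideleM.
Qed.

Let val_pi_at n : V x ((p ^+ n) x) = n%:Z.
Proof. by rewrite adeleX idele_pi_at valX hpix natz. Qed.

Let val_pi_out n y : y != x -> V y ((p ^+ n) y) = 0.
Proof. by move=> yx; rewrite adeleX idele_pi_out // expr1n Defs.val1. Qed.

(** The class of [x] has infinite order: a function whose divisor is [n] times [x] is integral off
    [x], so its value [n] at [x] is at most 0. *)
Lemma idele_pi_free n : H (p ^+ n) -> n = 0%N.
Proof.
move=> [_ [/diag_fieldP[f ->] uf] [u /int_adele_unitP Ou pn]].
have [f0|f0] := eqVneq f 0.
  have := idele_neq0 (ideleX n idele_pi_idele) x.
  by rewrite pn f0 diag0 mul0r eqxx.
have Vf y : V y ((p ^+ n) y) = y f.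
  have [u0 Vu] := Ou y; rewrite pn -[(diag f * u) y]/(diag f y * u y).
  by rewrite valM ?diagE ?fmorph_eq0 // Vu addr0 compl_embE.
have xf := Vf x; rewrite val_pi_at in xf.
have : x f <= 0.
  apply: (integral_val_le0 k0P) => y /eqP yx.
  by rewrite val_geE // -Vf val_pi_out.
by rewrite -xf; lia.
Qed.

(** The key of [a] records by how much the divisor of the function [r a] exceeds that of [a] where
    [M] is not a unit. With equal keys, [a / b] and [r a / r b] have the same values off [x], so
    they differ by a power of [p] up to integral units. *)
Lemma class_key : exists (T : finType) (key : A -> T),
  forall a b, ideles Fc a -> ideles Fc b -> key a = key b ->
  eqmod (cyclic_extension H p) a b.
Proof.
have [M [BM M0] MP] := divisor_reduction growthF k0P x.
have /choice[r rP] : forall a, exists f, ideles Fc a -> f != 0 /\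
    forall y, y != x -> V y (a y) <= y f <= V y (a y) + y M.
  move=> a; have [Ia|nIa] := pselect (ideles Fc a); last by exists 0.
  by have [f f0 fP] := MP _ (idele_val_fin Ia); exists f.
have [s sP] := (finite_seqP _).1 (finite_val_neq0 growthF M).
pose K := (\sum_(y <- s) `|y M|)%N.
have KP y : y \in s -> (`|y M| <= K)%N.
  by move=> ys; rewrite /K (big_rem y) //= leq_addr.
(* Off [x] the excess lies between 0 and [y M], hence is at most [K], so [inord] loses nothing
   there. *)
pose key a : {ffun 'I_(size s) -> 'I_K.+1} :=
  [ffun i : 'I_(size s) => let y := nth x s i in
    inord `|y (r a) - V y (a y)|%N].
exists {ffun 'I_(size s) -> 'I_K.+1}, key => a b Ia Ib kab.
have [ra0 raP] := rP a Ia; have [rb0 rbP] := rP b Ib.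
have diff y : y != x -> y (r a) - V y (a y) = y (r b) - V y (b y).
  move=> yx; have := raP y yx; have := rbP y yx.
  have [ys|ys] := boolP (y \in s); last first.
    suff -> : y M = 0 by lia.
    apply/eqP; apply: contraNT ys => yM.
    by have : [set y : place F | y M != 0] y by []; rewrite sP.
  have is_ : (index y s < size s)%N by rewrite index_mem.
  have := congr1 (fun g : {ffun _ -> 'I_K.+1} => val (g (Ordinal is_))) kab.
  have := KP y ys; rewrite !ffunE /= nth_index // => yK + rb_ ra_.
  by rewrite !inordK; lia.
have [_ [b' _ bb']] := Ib; pose c := a * b'.
have Ib' : ideles Fc b' by split=> //; exists b; rewrite // mulrC.
have Ic : ideles Fc c by apply: ideleM.
pose f := r a / r b; have f0 : f != 0 by rewrite mulf_neq0 ?invr_eq0.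
have Vc y : V y (c y) = V y (a y) - V y (b y).
  rewrite -[c y]/(a y * b' y).
  have -> : b' y = (b y)^-1.
    apply: (mulfI (idele_neq0 Ib y)); rewrite mulfV ?idele_neq0 //.
    by rewrite -[LHS]/((b * b') y) bb'.
  by rewrite valM ?invr_eq0 ?idele_neq0 // valV.
have [n [m nm]] : exists n m : nat, V x (c x) + n%:Z = x f + m%:Z.
  have [le|lt] := leP (V x (c x)) (x f).
    by exists `|x f - V x (c x)|%N, 0%N; lia.
  by exists 0%N, `|x f - V x (c x)|%N; lia.
have Ip := idele_pi_idele.
have If : ideles Fc (diag f) by apply: units_of_idele (diag_unit f0).
have [||y|u Ou E] := @eq_val_unit (c * p ^+ n) (diag f * p ^+ m).
- by apply: ideleM => //; apply: ideleX.
- by apply: ideleM => //; apply: ideleX.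
- rewrite -[(c * p ^+ n) y]/(c y * (p ^+ n) y).
  rewrite -[(diag f * p ^+ m) y]/(diag f y * (p ^+ m) y).
  have In i := idele_neq0 (ideleX i Ip) y.
  rewrite (valM _ (idele_neq0 Ic y) (In n)) (valM _ (idele_neq0 If y) (In m)).
  rewrite diagE compl_embE; have [->|yx] := eqVneq y x.
    by rewrite !val_pi_at nm.
  rewrite !val_pi_out // !addr0 Vc /f valM ?invr_eq0 // valV.
  by have := diff y yx; lia.
exists c; last by rewrite /c mulrCA bb' mulr1.
split=> //; exists (diag f * u), n, m; split; last by rewrite E mulrAC.
by exists (diag f); [exact: diag_unit|exists u].
Qed.

Lemma finite_class_group_2torsion : finite_set (class_group_2torsion Fc).
Proof.
have [T [key keyP]] := class_key; rewrite class_group_2torsionE.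
apply: finite_torsion_cosets keyP.
- exact: principal_ideles_subgroup.
- exact: principal_ideles_sub.
- exact: idele_pi_idele.
- exact: idele_pi_free.
Qed.

Lemma card_class_mod2 : twice_class_group Fc (idele_class p) ->
  ([set class_mod2 a | a in ideles Fc] #=
    `I_(2 * #|` fset_set (class_group_2torsion Fc)|)%N)%card.
Proof.
have HH := principal_ideles_subgroup.
move=> [c Uc]; rewrite !idele_classE => /(eqmod_coset HH)[h Hh cc].
have [T [key keyP]] := class_key; rewrite class_group_2torsionE.
have -> : [set class_mod2 a | a in ideles Fc] = square_cosets H.
  by apply: eq_imagel => a _; rewrite class_mod2E.
apply: (card_square_cosets HH _ _ _ keyP Uc Hh); last by rewrite cc mulrC.
- exact: principal_ideles_sub.
- exact: idele_pi_idele.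
- exact: idele_pi_free.
Qed.

End Ideles.

(** * Two by two matrices *)

Lemma ord2P (P : 'I_2 -> Prop) : P 0 -> P 1 -> forall i, P i.
Proof.
move=> P0 P1 [[|[|//]] ltn2].
  by rewrite (_ : Ordinal ltn2 = 0) //; apply: val_inj.
by rewrite (_ : Ordinal ltn2 = 1) //; apply: val_inj.
Qed.

Section Mx2.
Variable R : comPzRingType.
Implicit Types (a b c d : R) (g h : 'M[R]_2) (S : set R).

Let ord2_0 : (0 : 'I_2) = lshift 1 (0 : 'I_1). Proof. exact: val_inj. Qed.
Let ord2_1 : (1 : 'I_2) = rshift 1 (0 : 'I_1). Proof. exact: val_inj. Qed.

Lemma mx2_00 a b c d : mx2 a b c d 0 0 = a.
Proof. by rewrite ord2_0 [LHS]block_mxEul mxE mulr1n. Qed.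

Lemma mx2_01 a b c d : mx2 a b c d 0 1 = b.
Proof. by rewrite ord2_0 ord2_1 [LHS]block_mxEur mxE mulr1n. Qed.

Lemma mx2_10 a b c d : mx2 a b c d 1 0 = c.
Proof. by rewrite ord2_0 ord2_1 [LHS]block_mxEdl mxE mulr1n. Qed.

Lemma mx2_11 a b c d : mx2 a b c d 1 1 = d.
Proof. by rewrite ord2_1 [LHS]block_mxEdr mxE mulr1n. Qed.

Definition mx2E := (mx2_00, mx2_01, mx2_10, mx2_11).

Lemma mx2_eq g h : g 0 0 = h 0 0 -> g 0 1 = h 0 1 -> g 1 0 = h 1 0 ->
  g 1 1 = h 1 1 -> g = h.
Proof. by move=> *; apply/matrixP; do 2!apply: ord2P. Qed.

Lemma mx2_eta g : g = mx2 (g 0 0) (g 0 1) (g 1 0) (g 1 1).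
Proof. by apply: mx2_eq; rewrite mx2E. Qed.

Lemma mul_mx2 a b c d a' b' c' d' :
  mx2 a b c d *m mx2 a' b' c' d' =
  mx2 (a * a' + b * c') (a * b' + b * d') (c * a' + d * c') (c * b' + d * d').
Proof.
have l1 : lift ord0 ord0 = 1 :> 'I_2 by apply: val_inj.
by apply: mx2_eq; rewrite mx2E mxE !big_ord_recl big_ord0 addr0 l1 !mx2E.
Qed.

Lemma add_mx2 a b c d a' b' c' d' :
  mx2 a b c d + mx2 a' b' c' d' = mx2 (a + a') (b + b') (c + c') (d + d').
Proof. by apply: mx2_eq; rewrite [LHS]mxE !mx2E. Qed.

Lemma scale_mx2 e a b c d :
  e *: mx2 a b c d = mx2 (e * a) (e * b) (e * c) (e * d).
Proof. by apply: mx2_eq; rewrite [LHS]mxE !mx2E. Qed.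

Lemma mx2_1 : 1%:M = mx2 1 0 0 1 :> 'M[R]_2.
Proof. by apply: mx2_eq; rewrite mx2E mxE. Qed.

Lemma det_mx22 g : \det g = g 0 0 * g 1 1 - g 0 1 * g 1 0.
Proof.
have l00 : lift 0 0 = 1 :> 'I_2 by apply: val_inj.
have l10 : lift 1 0 = 0 :> 'I_2 by apply: val_inj.
rewrite (expand_det_row _ 0) !big_ord_recl big_ord0 addr0 /cofactor.
have -> : lift ord0 ord0 = 1 :> 'I_2 by apply: val_inj.
rewrite !det_mx11 !mxE l00 l10.
by rewrite /= expr0 mul1r add0n expr1 mulN1r mulrN.
Qed.

Lemma det_mx2 a b c d : \det (mx2 a b c d) = a * d - b * c.
Proof. by rewrite det_mx22 !mx2E. Qed.

Lemma mul_mx2_adj g : g *m mx2 (g 1 1) (- g 0 1) (- g 1 0) (g 0 0) = (\det g)%:M.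
Proof.
rewrite {1 6}[g]mx2_eta mul_mx2 det_mx2.
apply: mx2_eq; rewrite mx2E mxE /= ?mulr1n ?mulr0n; ring.
Qed.

Lemma mul_adj_mx2 g : mx2 (g 1 1) (- g 0 1) (- g 1 0) (g 0 0) *m g = (\det g)%:M.
Proof.
rewrite {5 6}[g]mx2_eta mul_mx2 det_mx2.
apply: mx2_eq; rewrite mx2E mxE /= ?mulr1n ?mulr0n; ring.
Qed.

Variables (S : set R) (HS : is_subring S).

Lemma subring_det g : (forall i j, S (g i j)) -> S (\det g).
Proof.
move=> Sg; rewrite [g]mx2_eta det_mx2.
by apply: (subringB HS); apply: (subringM HS).
Qed.

Lemma GL2_det g : GL2 S g -> units_of S (\det g).
Proof.
move=> [Sg [h Sh [gh _]]]; split; first exact: subring_det.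
by exists (\det h); [exact: subring_det|rewrite -det_mulmx gh det1].
Qed.

Lemma GL2_intro g : (forall i j, S (g i j)) -> units_of S (\det g) -> GL2 S g.
Proof.
move=> Sg [_ [d Sd gd]]; split=> //.
exists (d *: mx2 (g 1 1) (- g 0 1) (- g 1 0) (g 0 0)).
  do 2!apply: ord2P; rewrite mxE mx2E; apply: (subringM HS) => //;
    exact: (subringN HS).
by rewrite -scalemxAr -scalemxAl mul_mx2_adj mul_adj_mx2 scale_scalar_mx mulrC gd.
Qed.

Lemma subring_mulmx g h : (forall i j, S (g i j)) -> (forall i j, S (h i j)) ->
  forall i j, S ((g *m h) i j).
Proof.
move=> Sg Sh i j; rewrite mxE; elim/big_ind: _ => [|a b|k _].
- exact: (subring0 HS).
- exact: (subringD HS).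
- exact: (subringM HS).
Qed.

Lemma GL2M g h : GL2 S g -> GL2 S h -> GL2 S (g *m h).
Proof.
move=> [Sg [g' Sg' [gg' g'g]]] [Sh [h' Sh' [hh' h'h]]].
split; first exact: subring_mulmx.
exists (h' *m g'); first exact: subring_mulmx.
rewrite !mulmxA -[_ *m h *m _]mulmxA hh' mulmx1 gg'.
by rewrite -[_ *m g' *m _]mulmxA g'g mulmx1 h'h.
Qed.

Lemma GL2_1 : GL2 S 1%:M.
Proof.
have S1 (i j : 'I_2) : S ((1%:M : 'M[R]_2) i j).
  by rewrite mxE; case: eqP => _; [exact: (subring1 HS)|exact: (subring0 HS)].
by split=> //; exists 1%:M; rewrite ?mulmx1.
Qed.

Lemma GL2_inv g : GL2 S g ->
  exists2 h, GL2 S h & g *m h = 1%:M /\ h *m g = 1%:M.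
Proof.
move=> [Sg [h Sh [gh hg]]]; exists h => //; split=> //; exists g => //.
Qed.

End Mx2.

(** * Strong approximation for the special linear group *)

Section Graph.
Variables (F : fieldType) (growthF : forall z : F, growth_bounded z).
Variable Fc : forall y : place F, completion y.
Variable k0 : seq F.
Hypothesis k0P : forall f, integral_on setT f -> f \in k0.
Variables (x : place F) (pix : Fc x) (hpix : compl_val (Fc x) pix = 1).
Local Notation A := (adele Fc).
Local Notation V y := (compl_val (Fc y)).
Local Notation H := (@principal_ideles F Fc).
Local Notation HL := (square_extension H).
Local Notation p := (idele_pi pix).
Implicit Types (y : place F) (f : F) (a b c e : A) (g h X Y : 'M[A]_2).

Definition component_at y (a : A) : Fc y := a y.

Fact component_at_zmod_morphism y : zmod_morphism (component_at y).
Proof. by []. Qed.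

Fact component_at_monoid_morphism y : monoid_morphism (component_at y).
Proof. by []. Qed.

HB.instance Definition _ y := GRing.isZmodMorphism.Build A (Fc y)
  (component_at y) (component_at_zmod_morphism y).
HB.instance Definition _ y := GRing.isMonoidMorphism.Build A (Fc y)
  (component_at y) (component_at_monoid_morphism y).

Definition mx_at y (g : 'M[A]_2) : 'M[Fc y]_2 := map_mx (component_at y) g.

Lemma mx_atE y g i j : mx_at y g i j = g i j y.
Proof. by rewrite mxE. Qed.

Lemma mx_at_ext g h : (forall y, mx_at y g = mx_at y h) -> g = h.
Proof.
move=> gh; apply/matrixP => i j; apply: adele_ext => y.
by have /matrixP/(_ i j) := gh y; rewrite !mxE.
Qed.

Lemma mx_atM y g h : mx_at y (g *m h) = mx_at y g *m mx_at y h.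
Proof. exact: map_mxM. Qed.

Lemma mx_at1 y : mx_at y 1%:M = 1%:M.
Proof. exact: map_mx1. Qed.

Lemma det_mx_at y g : \det (mx_at y g) = (\det g) y.
Proof. exact: det_map_mx. Qed.

Lemma mx_at_matrix_at (m : 'M[Fc x]_2) : mx_at x (matrix_at m) = m.
Proof. by apply/matrixP => i j; rewrite !mxE; apply: dfwith_in. Qed.

Lemma mx_at_matrix_at_out (m : 'M[Fc x]_2) y : y != x ->
  mx_at y (matrix_at m) = 1%:M.
Proof.
move=> yx; rewrite -(mx_at1 y); apply/matrixP => i j; rewrite [LHS]mxE [RHS]mxE.
by rewrite /component_at [matrix_at _ _ _]mxE /= dfwith_out // eq_sym.
Qed.

Lemma matrix_atM (m n : 'M[Fc x]_2) :
  matrix_at (m *m n) = matrix_at m *m matrix_at n.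
Proof.
apply: mx_at_ext => y; rewrite mx_atM; have [->|yx] := eqVneq y x.
  by rewrite !mx_at_matrix_at.
by rewrite !mx_at_matrix_at_out // mulmx1.
Qed.

Lemma matrix_at1 : matrix_at (1%:M : 'M[Fc x]_2) = 1%:M.
Proof.
apply: mx_at_ext => y; rewrite mx_at1; have [->|yx] := eqVneq y x.
  by rewrite mx_at_matrix_at.
by rewrite mx_at_matrix_at_out.
Qed.

Lemma det_matrix_at (m : 'M[Fc x]_2) : \det (matrix_at m) = adele_at 1 (\det m).
Proof.
apply: adele_ext => y; rewrite -det_mx_at; have [->|yx] := eqVneq y x.
  by rewrite mx_at_matrix_at; apply/esym/dfwith_in.
by rewrite mx_at_matrix_at_out // det1 /= dfwith_out // eq_sym.
Qed.

Lemma det_xi (w : option (Fc x)) : \det (xi pix w) = p.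
Proof.
rewrite /xi det_matrix_at; congr adele_at.
by case: w => [b|] /=; rewrite det_mx2 ?mulr1 ?mul1r !mulr0 subr0.
Qed.

Let HT : is_subring [set: A]. Proof. by []. Qed.

Lemma diag_field_subring : is_subring (diag_field Fc).
Proof.
split; first by exists 1 => y; rewrite rmorph1.
  move=> a b [f af] [f' bf]; exists (f - f') => y.
  by rewrite rmorphB -af -bf.
by move=> a b [f af] [f' bf]; exists (f * f') => y; rewrite rmorphM -af -bf.
Qed.

Lemma int_adele_subring : is_subring (int_adele Fc).
Proof.
split=> [y|a b Oa Ob y|a b Oa Ob y]; first exact: valring1.
  by apply: valringD => //; apply: valringN.
exact: valringM.
Qed.

Local Notation GA := (GL2 [set: A]).

Lemma GL2_idele g : GA g <-> ideles Fc (\det g).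
Proof. by split=> [/(GL2_det HT)//|ug]; apply: (GL2_intro HT). Qed.

Lemma dcoset_refl g : dcoset g g.
Proof.
exists 1%:M; first exact: (GL2_1 diag_field_subring).
exists 1%:M; first exact: (GL2_1 int_adele_subring).
exists 1; first by case: (units_of_setT_subgroup A).
by rewrite scale1r mul1mx mulmx1.
Qed.

Lemma dcoset_sym g h : dcoset g h -> dcoset h g.
Proof.
move=> [ga Ga [ka Ka [z Uz ->]]].
have [ga' Ga' [_ gag]] := GL2_inv Ga; have [ka' Ka' [kak _]] := GL2_inv Ka.
have [_ _ /(_ z Uz)[z' Uz' zz']] := units_of_setT_subgroup A.
exists ga' => //; exists ka' => //; exists z' => //.
rewrite -scalemxAr -scalemxAl scalerA mulrC zz' scale1r.
by rewrite !mulmxA gag mul1mx -mulmxA kak mulmx1.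
Qed.

Lemma dcoset_trans g h X : dcoset g h -> dcoset h X -> dcoset g X.
Proof.
move=> [ga Ga [ka Ka [z Uz ->]]] [gb Gb [kb Kb [w Uw ->]]].
exists (gb *m ga); first exact: (GL2M diag_field_subring).
exists (ka *m kb); first exact: (GL2M int_adele_subring).
exists (w * z); first by have [_ UM _] := units_of_setT_subgroup A; apply: UM.
by rewrite -scalemxAr -scalemxAl scalerA !mulmxA.
Qed.

Lemma dcoset_eqP g h : dcoset g = dcoset h <-> dcoset g h.
Proof.
split=> [->|gh]; first exact: dcoset_refl.
apply/seteqP; split=> X; last exact: dcoset_trans.
by apply: dcoset_trans; apply: dcoset_sym.
Qed.

Lemma dcoset_intro g ga ka : GL2 (diag_field Fc) ga -> GL2 (int_adele Fc) ka ->
  dcoset (ga *m g *m ka) = dcoset g.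
Proof.
move=> Ga Ka; apply/esym/dcoset_eqP; exists ga => //; exists ka => //.
by exists 1; [case: (units_of_setT_subgroup A)|rewrite scale1r].
Qed.

Let HLs : is_unit_subgroup HL.
Proof. exact: square_extension_subgroup (principal_ideles_subgroup growthF Fc). Qed.

Lemma class_mod2P a b : class_mod2 a = class_mod2 b <-> eqmod HL a b.
Proof. by rewrite !class_mod2E; apply: eqmod_coset. Qed.

Lemma dcoset_det g h : dcoset g h -> eqmod HL (\det h) (\det g).
Proof.
move=> [ga /(GL2_det diag_field_subring) Ga].
move=> [ka /(GL2_det int_adele_subring) Ka [z Uz ->]].
exists (\det ga * \det ka * (z * z)).
  exists (\det ga * \det ka), z; split=> //.
  by exists (\det ga) => //; exists (\det ka).
by rewrite detZ !det_mulmx expr2; ring.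
Qed.

Lemma label_dcoset g h : dcoset g = dcoset h -> label g = label h.
Proof. by move/dcoset_eqP/dcoset_sym/dcoset_det/class_mod2P. Qed.

(** * Matrices at x keep every vertex in its component *)

Section Local.
Local Notation conn := (connected_in pix).
Local Notation O := (valring (V x)).
Implicit Types m n : 'M[Fc x]_2.

Lemma pix_neq0 : pix != 0.
Proof. by apply: contra_eq_neq hpix => ->; rewrite valz0. Qed.

Lemma matrix_at_GL2 m : \det m != 0 -> GA (matrix_at m).
Proof.
move=> m0; apply/GL2_idele; rewrite det_matrix_at; apply: mk_idele => [y|].
  have [->|yx] := eqVneq y x; first by rewrite /= dfwith_in.
  by rewrite /= dfwith_out ?oner_neq0 // eq_sym.
apply: sub_finite_set (finite_set1 x) => y; rewrite /mkset.
apply: contraNeq => yx.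
by rewrite /= dfwith_out 1?eq_sym // Defs.val1.
Qed.

Lemma matrix_at_int m : (forall i j, m i j \in O) -> V x (\det m) = 0 ->
  \det m != 0 -> GL2 (int_adele Fc) (matrix_at m).
Proof.
move=> Om Vm m0; apply: (GL2_intro int_adele_subring) => [i j y|].
  have [->|yx] := eqVneq y x.
    by rewrite mxE /= dfwith_in.
  rewrite mxE /= dfwith_out 1?eq_sym // !mxE.
  by case: eqP => _; [exact: valring1|exact: valring0].
rewrite det_matrix_at; apply/int_adele_unitP => y.
have [->|yx] := eqVneq y x; first by rewrite /= dfwith_in.
rewrite /= dfwith_out; last by rewrite eq_sym.
by split; [exact: oner_neq0|exact: Defs.val1].
Qed.

(** The determinant condition is carried along so that [X *m matrix_at m] is again invertible and
    the property can be composed. *)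
Definition preserves_components m := \det m != 0 /\
  forall X, GA X -> conn (dcoset (X *m matrix_at m)) (dcoset X).

Local Notation good := preserves_components.

Lemma preserves_componentsM m n : good m -> good n -> good (m *m n).
Proof.
move=> [m0 gm] [n0 gn]; split; first by rewrite det_mulmx mulf_neq0.
move=> X GX; rewrite matrix_atM mulmxA; apply: (rst_trans _ _ _ _ _ _ (gm X GX)).
by apply: gn; apply: (GL2M HT) => //; apply: matrix_at_GL2.
Qed.

Lemma preserves_componentsV m n : good m -> n *m m = 1%:M -> good n.
Proof.
move=> [m0 gm] nm.
have n0 : \det n != 0.
  apply: contra_eq_neq (congr1 determinant nm); rewrite det_mulmx => ->.
  by rewrite mul0r det1 eq_sym oner_neq0.
split; first exact: n0.
move=> X GX; apply: rst_sym.
have := gm (X *m matrix_at n); rewrite -mulmxA -matrix_atM nm matrix_at1 mulmx1.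
by apply; apply: (GL2M HT) => //; apply: matrix_at_GL2.
Qed.

Lemma preserves_components_int m : (forall i j, m i j \in O) ->
  V x (\det m) = 0 -> \det m != 0 -> good m.
Proof.
move=> Om Vm m0; split=> // X GX; rewrite -[X *m _]mul1mx mulmxA.
rewrite dcoset_intro; [exact: rst_refl|exact: (GL2_1 diag_field_subring)|].
exact: matrix_at_int.
Qed.

Lemma preserves_components_pi : good (mx2 1 0 0 pix).
Proof.
split; first by rewrite det_mx2 mul1r mul0r subr0 pix_neq0.
by move=> X GX; apply/rst_sym/rst_step; exists X => //; exists None.
Qed.

Let good_swap : good (mx2 0 1 1 0).
Proof.
apply: preserves_components_int.
- by do 2!apply: ord2P; rewrite mx2E ?valring0 ?valring1.
- by rewrite det_mx2 mul0r mul1r sub0r valN Defs.val1.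
- by rewrite det_mx2 mul0r mul1r sub0r oppr_eq0 oner_neq0.
Qed.

Let good_swapped (a b c d : Fc x) : good (mx2 a b c d) -> good (mx2 d c b a).
Proof.
move=> gm.
have := preserves_componentsM good_swap (preserves_componentsM gm good_swap).
by rewrite !mul_mx2 !(mul0r, mulr0, mul1r, mulr1, add0r, addr0).
Qed.

Let good_diag1 (a : Fc x) : a != 0 -> good (mx2 a 0 0 1).
Proof.
move=> a0; have pi0 := pix_neq0.
have gX i : good (mx2 (pix ^+ i) 0 0 1).
  elim: i => [|i IH].
    rewrite expr0 -mx2_1; apply: preserves_components_int;
      rewrite ?det1 ?oner_neq0 ?Defs.val1 //.
    by move=> i j; rewrite mxE; case: eqP => _; rewrite ?valring0 ?valring1.
  have := preserves_componentsM (good_swapped preserves_components_pi) IH.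
  by rewrite mul_mx2 !(mul0r, mulr0, mulr1, add0r, addr0) exprS.
have gZ (n : int) : good (mx2 (pix ^ n) 0 0 1).
  case: n => n; first exact: gX.
  apply: (preserves_componentsV (gX n.+1)).
  by rewrite mul_mx2 !(mul0r, mulr0, mulr1, add0r, addr0) NegzE -invr_expz
             mulVf ?expf_neq0 // mx2_1.
have gu (u : Fc x) : u != 0 -> V x u = 0 -> good (mx2 u 0 0 1).
  move=> u0 Vu; apply: preserves_components_int;
    rewrite ?det_mx2 ?mulr1 ?mulr0 ?subr0 //.
  do 2!apply: ord2P; rewrite mx2E ?valring0 ?valring1 //.
  by rewrite inE /= val_geE // Vu.
have := preserves_componentsM (gZ (V x a)) (gu (a / pix ^ V x a) _ _).
have aE : pix ^ V x a * (a / pix ^ V x a) = a.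
  by rewrite mulrCA mulfV ?mulr1 // expfz_neq0.
rewrite mul_mx2 !(mul0r, mulr0, mulr1, add0r, addr0) aE.
apply; first by rewrite mulf_neq0 ?invr_eq0 ?expfz_neq0.
by rewrite valM ?invr_eq0 ?expfz_neq0 // valV val_exprz hpix mul1r subrr.
Qed.

Let good_diag (a d : Fc x) : a != 0 -> d != 0 -> good (mx2 a 0 0 d).
Proof.
move=> a0 d0.
have := preserves_componentsM (good_diag1 a0) (good_swapped (good_diag1 d0)).
by rewrite mul_mx2 !(mul0r, mulr0, mul1r, mulr1, add0r, addr0).
Qed.

(** Conjugation by the diagonal matrix with entries [b], 1 turns the integral unipotent matrix with
    entry 1 into the one with entry [b]. *)
Let good_upper (b : Fc x) : good (mx2 1 b 0 1).
Proof.
have g1 (b' : Fc x) : b' \in O -> good (mx2 1 b' 0 1).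
  move=> Ob; apply: preserves_components_int;
    rewrite ?det_mx2 ?mulr1 ?mulr0 ?subr0 ?oner_neq0 ?Defs.val1 //.
  by do 2!apply: ord2P; rewrite mx2E ?valring0 ?valring1.
have [->|b0] := eqVneq b 0; first by apply: g1; apply: valring0.
have bV : b^-1 != 0 by rewrite invr_eq0.
have := preserves_componentsM (good_diag1 b0)
  (preserves_componentsM (g1 1 (valring1 _)) (good_diag1 bV)).
by rewrite !mul_mx2 !(mul0r, mulr0, mul1r, mulr1, add0r, addr0) mulfV.
Qed.

(* Bruhat decomposition *)
Lemma preserves_componentsT m : \det m != 0 -> good m.
Proof.
rewrite [m]mx2_eta; move: (m 0 0) (m 0 1) (m 1 0) (m 1 1) => a b c d.
rewrite det_mx2 => det0; have [c0|c0] := eqVneq c 0.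
  rewrite c0 mulr0 subr0 mulf_eq0 negb_or in det0 *; case/andP: det0 => a0 d0.
  have := preserves_componentsM (good_diag a0 d0) (good_upper (b / a)).
  have bE : a * (b / a) = b by rewrite mulrCA mulfV ?mulr1.
  by rewrite mul_mx2 !(mul0r, mulr0, mulr1, add0r, addr0) bE.
have e0 : - ((a * d - b * c) / c) != 0 by rewrite oppr_eq0 mulf_neq0 ?invr_eq0.
have := preserves_componentsM (good_upper (a / c))
  (preserves_componentsM good_swap
  (preserves_componentsM (good_diag c0 e0) (good_upper (d / c)))).
rewrite !mul_mx2 !(mul0r, mulr0, mul1r, mulr1, add0r, addr0).
have dE : c * (d / c) = d by rewrite mulrCA mulfV ?mulr1.
have bE : - ((a * d - b * c) / c) + a / c * d = b by field.
rewrite (divfK c0) dE bE; exact: id.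
Qed.

End Local.

(* X and Y differ by PGL_2(F), by PGL_2(O_y) at the places y other than x, and
   by an arbitrary matrix at x. *)
Definition similar_off X Y := exists ga ka ka' : 'M[A]_2,
  [/\ GL2 (diag_field Fc) ga,
  ka *m ka' = 1%:M /\ ka' *m ka = 1%:M,
  forall y, y != x -> forall i j, ka i j y \in valring (V y),
  forall y, y != x -> forall i j, ka' i j y \in valring (V y)
  & X = ga *m Y *m ka].

Lemma similar_off_trans X Y g :
  similar_off X Y -> similar_off Y g -> similar_off X g.
Proof.
move=> [ga [ka [ka' [Ga [kk kk'] Ka Ka' ->]]]].
move=> [gb [kb [kb' [Gb [ll ll'] Kb Kb' ->]]]].
have Omul y (m n : 'M[A]_2) : (forall i j, m i j y \in valring (V y)) ->
    (forall i j, n i j y \in valring (V y)) ->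
    forall i j, (m *m n) i j y \in valring (V y).
  move=> Om On i j; rewrite -mx_atE mx_atM mxE.
  elim/big_ind: _ => [|a b|k _]; [exact: valring0|exact: valringD|].
  by apply: valringM; rewrite mx_atE.
exists (ga *m gb), (kb *m ka), (ka' *m kb'); split.
- exact: (GL2M diag_field_subring).
- rewrite !mulmxA -[_ *m ka *m _]mulmxA kk mulmx1 ll.
  by rewrite -[_ *m kb' *m _]mulmxA ll' mulmx1 kk'.
- by move=> y yx; apply: Omul; [apply: Kb|apply: Ka].
- by move=> y yx; apply: Omul; [apply: Ka'|apply: Kb'].
- by rewrite !mulmxA.
Qed.

(** [ka] is its component at [x], which preserves components, times a matrix integral at all places,
    which the double coset absorbs. *)
Lemma similar_off_connected X Y : GA Y -> similar_off X Y ->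
  connected_in pix (dcoset X) (dcoset Y).
Proof.
move=> GY [ga [ka [ka' [Ga [kk kk'] Ka Ka' ->]]]].
pose k := mx_at x ka; pose k' := mx_at x ka'.
have kk1 : k *m k' = 1%:M by rewrite -mx_atM kk mx_at1.
have kk1' : k' *m k = 1%:M by rewrite -mx_atM kk' mx_at1.
have det0 : \det k != 0.
  apply: contra_eq_neq (congr1 determinant kk1); rewrite det_mulmx => ->.
  by rewrite mul0r det1 eq_sym oner_neq0.
have -> : ga *m Y *m ka = ga *m (Y *m matrix_at k) *m (matrix_at k' *m ka).
  rewrite !mulmxA -[_ *m matrix_at k *m _]mulmxA -matrix_atM kk1 matrix_at1.
  by rewrite mulmx1.
rewrite dcoset_intro //; first by case: (preserves_componentsT det0) => _; apply.
have int1 y (i j : 'I_2) : (1%:M : 'M[Fc y]_2) i j \in valring (V y).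
  by rewrite mxE; case: eqP => _; rewrite ?valring0 ?valring1.
split.
  move=> i j y; rewrite -mx_atE mx_atM; have [->|yx] := eqVneq y x.
    by rewrite mx_at_matrix_at kk1'.
  by rewrite mx_at_matrix_at_out // mul1mx mx_atE; apply: Ka.
exists (ka' *m matrix_at k).
  move=> i j y; rewrite -mx_atE mx_atM; have [->|yx] := eqVneq y x.
    by rewrite mx_at_matrix_at kk1'.
  by rewrite mx_at_matrix_at_out // mulmx1 mx_atE; apply: Ka'.
split.
  rewrite !mulmxA -[_ *m ka *m _]mulmxA kk mulmx1 -matrix_atM kk1' matrix_at1 //.
rewrite !mulmxA -[_ *m matrix_at k *m _]mulmxA -matrix_atM kk1 matrix_at1 mulmx1.
by rewrite kk'.
Qed.

Lemma adele_denominator a : exists c,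
  [/\ ideles Fc c, int_adele Fc c & int_adele Fc (c * a)].
Proof.
pose cf y : Fc y := if a y \in valring (V y) then 1 else (a y)^-1.
have Oc y : cf y \in valring (V y).
  rewrite /cf; case: ifPn => [_|]; first exact: valring1.
  rewrite !inE /= /val_ge negb_or valV -ltNge => /andP[_ Va].
  by apply/orP; right; lia.
have fin : finite_set [set y | cf y \notin valring (V y)].
  by apply: sub_finite_set (finite_set0 _) => y /=; rewrite Oc.
exists (Adele fin); split=> //.
- apply: mk_idele => [y|].
    rewrite /= /cf; case: ifPn => [_|]; first exact: oner_neq0.
    by rewrite !inE /= negb_or invr_eq0 => /andP[].
  apply: sub_finite_set (adele_fin a) => y; rewrite /mkset /= /cf.
  by case: ifPn => // _; rewrite Defs.val1.
- move=> y; rewrite -[(_ * a) y]/(cf y * a y) /cf; case: ifPn => [ay|].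
    by rewrite mul1r.
  rewrite !inE /= negb_or => /andP[ay _]; rewrite mulVf //; exact: val_ge1.
Qed.

Lemma adele_denominators (s : seq A) : exists2 c, ideles Fc c &
  int_adele Fc c /\ forall a, a \in s -> int_adele Fc (c * a).
Proof.
have [U1 UM _] := units_of_setT_subgroup A.
have OM := subringM int_adele_subring.
elim: s => [|a s [c Ic [Oc cs]]].
  by exists 1 => //; split=> //; apply: (subring1 int_adele_subring).
have [d [Id Od da]] := adele_denominator a.
exists (d * c); first exact: UM.
split; first exact: OM.
move=> b; rewrite inE => /orP[/eqP ->|/cs cb].
  by rewrite mulrAC; apply: OM.
by rewrite -mulrA; apply: OM.
Qed.

(** With [N' = X^-1 N X], multiplying [X] by [1 + d N'] on the right is multiplying by [1 + d N] on
    the left. Write [a = f + d] with [f] in [F] and [d] so small off [x] that [d N'] is integral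
    there. As [N] has square zero, [(1 + f N) X (1 + d N') = (1 + a N) X]. *)
Lemma nilpotent_similar_off N a X : GA X -> N *m N = 0 ->
  (forall i j, diag_field Fc (N i j)) -> similar_off ((1%:M + a *: N) *m X) X.
Proof.
move=> [_ [X' _ [XX' X'X]]] NN dN.
pose N' := X' *m N *m X.
have N'N' : N' *m N' = 0.
  rewrite /N' !mulmxA -[_ *m X *m X']mulmxA XX' mulmx1 -[X' *m N *m N]mulmxA NN.
  by rewrite mulmx0 mul0mx.
have [c Ic [Oc cN]] :=
  adele_denominators [:: N' 0 0; N' 0 1; N' 1 0; N' 1 1].
have [f fP] := adelic_strong_approximation growthF k0P x a Ic.
pose d := a - diag growthF Fc f.
have Od y i j : y != x -> (d *: N') i j y \in valring (V y).
  move=> yx; have dy := fP y yx.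
  have {}cN : (c * N' i j) y \in valring (V y).
    apply: cN; move: i j; do 2!apply: ord2P; rewrite !inE eqxx ?orbT //.
  rewrite mxE -[(d * _) y]/(d y * N' i j y).
  have cy0 := idele_neq0 Ic y.
  have -> : d y * N' i j y = (d y / c y) * (c y * N' i j y).
    by rewrite mulrA divfK.
  apply: valringM => //; apply: val_ge_div => //.
  by rewrite add0r.
have O1 y (i j : 'I_2) : (1%:M : 'M[A]_2) i j y \in valring (V y).
  by rewrite mxE; case: eqP => _; [exact: valring1|exact: valring0].
have sqz (M : 'M[A]_2) b : M *m M = 0 ->
    (1%:M + b *: M) *m (1%:M - b *: M) = 1%:M /\
    (1%:M - b *: M) *m (1%:M + b *: M) = 1%:M.
  move=> MM; have PP : (b *: M) *m (b *: M) = 0.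
    by rewrite -scalemxAr -scalemxAl MM !scaler0.
  split.
    by rewrite mulmxDl mul1mx mulmxDr mulmx1 mulmxN PP oppr0 addr0 subrK.
  by rewrite mulmxDl mul1mx mulNmx mulmxDr mulmx1 PP addr0 addrK.
have mxB (M M' : 'M[A]_2) i j : (M - M') i j = M i j - M' i j by rewrite !mxE.
have diagf : diag_field Fc (diag growthF Fc f) by exists f.
exists (1%:M + diag growthF Fc f *: N), (1%:M + d *: N'), (1%:M - d *: N'); split.
- have HD := diag_field_subring.
  have D1 (i j : 'I_2) : diag_field Fc ((1%:M : 'M[A]_2) i j).
    by rewrite mxE; case: eqP => _; [exact: (subring1 HD)|exact: (subring0 HD)].
  split=> [i j|].
    rewrite mxE; apply: (subringD HD); first exact: D1.
    by rewrite mxE; exact: (subringM HD).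
  exists (1%:M - diag growthF Fc f *: N); last exact: sqz.
  move=> i j; rewrite mxB; apply: (subringB HD); first exact: D1.
  by rewrite mxE; exact: (subringM HD).
- exact: sqz.
- move=> y yx i j; rewrite mxE.
  by apply: (@valringD _ (V y) ((1%:M : 'M[A]_2) i j y)); [exact: O1|exact: Od].
- move=> y yx i j; rewrite mxB.
  apply: (@valringD _ (V y) ((1%:M : 'M[A]_2) i j y)); first exact: O1.
  by apply: valringN; exact: Od.
- have XN : X *m N' = N *m X by rewrite /N' !mulmxA XX' mul1mx.
  have -> : (1%:M + diag growthF Fc f *: N) *m X *m (1%:M + d *: N') =
            (1%:M + diag growthF Fc f *: N) *m (1%:M + d *: N) *m X.
    rewrite -!mulmxA; congr (_ *m _); rewrite mulmxDr mulmxDl mulmx1 mul1mx.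
    by rewrite -scalemxAr XN scalemxAl.
  congr (_ *m _); rewrite mulmxDr !mulmxDl !mul1mx mulmx1.
  rewrite -scalemxAr -scalemxAl NN !scaler0 addr0 -addrA -scalerDl.
  by rewrite /d [X in _ = 1%:M + X *: N]addrC subrK.
Qed.

Definition e12 a : 'M[A]_2 := mx2 1 a 0 1.
Definition e21 a : 'M[A]_2 := mx2 1 0 a 1.

Lemma e12_similar_off a X : GA X -> similar_off (e12 a *m X) X.
Proof.
have HD := diag_field_subring.
have -> : e12 a = 1%:M + a *: mx2 0 1 0 0.
  by rewrite mx2_1 scale_mx2 add_mx2 !(mulr0, mulr1, addr0, add0r).
move=> GX; apply: nilpotent_similar_off => //.
  by rewrite mul_mx2 !(mulr0, mul0r, addr0); apply: mx2_eq; rewrite mx2E mxE.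
by do 2!apply: ord2P; rewrite mx2E;
   (exact: (subring0 HD) || exact: (subring1 HD)).
Qed.

Lemma e21_similar_off a X : GA X -> similar_off (e21 a *m X) X.
Proof.
have HD := diag_field_subring.
have -> : e21 a = 1%:M + a *: mx2 0 0 1 0.
  by rewrite mx2_1 scale_mx2 add_mx2 !(mulr0, mulr1, addr0, add0r).
move=> GX; apply: nilpotent_similar_off => //.
  by rewrite mul_mx2 !(mulr0, mul0r, addr0); apply: mx2_eq; rewrite mx2E mxE.
by do 2!apply: ord2P; rewrite mx2E;
   (exact: (subring0 HD) || exact: (subring1 HD)).
Qed.

(* The choice of e makes the lower left entry of e21 (- e) h nonzero, and a
   unit wherever h is integral. *)
Lemma SL2_elementary h : \det h = 1 ->
  exists e a b c, h = e21 e *m (e12 a *m (e21 b *m e12 c)).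
Proof.
rewrite [h]mx2_eta; move: (h 0 0) (h 0 1) (h 1 0) (h 1 1) => a b c d.
rewrite det_mx2 => dt.
pose int y := [&& a y \in valring (V y), b y \in valring (V y),
  c y \in valring (V y) & d y \in valring (V y)].
pose ok y (s : Fc y) := (s != 0) && (int y ==> (V y s == 0)).
pose ef y : Fc y := if ok y (c y) then 0 else 1.
have fin : finite_set [set y | ef y \notin valring (V y)].
  apply: sub_finite_set (finite_set0 _) => y /=; rewrite /ef.
  by case: ifP; rewrite ?valring0 ?valring1.
pose e : A := Adele fin.
have okc y : ok y ((c - e * a) y).
  rewrite -[(c - e * a) y]/(c y - ef y * a y) /ef.
  case: ifPn => [oc|]; first by rewrite mul0r subr0.
  have dty : a y * d y - b y * c y = 1.
    by rewrite -[LHS]/((a * d - b * c) y) dt.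
  rewrite mul1r /ok; have [iy|niy] := boolP (int y); last first.
    rewrite !implyFb !andbT negbK => /eqP c0; rewrite c0 sub0r oppr_eq0.
    apply: contra_eq_neq dty => ->; rewrite c0 mul0r mulr0 subr0.
    by rewrite eq_sym oner_neq0.
  (* All entries are integral at [y] and [c] is not a unit there, so the determinant forces [a] and
     [d] to be units; hence [c - a] is a unit. *)
  rewrite !implyTb negb_and negbK => nc; case/and4P: iy => Oa Ob Oc Od.
  have mc : val_ge (V y) 1 (c y).
    have [->|c0] := eqVneq (c y) 0; first exact: val_ge0.
    rewrite (negPf c0) /= in nc; move: Oc; rewrite inE /= !val_geE //.
    by move: nc; case: (V y (c y)) => [[|n]|n].
  have [|ad0 Vad] := @val_near _ (V y) (a y * d y) 1 (oner_neq0 _).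
    have -> : a y * d y - 1 = c y * b y by rewrite -dty; ring.
    by rewrite Defs.val1; apply: val_geMr.
  have [a0 d0] : a y != 0 /\ d y != 0.
    by move: ad0; rewrite mulf_eq0 negb_or => /andP.
  have Va : V y (a y) = 0.
    move: Vad Oa Od; rewrite valM // Defs.val1 !inE /= !val_geE //; lia.
  have [||ca0 Vca] := @val_near _ (V y) (c y - a y) (- a y).
  - by rewrite oppr_eq0.
  - by rewrite valN Va add0r opprK subrK.
  by rewrite ca0 Vca valN Va eqxx.
have Uc : ideles Fc (c - e * a).
  apply: mk_idele => [y|]; first by case/andP: (okc y).
  have fin4 : finite_set ([set y | a y \notin valring (V y)] `|`
      [set y | b y \notin valring (V y)] `|`
      [set y | c y \notin valring (V y)] `|`
      [set y | d y \notin valring (V y)]).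
    by rewrite !finite_setU; do !split; apply: adele_fin.
  apply: sub_finite_set fin4 => y; rewrite /mkset => Vc.
  apply: contrapT.
  move=> /not_orP[/not_orP[/not_orP[/negP Oa /negP Ob] /negP Oc] /negP Od].
  move/negP: Vc; apply; case/andP: (okc y) => _ /implyP; apply.
  by rewrite /int (negbNE Oa) (negbNE Ob) (negbNE Oc) (negbNE Od).
(* Once the lower left entry [c'] is invertible, with inverse [w], the two upper unipotent factors
   are dictated by the diagonal entries [a] and [d']; the upper right entry then follows from the
   determinant. *)
have [_ [w _ cw]] := Uc; pose c' := c - e * a; pose d' := d - e * b.
exists e, ((a - 1) * w), c', ((d' - 1) * w).
have dt' : a * d' - b * c' = 1 by rewrite -dt /d' /c'; ring.
have aE : 1 + (a - 1) * w * c' = a.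
  have -> : (a - 1) * w * c' = (a - 1) * (c' * w) by ring.
  by rewrite cw mulr1 addrC subrK.
have dE : c' * ((d' - 1) * w) + 1 = d'.
  have -> : c' * ((d' - 1) * w) = (d' - 1) * (c' * w) by ring.
  by rewrite cw mulr1 subrK.
rewrite /e21 /e12 !mul_mx2 !(mul0r, mulr0, mul1r, mulr1, add0r, addr0).
rewrite dE aE.
have bE : (d' - 1) * w + (a - 1) * w * d' = b.
  have -> : (d' - 1) * w + (a - 1) * w * d' = (a * d' - 1) * w by ring.
  have -> : a * d' - 1 = b * c' by rewrite -dt'; ring.
  by rewrite -mulrA cw mulr1.
by rewrite bE /c' /d' !(addrC (e * _)) !subrK.
Qed.

Lemma SL2_similar_off h X : \det h = 1 -> GA X -> similar_off (h *m X) X.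
Proof.
move=> /SL2_elementary[e [a [b [c ->]]]] GX.
have [U1 _ _] := units_of_setT_subgroup A.
have G12 s Y : GA Y -> GA (e12 s *m Y).
  move=> GY; apply: (GL2M HT) => //; apply/GL2_idele.
  by rewrite det_mx2 mulr1 mulr0 subr0.
have G21 s Y : GA Y -> GA (e21 s *m Y).
  move=> GY; apply: (GL2M HT) => //; apply/GL2_idele.
  by rewrite det_mx2 mulr1 mul0r subr0.
rewrite -!mulmxA.
have G1 := G12 c X GX; have G2 := G21 b _ G1; have G3 := G12 a _ G2.
apply: similar_off_trans (e21_similar_off e G3) _.
apply: similar_off_trans (e12_similar_off a G2) _.
apply: similar_off_trans (e21_similar_off b G1) _.
exact: e12_similar_off.
Qed.

(** Equal labels mean that the determinants differ by a function [f], an integral unit [u] and a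
    square. Diagonal matrices over [F] and over the integral adeles, and the scalar [s], absorb
    these without leaving the double coset, which leaves a factor of determinant 1. *)
Lemma same_label_connected g h : GA g -> GA h -> label g = label h ->
  connected_in pix (dcoset g) (dcoset h).
Proof.
move=> Gg Gh /class_mod2P[_ [_ [s [[f Uf [u Uu ->]] Us ->]]] gh].
have Df : GL2 (diag_field Fc) (mx2 f 0 0 1).
  have HD := diag_field_subring; apply: (GL2_intro HD).
    do 2!apply: ord2P; rewrite mx2E; first by case: Uf.
    - exact: (subring0 HD).
    - exact: (subring0 HD).
    - exact: (subring1 HD).
  by rewrite det_mx2 mulr1 mulr0 subr0.
have Du : GL2 (int_adele Fc) (mx2 u 0 0 1).
  have HD := int_adele_subring; apply: (GL2_intro HD).
    do 2!apply: ord2P; rewrite mx2E; first by case: Uu.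
    - exact: (subring0 HD).
    - exact: (subring0 HD).
    - exact: (subring1 HD).
  by rewrite det_mx2 mulr1 mulr0 subr0.
pose h1 := s *: (mx2 f 0 0 1 *m h *m mx2 u 0 0 1).
have hh1 : dcoset h = dcoset h1.
  apply/dcoset_eqP; exists (mx2 f 0 0 1) => //; exists (mx2 u 0 0 1) => //.
  by exists s.
have dh1 : \det h1 = \det g.
  by rewrite gh detZ !det_mulmx !det_mx2 !(mulr1, mulr0, subr0) expr2; ring.
have Gh1 : GA h1 by apply/GL2_idele; rewrite dh1; apply/GL2_idele.
have [_ [h1' _ [hh' h'h]]] := Gh1.
rewrite hh1; have -> : g = (g *m h1') *m h1 by rewrite -mulmxA h'h mulmx1.
apply: similar_off_connected => //; apply: SL2_similar_off => //.
rewrite det_mulmx -dh1 -det_mulmx hh' det1 //.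
Qed.

End Graph.

(** * Components and labels *)

Section Components.
Variables (F : fieldType) (growthF : forall z : F, growth_bounded z).
Variable Fc : forall y : place F, completion y.
Variable k0 : seq F.
Hypothesis k0P : forall f, integral_on setT f -> f \in k0.
Variables (x : place F) (pix : Fc x) (hpix : compl_val (Fc x) pix = 1).
Local Notation A := (adele Fc).
Local Notation H := (@principal_ideles F Fc).
Local Notation HL := (square_extension H).
Local Notation p := (idele_pi pix).
Local Notation GA := (GL2 [set: A]).
Local Notation conn := (connected_in pix).
Implicit Types (g h : 'M[A]_2) (C D : set (set 'M[A]_2)).

Let HH : is_unit_subgroup H. Proof. exact: principal_ideles_subgroup. Qed.
Let HLs : is_unit_subgroup HL. Proof. exact: square_extension_subgroup. Qed.
Let HT : is_subring [set: A]. Proof. by []. Qed.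
Let labelP g h : label g = label h <-> eqmod HL (\det g) (\det h).
Proof. exact: class_mod2P. Qed.

Lemma twice_class_groupP : twice_class_group Fc (idele_class p) <-> HL p.
Proof.
have [_ _ HV] := HH; split.
  move=> [c Uc]; rewrite !idele_classE => /(eqmod_coset HH)[h Hh cc].
  have [h' Hh' hh'] := HV h Hh; exists h', c; split=> //.
  by rewrite cc mulrCA [h' * h]mulrC hh' mulr1.
move=> [h [c [Hh Uc pE]]]; exists c => //; rewrite !idele_classE.
by apply/(eqmod_coset HH)/eqmod_sym => //; exists h; rewrite // pE mulrC.
Qed.

Lemma GL2_xi g w : GA g -> GA (g *m xi pix w).
Proof.
move=> /GL2_idele Ug; apply/GL2_idele; rewrite det_mulmx det_xi.
have [_ UM _] := units_of_setT_subgroup A; apply: UM => //.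
exact: idele_pi_idele.
Qed.

Lemma label_xi g w : label (g *m xi pix w) = class_mod2 (\det g * p).
Proof. by rewrite /label det_mulmx det_xi. Qed.

(** The group generated by [HL] and [p]; two cosets suffice because [p * p] is a square. *)
Let HLp := [set s : A | HL s \/ exists2 h, HL h & s = h * p].

Let HLp_subgroup : is_unit_subgroup HLp.
Proof.
have [HL1 HLM HLV] := HLs; have [U1 UM UV] := units_of_setT_subgroup A.
have [q Uq pq] := UV _ (idele_pi_idele hpix).
have sq s : ideles Fc s -> HL (s * s).
  by move=> Us; exists 1, s; split=> //; [case: HH|rewrite mul1r].
split; first by left.
- move=> a b [Ha|[a' Ha ->]] [Hb|[b' Hb ->]].
  + by left; apply: HLM.
  + by right; exists (a * b'); [apply: HLM|rewrite mulrA].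
  + by right; exists (a' * b); [apply: HLM|rewrite mulrAC].
  + left; rewrite mulrACA; apply: (HLM); first exact: HLM.
    by apply: sq; apply: idele_pi_idele.
- move=> a [Ha|[a' Ha ->]].
    by have [b Hb ab] := HLV a Ha; exists b => //; left.
  have [b Hb ab] := HLV a' Ha.
  exists (b * q); last by rewrite mulrACA ab pq mulr1.
  right; exists (b * (q * q)); first by apply: HLM => //; apply: sq.
  by rewrite -!mulrA [q * p]mulrC pq mulr1.
Qed.

(** Connectedness relates arbitrary sets of matrices, so the condition on determinants is put on
    representatives. The induction on paths proves it in both directions at once because of the
    symmetry steps. *)
Let reach (V W : set 'M[A]_2) := forall g, GA g -> V = dcoset g ->
  exists h, [/\ GA h, W = dcoset h & eqmod HLp (\det h) (\det g)].

Let HL_HLp a b : eqmod HL a b -> eqmod HLp a b.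
Proof. by move=> [s Hs ->]; exists s => //; left. Qed.

Let conn_reach V W : conn V W -> reach V W /\ reach W V.
Proof.
elim=> [{}V {}W [g Gg [w _ [-> ->]]]|{}V|{}V {}W _ [VW WV]
  |U1 U2 U3 _ [R12 R21] _ [R23 R32]].
- have HL1 : HL 1 by case: HLs.
  split=> g' Gg' gg'.
    exists (g *m xi pix w); split; [exact: GL2_xi|exact: erefl|].
    apply: (eqmod_trans HLp_subgroup (b := \det g)).
      rewrite det_mulmx det_xi; exists p => //; right; exists 1 => //.
      by rewrite mul1r.
    by apply/HL_HLp/labelP/label_dcoset.
  exists g; split=> //.
  apply: (eqmod_trans HLp_subgroup (b := \det (g *m xi pix w))).
    apply: eqmod_sym => //; rewrite det_mulmx det_xi; exists p => //; right.
    by exists 1; rewrite // mul1r.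
  by apply/HL_HLp/labelP/label_dcoset.
- by split=> g Gg ->; exists g; split=> //; apply: eqmod_refl.
- by [].
- split=> g Gg gE.
    have [h [Gh hE hg]] := R12 g Gg gE; have [h' [Gh' hE' hg']] := R23 h Gh hE.
    by exists h'; split=> //; apply: (eqmod_trans HLp_subgroup hg').
  have [h [Gh hE hg]] := R32 g Gg gE; have [h' [Gh' hE' hg']] := R21 h Gh hE.
  by exists h'; split=> //; apply: (eqmod_trans HLp_subgroup hg').
Qed.

Lemma connected_labels g h : GA g -> GA h -> conn (dcoset g) (dcoset h) ->
  label h = label g \/ label h = class_mod2 (\det g * p).
Proof.
move=> Gg Gh /conn_reach[/(_ g Gg erefl)[h' [Gh' hh' h'g]] _].
rewrite (label_dcoset growthF hh'); case: h'g => s [Hs|[t Ht ->]] E.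
  by left; apply/labelP; exists s.
by right; apply/class_mod2P => //; exists t; rewrite // E mulrAC mulrA.
Qed.

Lemma component_connected V C g h : C = component pix V ->
  C (dcoset g) -> C (dcoset h) -> conn (dcoset g) (dcoset h).
Proof.
move=> -> [_ Vg] [_ Vh]; apply: rst_trans Vh; exact: rst_sym.
Qed.

Lemma component_eq V W : conn V W -> component pix V = component pix W.
Proof.
move=> VW; apply/seteqP; split=> U [vU VU]; split=> //; apply: rst_trans VU => //.
exact: rst_sym.
Qed.

Section SquareCase.
Hypothesis psq : twice_class_group Fc (idele_class p).

Lemma label_connected g h : GA g -> GA h ->
  (label g = label h <-> conn (dcoset g) (dcoset h)).
Proof.
move=> Gg Gh; split; first exact: (same_label_connected growthF k0P hpix).
move=> /(connected_labels Gg Gh)[->//|->]; apply/class_mod2P => //.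
by apply: eqmod_sym => //; exists p => //; apply/twice_class_groupP.
Qed.

(** [Phi] sends a label to the set of vertices carrying it, which is a component by
    [label_connected]. Every class modulo squares is a label, since every idele is a determinant. *)
Lemma card_components :
  (components pix #= `I_(2 * #|` fset_set (class_group_2torsion Fc)|)%N)%card.
Proof.
pose Phi (l : set A) := [set W | exists g, [/\ GA g, label g = l & W = dcoset g]].
have PhiE g : GA g -> Phi (label g) = component pix (dcoset g).
  move=> Gg; apply/seteqP; split=> [_ [h [Gh hg ->]]|W [[h Gh <-] gh]].
    split; first by exists h.
    by apply/label_connected.
  by exists h; split=> //; apply/esym/label_connected.
have labelsE : [set class_mod2 a | a in ideles Fc] = [set label g | g in GA].
  apply/seteqP; split=> [_ [a Ua <-]|_ [g /GL2_idele Ug <-]]; last first.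
    by exists (\det g).
  exists (mx2 a 0 0 1); last by rewrite /label det_mx2 mulr1 mulr0 subr0.
  by apply/GL2_idele; rewrite det_mx2 mulr1 mulr0 subr0.
have cmpE : components pix = [set Phi l | l in [set label g | g in GA]].
  apply/seteqP; split=> [_ [_ [g Gg <-] <-]|_ [_ [g Gg <-] <-]].
    by exists (label g); [exists g|rewrite PhiE].
  by exists (dcoset g); [exists g|rewrite PhiE].
apply: card_eq_trans (card_class_mod2 growthF k0P hpix psq).
rewrite cmpE labelsE; apply: inj_card_eq.
move=> _ _ /set_mem[g Gg <-] /set_mem[h Gh <-] gh.
have : Phi (label h) (dcoset g) by rewrite -gh; exists g.
by move=> [h' [Gh' <- /(label_dcoset growthF)]].
Qed.

End SquareCase.

Section NonSquareCase.
Hypothesis npsq : ~ twice_class_group Fc (idele_class p).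

Lemma class_mod2_pi_neq a : ideles Fc a -> class_mod2 a <> class_mod2 (a * p).
Proof.
move=> [_ [b _ ab]] /(class_mod2P growthF)[s Hs E]; apply/npsq/twice_class_groupP.
have [_ _ HLV] := HLs; have [t Ht st] := HLV s Hs.
have -> : p = t; last by [].
have ps : p * s = 1.
  have -> : p * s = a * b * (p * s) by rewrite ab mul1r.
  have -> : a * b * (p * s) = a * p * s * b by ring.
  by rewrite -E ab.
by rewrite -[p]mulr1 -st mulrA ps mul1r.
Qed.

Lemma adjacent_labels g h : GA g -> GA h ->
  edge pix (dcoset g) (dcoset h) -> label g <> label h.
Proof.
move=> Gg Gh [g1 Gg1 [w _ [gg1 hg1]]].
rewrite (label_dcoset growthF gg1) (label_dcoset growthF hg1) label_xi.
by apply: class_mod2_pi_neq; apply/GL2_idele.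
Qed.

Lemma component_two_labels C : components pix C -> exists2 a, ideles Fc a &
  class_mod2 a <> class_mod2 (a * p) /\
  forall g, GA g -> C (dcoset g) ->
    label g = class_mod2 a \/ label g = class_mod2 (a * p).
Proof.
move=> [_ [g0 Gg0 <-] <-]; have Ug0 := (GL2_idele g0).1 Gg0.
exists (\det g0) => //; split; first exact: class_mod2_pi_neq.
by move=> g Gg [_ g0g]; apply: connected_labels.
Qed.

Lemma component_bipartite C : components pix C -> bipartite pix C.
Proof.
move=> /component_two_labels[a Ua [apa Ca]].
(* The colour classes are the two labels. Since [label] is defined on matrices, the colour of a
   vertex is defined through a representative; [label_dcoset] makes the choice immaterial. *)
pose red W := exists g, [/\ GA g, W = dcoset g & label g = class_mod2 a].
exists (fun W => `[< red W >]) => V W CV CW VW.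
have [g1 Gg1 [w _ [VE WE]]] := VW.
have Gw : GA (g1 *m xi pix w) by apply: GL2_xi.
have redP g U : GA g -> U = dcoset g -> red U <-> label g = class_mod2 a.
  move=> Gg ->; split; last by exists g.
  by move=> [h [Gh /(label_dcoset growthF) -> ->]].
have neq : label g1 <> label (g1 *m xi pix w).
  by apply: adjacent_labels => //; rewrite -VE -WE.
have Lg : label g1 = class_mod2 a \/ label g1 = class_mod2 (a * p).
  by apply: Ca => //; rewrite -VE.
have Lw : label (g1 *m xi pix w) = class_mod2 a \/
    label (g1 *m xi pix w) = class_mod2 (a * p).
  by apply: Ca => //; rewrite -WE.
apply/eqP => redVW; apply: neq.
have rVW : red V -> red W by move/asboolP; rewrite redVW => /asboolP.
have rWV : red W -> red V by move/asboolP; rewrite -redVW => /asboolP.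
have Vred := redP _ _ Gg1 VE; have Wred := redP _ _ Gw WE.
case: Lg => Eg; first by rewrite Eg; apply/esym/Wred/rVW/Vred.
by case: Lw => Ew; [rewrite Ew; apply/Vred/rWV/Wred|rewrite Eg Ew].
Qed.

End NonSquareCase.

End Components.

Theorem proposition4p2 (k : finFieldType) (F : fieldExtType {fraction {poly k}})
    (hF : constants_closed F)
    (Fc : forall y : place F, completion y)
    (x : place F) (pix : Fc x) (hpix : compl_val (Fc x) pix = 1) :
  let cl2 := class_group_2torsion Fc in
  let h2 := #|` fset_set cl2 |%fset in
  let GA := GL2 [set: adele Fc] in
  finite_set cl2 /\
  (twice_class_group Fc (idele_class (idele_pi pix)) ->
    [/\ forall C, components pix C -> forall g g', GA g -> GA g' ->
          C (dcoset g) -> C (dcoset g') -> label g = label g',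
        (components pix #= `I_(2 * h2)%N)%card
      & forall C C', components pix C -> components pix C' ->
          forall g g', GA g -> GA g' -> C (dcoset g) -> C' (dcoset g') ->
          C <> C' -> label g <> label g']) /\
  (~ twice_class_group Fc (idele_class (idele_pi pix)) ->
    [/\ forall C, components pix C ->
          exists2 a, ideles Fc a &
            class_mod2 a <> class_mod2 (a * idele_pi pix) /\
            forall g, GA g -> C (dcoset g) ->
              label g = class_mod2 a \/ label g = class_mod2 (a * idele_pi pix),
        forall g g', GA g -> GA g' ->
          edge pix (dcoset g) (dcoset g') -> label g <> label g'
      & forall C, components pix C -> bipartite pix C]).
Proof.
have growthF : forall z : F, growth_bounded z := @function_field_growth k F.
pose k0 := [seq Defs.constant F c | c : k].
(* A function without poles is algebraic over [k], since otherwise [place_with_pole] would give it a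
   pole; [hF] then puts it among the finitely many constants. *)
have k0P (f : F) : integral_on setT f -> f \in k0.
  move=> fint; have alg : algebraicOver (@Defs.constant k F) f.
    apply: contrapT => nalg.
    pose phi : {rmorphism k -> F} := in_alg F \o (@tofrac {poly k} \o polyC).
    have [v] := @place_with_pole k F phi f growthF nalg.
    have f0 : f != 0.
      apply: contra_notN nalg => /eqP ->; exists 'X; first by rewrite polyX_eq0.
      by rewrite (map_polyX phi) rootE hornerX.
    by have := fint v I; rewrite val_geE //; lia.
  by have [c ->] := hF f alg; apply: map_f; rewrite mem_enum.
move=> cl2 h2 GA; split.
  exact: (finite_class_group_2torsion growthF k0P hpix).
split=> psq; split.
- move=> C [V _ CV] g g' Gg Gg' Cg Cg'.
  apply/(label_connected growthF k0P hpix psq) => //.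
  exact: (component_connected (esym CV)).
- exact: (card_components growthF k0P hpix psq).
- move=> C C' [V _ CV] [V' _ CV'] g g' Gg Gg' Cg Cg' CC' lgg'; apply: CC'.
  have gg' : connected_in pix (dcoset g) (dcoset g').
    by apply/(label_connected growthF k0P hpix psq).
  move: Cg Cg'; rewrite -CV -CV' => -[_ Vg] [_ Vg'].
  by rewrite (component_eq Vg) (component_eq Vg'); apply: component_eq.
- exact: (component_two_labels growthF hpix psq).
- by move=> g g' Gg Gg'; apply: (adjacent_labels growthF psq).
- exact: (component_bipartite growthF hpix psq).
Qed.
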